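(* Let $(\mathfrak{B},\mathfrak{A},\mathfrak{C},Q,B_i)$ be a boundary node on the Hilbert spaces $(U_b,U,X,Y)$. Let $\mathfrak{K}\in\mathcal{L}(D(\mathfrak{A}),U)$, $L\in\mathcal{L}(Y,U_b)$, and $L_i\in\mathcal{L}(Y,X)$ be such that $(\mathfrak{B}-Q\mathfrak{K},\mathfrak{A}+B_i\mathfrak{K},\mathfrak{C},Q,B_i)$ is a boundary node with a well-posed input map and $(\mathfrak{B}-L\mathfrak{C},\mathfrak{A}+L_i\mathfrak{C},\mathfrak{K},Q,B_i)$ is a boundary node with a well-posed output map. Denote by $T_K$ and $T_L$ the semigroups generated by $A_K=(\mathfrak{A}+B_i\mathfrak{K})|_{\mathrm{Ker}(\mathfrak{B}-Q\mathfrak{K})}$ and $A_L=(\mathfrak{A}+L_i\mathfrak{C})|_{\mathrm{Ker}(\mathfrak{B}-L\mathfrak{C})}$, respectively. Then the operator $A_e=\mathfrak{A}_e|_{\mathrm{Ker}(\mathfrak{B}_e)}$, where $$\mathfrak{A}_e=\begin{bmatrix}\mathfrak{A}&B_i\mathfrak{K}\\-L_i\mathfrak{C}&\mathfrak{A}+B_i\mathfrak{K}+L_i\mathfrak{C}\end{bmatrix},\quad \mathfrak{B}_e=\begin{bmatrix}\mathfrak{B}&-Q\mathfrak{K}\\L\mathfrak{C}&\mathfrak{B}-Q\mathfrak{K}-L\mathfrak{C}\end{bmatrix},\quad D(\mathfrak{A}_e)=D(\mathfrak{A})\times D(\mathfrak{A}),$$ generates a strongly continuous semigroup $T_e$ on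 $X_e=X\times X$ and the following hold. (a) If $T_K$ and $T_L$ are exponentially stable, then $T_e$ is exponentially stable with growth bound $\omega_0(T_e)=\max\{\omega_0(T_K),\omega_0(T_L)\}$. (b) If $T_K$ is strongly stable and $T_L$ is exponentially stable (or vice versa), then $T_e$ is strongly stable. (c) If $T_K$ is polynomially stable with exponent $\alpha>0$ and $T_L$ is exponentially stable (or vice versa), then $T_e$ is polynomially stable with exponent $\alpha>0$.
   Context: Notation. $\mathcal{L}(X,Y)$ denotes the bounded linear operators and $\omega_0(T)$ the growth bound of a strongly continuous semigroup $T$. Boundary node. A tuple $(\mathfrak{B},\mathfrak{A},\mathfrak{C},Q,B_i)$ is a boundary node on the Hilbert spaces $(U_b,U,X,Y)$ if: (i) $\mathfrak{A}:D(\mathfrak{A})\subset X\to X$ is linear, $\mathfrak{B}\in\mathcal{L}(D(\mathfrak{A}),U_b)$, $\mathfrak{C}\in\mathcal{L}(D(\mathfrak{A}),Y)$, $Q\in\mathcal{L}(U,U_b)$, $B_i\in\mathcal{L}(U,X)$; (ii) the restriction $A=\mathfrak{A}|_{\mathrm{Ker}(\mathfrak{B})}$ with domain $D(A)=\mathrm{Ker}(\mathfrak{B})$ generates a strongly continuous semigroup on $X$; (iii) there is $\mathfrak{B}^r\in\mathcal{L}(U_b,D(\mathfrak{A}))$ with $\mathfrak{B}\mathfrak{B}^r=I$. Here $D(\mathfrak{A})$ carries a Hilbert space norm for which the embedding $D(\mathfrak{A})\hookrightarrow X$ and $\mathfrak{A}:D(\mathfrak{A})\to X$ are bounded (such as the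 graph norm of $\mathfrak{A}$); for other nodes built on the same domain (or products of it) the same norm (or product norm) is used. Input and output maps. For $x_0\in D(\mathfrak{A})$ and $u\in C^2([0,\tau];U)$ with $\mathfrak{B}x_0=Qu(0)$ the system $\dot x=\mathfrak{A}x+B_iu$, $x(0)=x_0$, $\mathfrak{B}x=Qu$, $y=\mathfrak{C}x$ has a unique classical solution $(x,u,y)$ on $[0,\tau]$ ($x\in C^1$, $x(t)\in D(\mathfrak{A})$, $y$ continuous, equations hold pointwise). The boundary node has a well-posed input map if there exist $\tau,M_\tau>0$ such that $\|x(\tau)\|_X\le M_\tau\|u\|_{L^2(0,\tau)}$ for all $u\in C^2([0,\tau];U)$ with $u(0)=0$, where $x$ is the classical solution with $x_0=0$. It has a well-posed output map if there exist $\tau,M_\tau>0$ such that $\|y\|_{L^2(0,\tau)}\le M_\tau\|x_0\|_X$ for all $x_0\in D(A)$, where $y$ is the output of the classical solution with $u\equiv0$. Stability. $T$ is exponentially stable if $\omega_0(T)<0$; strongly stable if $T(t)x\to0$ as $t\to\infty$ for all $x$; polynomially stable with exponent $\alpha>0$ if $T$ is bounded and there exist $M,t_0>0$ such that $\|T(t)x\|\le Mt^{-\alpha}(\|Ax\|+\|x\|)$ for all $t\ge t_0$, $x\in D(A)$, where $A$ is the generator of $T$. *)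

(* Defs.v *)
From Stdlib Require Export Reals.
From Coquelicot Require Export Coquelicot.
Open Scope R_scope.

Inductive scalar_field := RealField | ComplexField.

Definition scalars (F : scalar_field) : AbsRing :=
  match F with RealField => R_AbsRing | ComplexField => C_AbsRing end.

Coercion scalars : scalar_field >-> AbsRing.

Definition ofR {F : scalar_field} : R -> F :=
  match F return R -> F with
  | RealField => fun r => r
  | ComplexField => RtoC
  end.

Definition conj {F : scalar_field} : F -> F :=
  match F return F -> F with
  | RealField => fun r => r
  | ComplexField => Cconj
  end.

Record HilbertSpace (F : scalar_field) := {
  hilbert_sort :> CompleteNormedModule F;
  inner : hilbert_sort -> hilbert_sort -> F;
  inner_plus : forall x y z, inner (plus x y) z = plus (inner x z) (inner y z);
  inner_scal : forall k x y, inner (scal k x) y = mult k (inner x y);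
  inner_conj : forall x y, inner y x = conj (inner x y);
  inner_norm : forall x, inner x x = ofR (norm x ^ 2)
}.

(** The norm of [prod_NormedModule] is the Euclidean one, so
    [prod_NormedModule F X X] below is the Hilbert space product [X * X]. *)

(** Unbounded operators on [V] are represented by their graphs, as relations
    [V -> V -> Prop].  A semigroup is a function on [R] of which only the
    values at [t >= 0] matter. *)

Definition C0_semigroup {F : scalar_field} {V : NormedModule F}
    (T : R -> V -> V) : Prop :=
  (forall t, 0 <= t -> is_linear (T t)) /\
  (forall x, T 0 x = x) /\
  (forall s t x, 0 <= s -> 0 <= t -> T (s + t) x = T s (T t x)) /\
  (forall x, filterlim (fun t => T t x) (at_right 0) (locally x)).

Definition generator {F : scalar_field} {V : NormedModule F}
    (T : R -> V -> V) (x y : V) : Prop :=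
  filterlim (fun t => scal (ofR (/ t)) (minus (T t x) x))
    (at_right 0) (locally y).

Definition generates {F : scalar_field} {V : NormedModule F}
    (A : V -> V -> Prop) (T : R -> V -> V) : Prop :=
  C0_semigroup T /\ forall x y, A x y <-> generator T x y.

Definition growth_bound {F : scalar_field} {V : NormedModule F}
    (T : R -> V -> V) : Rbar :=
  Glb_Rbar (fun w => exists M, forall t x, 0 <= t ->
    norm (T t x) <= M * exp (w * t) * norm x).

Definition Rbar_max (a b : Rbar) : Rbar := if Rbar_le_dec a b then b else a.

Definition exponentially_stable {F : scalar_field} {V : NormedModule F}
    (T : R -> V -> V) : Prop :=
  Rbar_lt (growth_bound T) 0.

Definition strongly_stable {F : scalar_field} {V : NormedModule F}
    (T : R -> V -> V) : Prop :=
  forall x, filterlim (fun t => T t x) (Rbar_locally p_infty) (locally (zero : V)).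

Definition polynomially_stable {F : scalar_field} {V : NormedModule F}
    (alpha : R) (T : R -> V -> V) : Prop :=
  (exists M, forall t x, 0 <= t -> norm (T t x) <= M * norm x) /\
  (exists M t0, 0 < M /\ 0 < t0 /\
     forall t x Ax, t0 <= t -> generator T x Ax ->
       norm (T t x) <= M * Rpower t (- alpha) * (norm Ax + norm x)).

(** The domain D(fA), with its own Hilbert space norm, is a space [Z] together
    with a bounded injection [j : Z -> X]; the subspace D(fA) of [X] is the
    range of [j], and an element [x] of D(fA) is written [j z]. *)

(** Graph of the restriction of [fA] to the kernel of [fB]. *)
Definition restrict_ker {F : scalar_field} {Z X Ub : NormedModule F}
    (j fA : Z -> X) (fB : Z -> Ub) (x y : X) : Prop :=
  exists z, fB z = zero /\ j z = x /\ fA z = y.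

Record boundary_node {F : scalar_field} {Z Ub U X Y : HilbertSpace F}
    (j : Z -> X) (fB : Z -> Ub) (fA : Z -> X) (fC : Z -> Y)
    (Q : U -> Ub) (Bi : U -> X) : Prop := {
  node_j : is_linear j;
  node_j_inj : forall z z', j z = j z' -> z = z';
  node_fA : is_linear fA;
  node_fB : is_linear fB;
  node_fC : is_linear fC;
  node_Q : is_linear Q;
  node_Bi : is_linear Bi;
  node_generates : exists T, generates (restrict_ker j fA fB) T;
  node_right_inverse :
    exists fBr : Ub -> Z, is_linear fBr /\ forall v, fB (fBr v) = v
}.

Definition Icc (a b t : R) : Prop := a <= t <= b.

(** [df] is the derivative of [f] relative to [D], hence one-sided at the
    endpoints when [D] is a compact interval. *)
Definition derive_on {F : scalar_field} {V : NormedModule F}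
    (D : R -> Prop) (f df : R -> V) : Prop :=
  forall t, D t ->
    filterlim (fun s => scal (ofR (/ (s - t))) (minus (f s) (f t)))
      (within D (locally' t)) (locally (df t)).

Definition C2_on {F : scalar_field} {V : NormedModule F}
    (D : R -> Prop) (f : R -> V) : Prop :=
  exists f' f'', derive_on D f f' /\ derive_on D f' f'' /\ continuous_on D f''.

Definition L2norm {F : scalar_field} {V : NormedModule F}
    (tau : R) (f : R -> V) : R :=
  sqrt (RInt (fun t => norm (f t) ^ 2) 0 tau).

(** The state [x] takes its values in [Z], i.e. in D(fA), but continuity and
    differentiability are with respect to the norm of [X]. *)
Definition classical_solution {F : scalar_field} {Z Ub U X Y : HilbertSpace F}
    (j : Z -> X) (fB : Z -> Ub) (fA : Z -> X) (fC : Z -> Y)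
    (Q : U -> Ub) (Bi : U -> X)
    (tau : R) (x0 : Z) (x : R -> Z) (u : R -> U) (y : R -> Y) : Prop :=
  let D := Icc 0 tau in
  let dx := fun t => plus (fA (x t)) (Bi (u t)) in
  x 0 = x0 /\
  derive_on D (fun t => j (x t)) dx /\
  continuous_on D dx /\
  continuous_on D y /\
  forall t, D t -> fB (x t) = Q (u t) /\ y t = fC (x t).

Definition wellposed_input_map {F : scalar_field} {Z Ub U X Y : HilbertSpace F}
    (j : Z -> X) (fB : Z -> Ub) (fA : Z -> X) (fC : Z -> Y)
    (Q : U -> Ub) (Bi : U -> X) : Prop :=
  exists tau M, 0 < tau /\ 0 < M /\
    forall x u y, C2_on (Icc 0 tau) u -> u 0 = zero ->
      classical_solution j fB fA fC Q Bi tau zero x u y ->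
      norm (j (x tau)) <= M * L2norm tau u.

Definition wellposed_output_map {F : scalar_field} {Z Ub U X Y : HilbertSpace F}
    (j : Z -> X) (fB : Z -> Ub) (fA : Z -> X) (fC : Z -> Y)
    (Q : U -> Ub) (Bi : U -> X) : Prop :=
  exists tau M, 0 < tau /\ 0 < M /\
    forall x0 x y, fB x0 = zero ->
      classical_solution j fB fA fC Q Bi tau x0 x (fun _ => zero) y ->
      L2norm tau y <= M * norm (j x0).

(* Main.v *)
From Stdlib Require Import Lra Lia Psatz List.
From Stdlib Require Import Classical ClassicalEpsilon IndefiniteDescription.
From Stdlib Require Import FunctionalExtensionality PropExtensionality.
Require Import Defs.

(** The closed loop becomes a cascade when the second component [x2] is replaced
    by the error [e = x2 - x1].  The boundary condition and the differential
    equation of [e] are those of the free motion under [A_L], and [x1] is the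
    state of the boundary node of [A_K] driven by the input [u = fK e]
    ([closed_loop_cascade]).  So the semigroup sought is similar to
    [S t (x, e) = (T_K t x + Gam t e, T_L t e)], where [Gam t e] is the state
    reached from zero at time [t] under the observation [fK] of the orbit of
    [e].

    The operators [Gam t] are bounded because the output map of the second node
    sends [e] boundedly into [L2] and the input map of the first one sends [L2]
    boundedly into [X].  To make this precise, [e] is first taken in the domain
    of [A_L ^ 3].  The observation [u] is then twice continuously differentiable
    ([lift_orbit_integral]) and [Gam t e] has an explicit formula ([response]).
    The input map is only controlled for inputs with [u 0 = 0] and at one final
    time; delaying [u] and switching it on by a short cut-off reduces to that
    case ([response_bound]).  The existence of the classical solutions that
    well-posedness speaks about is Duhamel's formula ([generator_conv]).  That
    [fK] is continuous for the graph norm of [A_L], and that outputs are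
    continuous in time, rests on the equivalence of this norm with that of [Z]
    on the kernel of the boundary operator: a closed graph argument
    ([lift_graph_bound]), which like the uniform boundedness principle comes from
    Zabreiko's lemma ([countably_subadditive_bounded]).  A density argument
    defines [Gam t] on the whole space ([coupling_operators]).

    Domain and generator of [S] are computed in [triangular_generator].  For
    smooth [e] one expands the formula of [Gam t e] at [t = 0]; closedness of
    the generator and density give the rest of one inclusion, and subtracting
    [(E (fK e), e)] the other one, where [E u] is a state with boundary value
    [Q u].

    All stability statements come from the composition law
    [Gam (t + s) = T_K t o Gam s + Gam t o T_L s].
    - Iterated over integer times it bounds [Gam] by the convolution of the
      rates of [T_K] and [T_L] ([coupling_growth]).  This gives the growth bound
      of [S], and that [Gam] is uniformly bounded when one semigroup is bounded
      and the other exponentially stable.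
    - For strong stability, [s] is chosen such that [T_L s e] is small, and then
      [t] is large.
    - For polynomial stability, [t = s]: the second half of the time damps the
      state [x1] reached at time [s], while the error at time [s] has already
      decayed.  The state itself is not in the domain of [A_K], but
      [x1 - E (fK e)] is, and its image under [A_K] is controlled by the rate of
      change of the orbit ([damped_of_polynomial]). *)

(** * Identities between vectors *)

Lemma abs_ofR {F : scalar_field} (r : R) : abs (ofR r : F) = Rabs r.
Proof. destruct F; simpl; [reflexivity | apply Cmod_R]. Qed.

Lemma ofR_plus {F : scalar_field} (r s : R) :
  (ofR (r + s) : F) = plus (ofR r) (ofR s).
Proof. destruct F; simpl; [reflexivity | apply RtoC_plus]. Qed.

Lemma ofR_mult {F : scalar_field} (r s : R) :
  (ofR (r * s) : F) = mult (ofR r) (ofR s).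
Proof. destruct F; simpl; [reflexivity | apply RtoC_mult]. Qed.

Lemma ofR_one {F : scalar_field} : (ofR 1 : F) = one.
Proof. destruct F; reflexivity. Qed.

Lemma ofR_zero {F : scalar_field} : (ofR 0 : F) = zero.
Proof. destruct F; reflexivity. Qed.

Lemma ofR_opp {F : scalar_field} (r : R) : (ofR (- r) : F) = opp (ofR r).
Proof. destruct F; simpl; [reflexivity | apply RtoC_opp]. Qed.

(** Real multiples under a head symbol of their own, so that [norm_rscal] can
    be used for rewriting whatever the scalar field is. *)
Definition rscal {F : scalar_field} {V : NormedModule F} (r : R) (x : V) : V :=
  scal (ofR r) x.

(** Formal linear combinations with real coefficients; only their coefficients
    matter when two of them are compared. *)
Inductive vexpr :=
  | VZero
  | VAtom (n : nat)
  | VPlus (a b : vexpr)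
  | VOpp (a : vexpr)
  | VScal (r : R) (a : vexpr).

Section VectorIdentities.
Context {F : scalar_field} {V : NormedModule F}.

Fixpoint vdenote (env : list V) (e : vexpr) : V :=
  match e with
  | VZero => zero
  | VAtom n => nth n env zero
  | VPlus a b => plus (vdenote env a) (vdenote env b)
  | VOpp a => opp (vdenote env a)
  | VScal r a => scal (ofR r) (vdenote env a)
  end.

Fixpoint vcoef (e : vexpr) (i : nat) : R :=
  match e with
  | VZero => 0
  | VAtom n => if Nat.eqb n i then 1 else 0
  | VPlus a b => vcoef a i + vcoef b i
  | VOpp a => - vcoef a i
  | VScal r a => r * vcoef a i
  end.

Fixpoint vcomb (env : list V) (c : nat -> R) : V :=
  match env with
  | nil => zero
  | x :: env' => plus (scal (ofR (c O)) x) (vcomb env' (fun i => c (S i)))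
  end.

Fixpoint vagree (n : nat) (c d : nat -> R) : Prop :=
  match n with
  | O => True
  | S n' => c O = d O /\ vagree n' (fun i => c (S i)) (fun i => d (S i))
  end.

Lemma vcomb_agree env : forall c d, vagree (length env) c d -> vcomb env c = vcomb env d.
Proof.
  induction env as [|x env IH]; intros c d; simpl; [reflexivity|].
  intros [-> H]. now rewrite (IH _ _ H).
Qed.

Lemma vcomb_ext env : forall c d, (forall i, c i = d i) -> vcomb env c = vcomb env d.
Proof.
  induction env as [|x env IH]; intros c d H; simpl; [reflexivity|].
  rewrite (H O). f_equal. apply IH. intros i. apply H.
Qed.

Lemma scal_zero_ofR (x : V) : scal (ofR 0) x = zero.
Proof. rewrite ofR_zero. exact (scal_zero_l x). Qed.

Lemma vcomb_zero env : vcomb env (fun _ => 0) = zero.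
Proof.
  induction env as [|x env IH]; simpl; [reflexivity|].
  now rewrite IH, scal_zero_ofR, plus_zero_r.
Qed.

Lemma vcomb_atom env : forall n,
  vcomb env (fun i => if Nat.eqb n i then 1 else 0) = nth n env zero.
Proof.
  induction env as [|x env IH]; intros [|n]; simpl; try reflexivity.
  - rewrite vcomb_zero, plus_zero_r, ofR_one. exact (scal_one x).
  - rewrite IH, scal_zero_ofR. apply plus_zero_l.
Qed.

Lemma scal_ofR_plus r s (x : V) :
  scal (ofR (r + s)) x = plus (scal (ofR r) x) (scal (ofR s) x).
Proof. rewrite ofR_plus. exact (scal_distr_r (ofR r) (ofR s) x). Qed.

Lemma scal_ofR_mult r s (x : V) : scal (ofR (r * s)) x = scal (ofR r) (scal (ofR s) x).
Proof. rewrite ofR_mult. symmetry. exact (scal_assoc (ofR r) (ofR s) x). Qed.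

Lemma vcomb_plus env : forall c d,
  vcomb env (fun i => c i + d i) = plus (vcomb env c) (vcomb env d).
Proof.
  induction env as [|x env IH]; intros c d; simpl; [now rewrite plus_zero_r|].
  rewrite IH, scal_ofR_plus.
  rewrite <- !plus_assoc. f_equal. rewrite !plus_assoc. f_equal. apply plus_comm.
Qed.

Lemma vcomb_scal env r : forall c,
  vcomb env (fun i => r * c i) = scal (ofR r) (vcomb env c).
Proof.
  induction env as [|x env IH]; intros c; simpl.
  - symmetry. exact (scal_zero_r (V := NormedModule.ModuleSpace F V) _).
  - rewrite IH, scal_ofR_mult. symmetry. exact (scal_distr_l _ _ _).
Qed.

Lemma scal_opp_one_ofR (x : V) : scal (ofR (-1)) x = opp x.
Proof.
  replace (-1) with (- (1)) by ring. rewrite ofR_opp, ofR_one.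
  exact (scal_opp_one x).
Qed.

Lemma vcomb_coef env e : vdenote env e = vcomb env (vcoef e).
Proof.
  induction e as [|n|a IHa b IHb|a IHa|r a IHa]; simpl.
  - symmetry; apply vcomb_zero.
  - symmetry; apply vcomb_atom.
  - now rewrite vcomb_plus, IHa, IHb.
  - rewrite IHa, <- scal_opp_one_ofR, <- vcomb_scal. apply vcomb_ext. intros i; ring.
  - now rewrite vcomb_scal, IHa.
Qed.

(** A vector identity holds as soon as each atom has the same coefficient on
    both sides; [vmod] below reifies the two sides and leaves the comparison
    of real coefficients to [field]. *)
Lemma vdenote_eq (env : list V) (e1 e2 : vexpr) :
  vagree (length env) (vcoef e1) (vcoef e2) -> vdenote env e1 = vdenote env e2.
Proof. intros H. rewrite !vcomb_coef. now apply vcomb_agree. Qed.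

End VectorIdentities.

Ltac v_index x l :=
  lazymatch l with
  | cons x _ => constr:(O)
  | cons _ ?l' => let n := v_index x l' in constr:(S n)
  end.

Ltac v_add x l :=
  lazymatch l with
  | context [cons x _] => l
  | _ => constr:(cons x l)
  end.

Ltac v_atoms t l :=
  lazymatch t with
  | plus ?a ?b => let l1 := v_atoms a l in v_atoms b l1
  | minus ?a ?b => let l1 := v_atoms a l in v_atoms b l1
  | opp ?a => v_atoms a l
  | scal (ofR _) ?a => v_atoms a l
  | rscal _ ?a => v_atoms a l
  | zero => l
  | _ => v_add t l
  end.

Ltac v_reify t l :=
  lazymatch t with
  | plus ?a ?b => let x := v_reify a l in let y := v_reify b l in constr:(VPlus x y)
  | minus ?a ?b => let x := v_reify a l in let y := v_reify b l in constr:(VPlus x (VOpp y))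
  | opp ?a => let x := v_reify a l in constr:(VOpp x)
  | scal (ofR ?r) ?a => let x := v_reify a l in constr:(VScal r x)
  | rscal ?r ?a => let x := v_reify a l in constr:(VScal r x)
  | zero => constr:(VZero)
  | _ => let n := v_index t l in constr:(VAtom n)
  end.

Ltac vmod_coefs :=
  lazymatch goal with
  | |- @eq ?T ?a ?b =>
      let l0 := v_atoms a (@nil T) in
      let l := v_atoms b l0 in
      let e1 := v_reify a l in
      let e2 := v_reify b l in
      refine (vdenote_eq l e1 e2 _);
      cbn [vagree vcoef length Nat.eqb]; repeat split
  end.

Ltac vmod := vmod_coefs; try ring; try (field; lra).

(** * Norms and limits *)

Section Norms.
Context {F : scalar_field} {V : NormedModule F}.

(** The axioms of a norm only bound the norm of a multiple from above; the
    inverse scalar gives the other inequality. *)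
Lemma norm_rscal (r : R) (x : V) : norm (rscal r x) = Rabs r * norm x.
Proof.
  unfold rscal. apply Rle_antisym.
  - rewrite <- (abs_ofR (F := F)). apply norm_scal.
  - destruct (Req_dec r 0) as [->|Hr].
    + rewrite Rabs_R0, Rmult_0_l. apply norm_ge_0.
    + apply (Rmult_le_reg_l (/ Rabs r)).
      { apply Rinv_0_lt_compat, Rabs_pos_lt, Hr. }
      rewrite <- Rmult_assoc, Rinv_l, Rmult_1_l by now apply Rabs_no_R0.
      replace x with (scal (ofR (/ r)) (scal (ofR r) x)) at 1 by vmod.
      rewrite <- Rabs_inv, <- (abs_ofR (F := F)). apply norm_scal.
Qed.

Lemma norm_minus_sym (x y : V) : norm (minus x y) = norm (minus y x).
Proof. rewrite <- norm_opp. f_equal. vmod. Qed.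

Lemma norm_minus_triangle (x y z : V) :
  norm (minus x z) <= norm (minus x y) + norm (minus y z).
Proof. replace (minus x z) with (plus (minus x y) (minus y z)) by vmod. apply norm_triangle. Qed.

Lemma norm_minus_le (x y : V) : norm (minus x y) <= norm x + norm y.
Proof. unfold minus. rewrite <- (norm_opp y). apply norm_triangle. Qed.

Lemma norm_le_minus (x y : V) : norm x <= norm y + norm (minus x y).
Proof. replace x with (plus y (minus x y)) at 1 by vmod. apply norm_triangle. Qed.

Lemma minus_self (x : V) : @eq V (minus x x) zero.
Proof. vmod. Qed.

Lemma minus_zero (x : V) : @eq V (minus x (zero : V)) x.
Proof. vmod. Qed.

Lemma minus_eq_norm (x y : V) : norm (minus x y) = 0 -> x = y.
Proof.
  intros H. apply norm_eq_zero in H.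
  replace x with (plus y (minus x y)) by vmod. rewrite H. vmod.
Qed.

Lemma eq_of_norm_small (x y : V) :
  (forall eps, 0 < eps -> norm (minus x y) <= eps) -> x = y.
Proof.
  intros H. apply minus_eq_norm. apply Rle_antisym; [|apply norm_ge_0].
  apply Rnot_lt_le. intros Hl. specialize (H (norm (minus x y) / 2)). lra.
Qed.

Lemma limP {T : Type} (G : (T -> Prop) -> Prop) {FG : Filter G} (f : T -> V) (l : V) :
  filterlim f G (locally l) <->
  forall eps, 0 < eps -> G (fun s => norm (minus (f s) l) < eps).
Proof.
  split.
  - intros H eps Heps. apply (H (fun y => norm (minus y l) < eps)).
    apply (locally_le_locally_norm l). exists (mkposreal eps Heps).
    intros y Hy. exact Hy.
  - intros H P HP. apply locally_norm_le_locally in HP.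
    destruct HP as [eps He]. generalize (H eps (cond_pos eps)).
    unfold filtermap. apply filter_imp. intros s Hs. apply He. exact Hs.
Qed.

End Norms.

(** * Completeness and Riemann integrals of vector-valued functions *)

(** Completeness is a property here, not a structure, so that one canonical
    normed module underlies all the statements, products included. *)
Definition is_complete {F : scalar_field} (V : NormedModule F) : Prop :=
  forall G : (V -> Prop) -> Prop, ProperFilter G -> cauchy G ->
  exists l : V, forall eps : posreal, G (ball l eps).

Lemma is_complete_CompleteNormedModule {F : scalar_field} (V : CompleteNormedModule F) :
  is_complete (CompleteNormedModule.NormedModule F V).
Proof.
  intros G HG HC. exists (lim (T := V) G). intros eps.
  exact (complete_cauchy (T := V) G HG HC eps).
Qed.

Section RealScalars.
Context {F : scalar_field}.

Definition real_ModuleSpace_mixin (V : NormedModule F) :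
  ModuleSpace.mixin_of R_Ring V.
Proof.
  apply (ModuleSpace.Mixin R_Ring V (fun r x => scal (ofR r) x)).
  - intros x y u. symmetry. exact (scal_ofR_mult x y u).
  - intros u. change (one : R_Ring) with 1. vmod.
  - intros x u v. vmod.
  - intros x y u. exact (scal_ofR_plus x y u).
Defined.

Definition real_ModuleSpace_class (V : NormedModule F) : ModuleSpace.class_of R_Ring V :=
  ModuleSpace.Class R_Ring V (AbelianGroup.class (NormedModule.AbelianGroup F V))
    (real_ModuleSpace_mixin V).

Definition real_NormedModuleAux (V : NormedModule F) : NormedModuleAux R_AbsRing :=
  NormedModuleAux.Pack R_AbsRing V
    (NormedModuleAux.Class R_AbsRing V (real_ModuleSpace_class V)
      (UniformSpace.class (NormedModule.UniformSpace F V))) V.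

Definition real_NormedModule_mixin (V : NormedModule F) :
  NormedModule.mixin_of R_AbsRing (real_NormedModuleAux V).
Proof.
  apply (NormedModule.Mixin R_AbsRing (real_NormedModuleAux V)
           (fun x => @norm F V x) (@norm_factor F V)).
  - exact (@norm_triangle F V).
  - intros l x. unfold scal; simpl. change (norm (rscal l x : V) <= Rabs l * norm (x : V)).
    rewrite norm_rscal. apply Rle_refl.
  - exact (@norm_compat1 F V).
  - exact (@norm_compat2 F V).
  - exact (@norm_eq_zero F V).
Defined.

(** The space [V] with its scalars restricted to the reals: Riemann sums and
    difference quotients live there.  The group, the norm and the topology are
    those of [V], so that limits are the same. *)
Definition realified (V : NormedModule F) : NormedModule R_AbsRing :=
  NormedModule.Pack R_AbsRing V
    (NormedModule.Class R_AbsRing V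
      (NormedModuleAux.class R_AbsRing (real_NormedModuleAux V))
      (real_NormedModule_mixin V)) V.

Definition complete_mixin (V : NormedModule F) (hV : is_complete V) :
  CompleteSpace.mixin_of (NormedModule.UniformSpace F V).
Proof.
  (* Equivalent filters must have close limits, whence the choice of the limit
     by a predicate that does not distinguish them. *)
  pose (conv := fun (G : (V -> Prop) -> Prop) (l : V) => forall eps : posreal, G (ball l eps)).
  apply (CompleteSpace.Mixin (NormedModule.UniformSpace F V)
    (fun G => epsilon (inhabits zero) (conv G))).
  - intros G HG HC. apply (epsilon_spec (inhabits zero) (conv G)). exact (hV G HG HC).
  - intros G1 G2 H12 H21.
    replace (conv G2) with (conv G1); [intros eps; apply ball_center|].
    apply functional_extensionality. intros l.
    apply propositional_extensionality.
    unfold conv. split; intros H eps; [apply H21, H | apply H12, H].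
Defined.

Definition realified_complete (V : NormedModule F) (hV : is_complete V) :
  CompleteNormedModule R_AbsRing :=
  CompleteNormedModule.Pack R_AbsRing V
    (CompleteNormedModule.Class R_AbsRing V (NormedModule.class R_AbsRing (realified V))
       (complete_mixin V hV)) V.

(** The choice makes the integral a total function of its integrand; it is the
    limit of the Riemann sums whenever they converge. *)
Definition integral {V : NormedModule F} (f : R -> V) (a b : R) : V :=
  epsilon (inhabits zero) (fun l : V => @is_RInt (realified V) f a b l).

End RealScalars.

(** Continuity everywhere is what makes every integral below exist; the
    semigroups are extended to negative times so that it holds. *)
Definition cont {F : scalar_field} {V : NormedModule F} (f : R -> V) : Prop :=
  forall t, filterlim f (locally t) (locally (f t)).

Section Integrals.
Context {F : scalar_field} {V : NormedModule F}.

Lemma is_RInt_integral (hV : is_complete V) (f : R -> V) a b :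
  cont f -> @is_RInt (realified V) f a b (integral f a b).
Proof.
  intros Hf. unfold integral. apply epsilon_spec.
  destruct (ex_RInt_continuous (V := realified_complete V hV) f a b) as [l Hl].
  { intros z _. exact (Hf z). }
  exists l. exact Hl.
Qed.

Lemma is_RInt_det (f : R -> V) a b l l' :
  @is_RInt (realified V) f a b l -> @is_RInt (realified V) f a b l' -> l = l'.
Proof.
  intros H H'.
  assert (Hc : close (l : V) l').
  { exact (filterlim_locally_close (U := realified V) (F := Riemann_fine a b) _ l l' H H'). }
  apply eq_of_norm_small. intros eps Heps.
  pose proof (norm_factor_gt_0 (V := V)) as Hnf.
  assert (He : 0 < eps / @norm_factor F V) by (apply Rdiv_lt_0_compat; assumption).
  specialize (Hc (mkposreal _ He)). apply norm_compat2 in Hc. simpl in Hc.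
  rewrite norm_minus_sym. replace eps with (@norm_factor F V * (eps / @norm_factor F V)).
  - now apply Rlt_le.
  - field. lra.
Qed.

Lemma integral_unique (f : R -> V) a b l :
  @is_RInt (realified V) f a b l -> integral f a b = l.
Proof.
  intros H. apply (is_RInt_det f a b); [|exact H].
  unfold integral. apply epsilon_spec. now exists l.
Qed.

End Integrals.

Section Calculus.
Context {F : scalar_field} {V : NormedModule F}.

Lemma linear_sub {W : NormedModule F} (A : V -> W) x y :
  is_linear A -> A (minus x y) = minus (A x) (A y).
Proof.
  intros HA. replace (minus x y) with (plus x (scal (ofR (-1)) y)) by vmod.
  rewrite (linear_plus A HA), (linear_scal A HA). vmod.
Qed.

Lemma linear_0 {W : NormedModule F} (A : V -> W) : is_linear A -> A zero = zero.
Proof.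
  intros HA. replace (zero : V) with (scal (ofR 0) (zero : V)) by vmod.
  rewrite (linear_scal A HA). vmod.
Qed.

Lemma is_linear_scalar (k : F) : is_linear (fun v : V => scal k v).
Proof.
  apply is_linear_scal_r. clear. destruct F; [exact Rmult_comm | exact Cmult_comm].
Qed.

Lemma is_linear_sum {W : NormedModule F} (A B : V -> W) :
  is_linear A -> is_linear B -> is_linear (fun v => plus (A v) (B v)).
Proof.
  intros HA HB. constructor.
  - intros x y. rewrite (linear_plus A HA), (linear_plus B HB). vmod.
  - intros k x. rewrite (linear_scal A HA), (linear_scal B HB).
    symmetry. exact (scal_distr_l k (A x) (B x)).
  - destruct (linear_norm A HA) as [M [HM H1]]. destruct (linear_norm B HB) as [N [HN H2]].
    exists (M + N). split; [lra|]. intros x. eapply Rle_trans; [apply norm_triangle|].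
    specialize (H1 x). specialize (H2 x). lra.
Qed.

Lemma is_linear_difference {W : NormedModule F} (A B : V -> W) :
  is_linear A -> is_linear B -> is_linear (fun v => minus (A v) (B v)).
Proof.
  intros HA HB. apply (is_linear_sum A (fun v => opp (B v))); [exact HA|].
  apply (is_linear_comp B opp); [exact HB|]. apply is_linear_opp.
Qed.

Lemma linear_lim {W : NormedModule F} {T} (G : (T -> Prop) -> Prop)
  (A : V -> W) (f : T -> V) l :
  is_linear A -> filterlim f G (locally l) -> filterlim (fun s => A (f s)) G (locally (A l)).
Proof.
  intros HA Hf. exact (filterlim_comp _ _ _ f A G _ _ Hf (linear_cont A l HA)).
Qed.

Lemma lim_plus {T} (G : (T -> Prop) -> Prop) {FG : Filter G} (f g : T -> V) l m :
  filterlim f G (locally l) -> filterlim g G (locally m) ->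
  filterlim (fun s => plus (f s) (g s)) G (locally (plus l m)).
Proof. intros Hf Hg. exact (filterlim_comp_2 _ _ _ Hf Hg (filterlim_plus l m)). Qed.

Lemma lim_minus {T} (G : (T -> Prop) -> Prop) {FG : Filter G} (f g : T -> V) l m :
  filterlim f G (locally l) -> filterlim g G (locally m) ->
  filterlim (fun s => minus (f s) (g s)) G (locally (minus l m)).
Proof.
  intros Hf Hg. apply lim_plus; [assumption|assumption|].
  exact (filterlim_comp _ _ _ _ _ _ _ _ Hg (filterlim_opp m)).
Qed.

Lemma lim_unique {T} (G : (T -> Prop) -> Prop) {FG : ProperFilter G} (f : T -> V) l m :
  filterlim f G (locally l) -> filterlim f G (locally m) -> l = m.
Proof.
  intros Hl Hm. apply eq_of_norm_small. intros eps Heps.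
  apply (limP G f l) with (eps := eps / 2) in Hl; [|lra].
  apply (limP G f m) with (eps := eps / 2) in Hm; [|lra].
  destruct (filter_ex _ (filter_and _ _ Hl Hm)) as [s [H1 H2]].
  apply Rle_trans with (1 := norm_minus_triangle _ (f s) _).
  rewrite (norm_minus_sym l). lra.
Qed.

Lemma cont_const (x : V) : cont (fun _ => x).
Proof. intros t. apply filterlim_const. Qed.

Lemma cont_plus (f g : R -> V) : cont f -> cont g -> cont (fun s => plus (f s) (g s)).
Proof. intros Hf Hg t. apply (lim_plus (locally t)); auto. Qed.

Lemma cont_minus (f g : R -> V) : cont f -> cont g -> cont (fun s => minus (f s) (g s)).
Proof. intros Hf Hg t. apply (lim_minus (locally t)); auto. Qed.

Lemma cont_linear {W : NormedModule F} (A : V -> W) (f : R -> V) :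
  is_linear A -> cont f -> cont (fun s => A (f s)).
Proof. intros HA Hf t. apply linear_lim; auto. Qed.

Lemma cont_comp (f : R -> V) (g : R -> R) :
  (forall t, continuous g t) -> cont f -> cont (fun s => f (g s)).
Proof. intros Hg Hf t. exact (filterlim_comp _ _ _ _ _ _ _ _ (Hg t) (Hf (g t))). Qed.

Lemma cont_ext (f g : R -> V) : (forall s, f s = g s) -> cont f -> cont g.
Proof. intros H. now replace g with f by now apply functional_extensionality. Qed.

Lemma integral_linear {W : NormedModule F} (hV : is_complete V) (A : V -> W) f a b :
  is_linear A -> cont f -> integral (fun s => A (f s)) a b = A (integral f a b).
Proof.
  intros HA Hf. apply integral_unique.
  pose proof (is_RInt_integral hV f a b Hf) as H.
  unfold is_RInt in *.
  apply (filterlim_ext (fun ptd => A (@scal _ (realified V) (sign (b - a)) (@Riemann_sum (realified V) f ptd)))).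
  - intros ptd. unfold scal at 1; simpl. rewrite (linear_scal A HA).
    unfold scal at 2; simpl. f_equal.
    induction ptd as [x|h ptd IH] using SF_cons_ind.
    + exact (linear_0 A HA).
    + rewrite !Riemann_sum_cons. rewrite <- IH.
      etransitivity; [apply (linear_plus A HA)|].
      apply f_equal2; [|reflexivity]. exact (linear_scal A HA _ _).
  - apply linear_lim; auto.
Qed.

Lemma integral_plus (hV : is_complete V) (f g : R -> V) a b :
  cont f -> cont g ->
  integral (fun s => plus (f s) (g s)) a b = plus (integral f a b) (integral g a b).
Proof.
  intros Hf Hg. apply integral_unique.
  exact (is_RInt_plus (V := realified V) f g a b _ _
    (is_RInt_integral hV f a b Hf) (is_RInt_integral hV g a b Hg)).
Qed.

Lemma integral_minus (hV : is_complete V) (f g : R -> V) a b :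
  cont f -> cont g ->
  integral (fun s => minus (f s) (g s)) a b = minus (integral f a b) (integral g a b).
Proof.
  intros Hf Hg. apply integral_unique.
  exact (is_RInt_minus (V := realified V) f g a b _ _
    (is_RInt_integral hV f a b Hf) (is_RInt_integral hV g a b Hg)).
Qed.

Lemma integral_const (x : V) a b : integral (fun _ => x) a b = scal (ofR (b - a)) x.
Proof. apply integral_unique. exact (is_RInt_const (V := realified V) a b x). Qed.

Lemma integral_point f a : integral f a a = (zero : V).
Proof. apply integral_unique. exact (is_RInt_point (V := realified V) f a). Qed.

Lemma integral_ext (hV : is_complete V) (f g : R -> V) a b :
  a <= b -> cont f -> (forall s, a <= s <= b -> f s = g s) -> integral g a b = integral f a b.
Proof.
  intros Hab Hf Hfg. apply integral_unique.
  apply (is_RInt_ext (V := realified V) f g).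
  - rewrite Rmin_left, Rmax_right by assumption. intros x Hx. apply Hfg. lra.
  - now apply is_RInt_integral.
Qed.

Lemma integral_Chasles (hV : is_complete V) (f : R -> V) a b c :
  cont f -> plus (integral f a b) (integral f b c) = integral f a c.
Proof.
  intros Hf. symmetry. apply integral_unique.
  exact (is_RInt_Chasles (V := realified V) f a b c _ _
    (is_RInt_integral hV f a b Hf) (is_RInt_integral hV f b c Hf)).
Qed.

Lemma integral_shift (hV : is_complete V) (f : R -> V) a b c :
  cont f -> integral (fun s => f (s + c)) a b = integral f (a + c) (b + c).
Proof.
  intros Hf. apply integral_unique.
  apply (is_RInt_ext (V := realified V) (fun s => scal (ofR 1) (f (1 * s + c)))).
  - intros s _. rewrite Rmult_1_l. vmod.
  - apply (is_RInt_comp_lin (V := realified V) f 1 c a b). rewrite !Rmult_1_l.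
    now apply is_RInt_integral.
Qed.

Lemma integral_norm_le (hV : is_complete V) (f : R -> V) a b M :
  a <= b -> cont f -> (forall s, a <= s <= b -> norm (f s) <= M) ->
  norm (integral f a b) <= (b - a) * M.
Proof.
  intros Hab Hf HM.
  exact (norm_RInt_le_const (V := realified V) f a b _ M Hab HM (is_RInt_integral hV f a b Hf)).
Qed.

Lemma integral_norm_le_fun (hV : is_complete V) (f : R -> V) (g : R -> R) a b :
  a <= b -> cont f -> (forall t, continuous g t) -> (forall s, a <= s <= b -> norm (f s) <= g s) ->
  norm (integral f a b) <= RInt g a b.
Proof.
  intros Hab Hf Hg HM.
  refine (norm_RInt_le (V := realified V) f g a b _ _ Hab HM (is_RInt_integral hV f a b Hf) _).
  apply (RInt_correct (V := R_CompleteNormedModule)), (ex_RInt_continuous (V := R_CompleteNormedModule)).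
  intros; apply Hg.
Qed.

(** * Derivatives of vector-valued functions *)

Definition deriv (f : R -> V) (t : R) (l : V) : Prop :=
  filterlim (fun s => scal (ofR (/ (s - t))) (minus (f s) (f t)))
    (locally' t) (locally l).

Lemma locally_RP (t : R) (P : R -> Prop) :
  locally t P <-> exists d, 0 < d /\ forall s, Rabs (s - t) < d -> P s.
Proof.
  split.
  - intros [d Hd]. exists d. split; [apply cond_pos|]. intros s Hs. now apply Hd.
  - intros [d [Hd H]]. exists (mkposreal d Hd). intros s Hs. now apply H.
Qed.

Lemma derivP f t l :
  deriv f t l <-> forall eps, 0 < eps -> exists d, 0 < d /\ forall s, Rabs (s - t) < d ->
    norm (minus (minus (f s) (f t)) (scal (ofR (s - t)) l)) <= eps * Rabs (s - t).
Proof.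
  transitivity (forall eps, 0 < eps -> locally' t
    (fun s => norm (minus (scal (ofR (/ (s - t))) (minus (f s) (f t))) l) < eps)).
  { apply limP. typeclasses eauto. }
  unfold locally', within.
  split; intros H eps Heps.
  - specialize (H eps Heps). apply locally_RP in H. destruct H as [d [Hd H]].
    exists d; split; [exact Hd|]. intros s Hs.
    destruct (Req_dec s t) as [->|Hst].
    + replace (minus (minus (f t) (f t)) (scal (ofR (t - t)) l)) with (zero : V) by vmod.
      rewrite norm_zero, Rminus_diag_eq, Rabs_R0 by reflexivity. lra.
    + specialize (H s Hs Hst).
      replace (minus (minus (f s) (f t)) (scal (ofR (s - t)) l)) with
        (rscal (s - t) (minus (scal (ofR (/ (s - t))) (minus (f s) (f t))) l)) by vmod.
      rewrite norm_rscal, Rmult_comm. apply Rmult_le_compat_r; [apply Rabs_pos | lra].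
  - destruct (H (eps / 2)) as [d [Hd H']]; [lra|].
    apply locally_RP. exists d; split; [exact Hd|]. intros s Hs Hst.
    specialize (H' s Hs).
    replace (minus (scal (ofR (/ (s - t))) (minus (f s) (f t))) l) with
      (rscal (/ (s - t)) (minus (minus (f s) (f t)) (scal (ofR (s - t)) l))) by vmod.
    rewrite norm_rscal, Rabs_inv.
    assert (0 < Rabs (s - t)) by (apply Rabs_pos_lt; lra).
    apply Rle_lt_trans with (/ Rabs (s - t) * (eps / 2 * Rabs (s - t))).
    + apply Rmult_le_compat_l; [left; now apply Rinv_0_lt_compat | exact H'].
    + field_simplify; lra.
Qed.

Lemma cont_rscal (v : V) : cont (fun r => scal (ofR r) v).
Proof.
  intros t. apply (limP (locally t) (fun r => scal (ofR r) v)). intros eps He. apply locally_RP.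
  pose proof (norm_ge_0 v) as Hn.
  exists (eps / (norm v + 1)). split; [apply Rdiv_lt_0_compat; lra|]. intros s Hs.
  apply Rle_lt_trans with (norm (rscal (s - t) v)); [right; f_equal; vmod|].
  rewrite norm_rscal. apply Rle_lt_trans with (Rabs (s - t) * (norm v + 1)).
  - apply Rmult_le_compat_l; [apply Rabs_pos|lra].
  - apply Rlt_le_trans with (eps / (norm v + 1) * (norm v + 1)); [|right; field; lra].
    apply Rmult_lt_compat_r; lra.
Qed.

Lemma deriv_is_derive f t l : deriv f t l <-> @is_derive R_AbsRing (realified V) f t l.
Proof.
  rewrite derivP. split.
  - intros H. split; [apply is_linear_scal_l|].
    intros x Hx. apply (is_filter_lim_locally_unique t x) in Hx. subst x.
    intros eps. destruct (H eps (cond_pos eps)) as [d [Hd H']].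
    apply locally_RP. exists d. split; [exact Hd|]. exact H'.
  - intros [_ H] eps Heps.
    specialize (H t (fun P HP => HP) (mkposreal eps Heps)).
    apply locally_RP in H. exact H.
Qed.

Lemma deriv_cont f t l : deriv f t l -> filterlim f (locally t) (locally (f t)).
Proof.
  intros H. apply deriv_is_derive in H.
  refine (filterdiff_continuous (V := realified V) f t _). eexists. exact H.
Qed.

Lemma deriv_integral (hV : is_complete V) (f : R -> V) a t :
  cont f -> deriv (fun s => integral f a s) t (f t).
Proof.
  intros Hf. apply deriv_is_derive.
  apply (is_derive_RInt (V := realified V)) with (a := a); [|exact (Hf t)].
  apply filter_forall. intros b. now apply is_RInt_integral.
Qed.

Lemma integral_deriv (hV : is_complete V) (f df : R -> V) a b :
  (forall t, deriv f t (df t)) -> cont df -> integral df a b = minus (f b) (f a).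
Proof.
  intros Hf Hdf. apply integral_unique.
  refine (is_RInt_derive (V := realified_complete V hV) f df a b _ _).
  - intros t _. apply deriv_is_derive. apply Hf.
  - intros t _. apply Hdf.
Qed.

Lemma deriv_plus f g t l m :
  deriv f t l -> deriv g t m -> deriv (fun s => plus (f s) (g s)) t (plus l m).
Proof.
  intros Hf Hg. eapply filterlim_ext; [|apply (lim_plus (locally' t) _ _ _ _ Hf Hg)].
  intros s; simpl. vmod_coefs; ring.
Qed.

Lemma deriv_minus f g t l m :
  deriv f t l -> deriv g t m -> deriv (fun s => minus (f s) (g s)) t (minus l m).
Proof.
  intros Hf Hg. eapply filterlim_ext; [|apply (lim_minus (locally' t) _ _ _ _ Hf Hg)].
  intros s; simpl. vmod_coefs; ring.
Qed.

Lemma deriv_const (x : V) t : deriv (fun _ => x) t zero.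
Proof.
  apply derivP. intros eps Heps. exists 1. split; [lra|]. intros s _.
  apply Rle_trans with 0; [|apply Rmult_le_pos; [lra | apply Rabs_pos]].
  right. rewrite <- (norm_zero (V := V)). f_equal. vmod.
Qed.

Lemma deriv_shift f t l c : deriv f (t + c) l -> deriv (fun s => f (s + c)) t l.
Proof.
  rewrite !derivP. intros H eps Heps. destruct (H eps Heps) as [d [Hd H']].
  exists d; split; [exact Hd|]. intros s Hs. specialize (H' (s + c)).
  replace (s + c - (t + c)) with (s - t) in H' by ring. auto.
Qed.

Lemma deriv_mult (p : R -> R) f t dp l :
  is_derive p t dp -> deriv f t l ->
  deriv (fun s => scal (ofR (p s)) (f s)) t (plus (scal (ofR dp) (f t)) (scal (ofR (p t)) l)).
Proof.
  intros Hp Hf. apply deriv_is_derive. apply deriv_is_derive in Hf.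
  pose proof (filterdiff_scal_fct (V := realified V) t p f _ _ Rmult_comm Hp Hf) as H.
  eapply filterdiff_ext_lin; [exact H|]. intros y.
  change (plus (scal (ofR (y * dp)) (f t)) (scal (ofR (p t)) (scal (ofR y) l)) =
    scal (ofR y) (plus (scal (ofR dp) (f t)) (scal (ofR (p t)) l))).
  vmod.
Qed.

End Calculus.

Lemma deriv_linear {F : scalar_field} {V W : NormedModule F} (A : V -> W) (f : R -> V) t l :
  is_linear A -> deriv f t l -> deriv (fun s => A (f s)) t (A l).
Proof.
  intros HA Hf.
  apply (filterlim_ext (fun s => A (scal (ofR (/ (s - t))) (minus (f s) (f t))))).
  - intros s. now rewrite (linear_scal A HA), linear_sub.
  - now apply linear_lim.
Qed.

(** * Consequences of completeness *)

Section Completeness.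
Context {F : scalar_field} {X : NormedModule F}.

Lemma limP_seq (a : nat -> X) (x : X) :
  filterlim a eventually (locally x) <->
  forall eps, 0 < eps -> exists N, forall n, (N <= n)%nat -> norm (minus (a n) x) < eps.
Proof. exact (limP eventually a x). Qed.

Lemma limit_norm_le {T} (G : (T -> Prop) -> Prop) {FG : ProperFilter G} (f : T -> X) l y M :
  filterlim f G (locally l) -> G (fun s => norm (minus (f s) y) <= M) ->
  norm (minus l y) <= M.
Proof.
  intros Hf HM. apply le_epsilon. intros eps Heps.
  apply (limP G f l) with (eps := eps) in Hf; [|exact Heps].
  destruct (filter_ex _ (filter_and _ _ Hf HM)) as [s [H1 H2]].
  apply Rle_trans with (1 := norm_minus_triangle _ (f s) _).
  rewrite (norm_minus_sym l). lra.
Qed.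

Lemma limit_norm_le0 {T} (G : (T -> Prop) -> Prop) {FG : ProperFilter G} (f : T -> X) l M :
  filterlim f G (locally l) -> G (fun s => norm (f s) <= M) -> norm l <= M.
Proof.
  intros Hf HM. replace l with (minus l (zero : X)) by vmod.
  apply (limit_norm_le G f l (zero : X) M Hf). revert HM. apply filter_imp.
  intros s Hs. now replace (minus (f s) (zero : X)) with (f s) by vmod.
Qed.

Lemma cauchy_sequence_converges (hX : is_complete X) (a : nat -> X) :
  (forall eps, 0 < eps -> exists N, forall n, (N <= n)%nat -> norm (minus (a n) (a N)) < eps) ->
  exists x, filterlim a eventually (locally x).
Proof.
  intros Ha. destruct (hX (filtermap a eventually)) as [x Hx].
  - apply filtermap_proper_filter, eventually_filter.
  - intros eps. destruct (Ha eps (cond_pos eps)) as [N HN]. exists (a N).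
    exists N. intros n Hn. apply norm_compat1, HN, Hn.
  - exists x. intros P [eps HP]. generalize (Hx eps). unfold filtermap.
    apply filter_imp. intros n Hn. now apply HP.
Qed.

Lemma half_pow_pos n : 0 < (/ 2) ^ n.
Proof. apply pow_lt. lra. Qed.

Lemma half_pow_small c eps : 0 <= c -> 0 < eps -> exists N, forall n, (N <= n)%nat -> c * (/ 2) ^ n < eps.
Proof.
  intros Hc He.
  destruct (pow_lt_1_zero (/ 2) (ltac:(rewrite Rabs_pos_eq; lra)) (eps / (c + 1))) as [N HN].
  { apply Rdiv_lt_0_compat; lra. }
  exists N. intros n Hn. specialize (HN n Hn).
  rewrite Rabs_pos_eq in HN by (left; apply half_pow_pos).
  pose proof (half_pow_pos n).
  apply Rle_lt_trans with ((c + 1) * (/ 2) ^ n); [nra|].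
  apply Rlt_le_trans with ((c + 1) * (eps / (c + 1))).
  - apply Rmult_lt_compat_l; lra.
  - right. field. lra.
Qed.

Lemma geometric_steps (a : nat -> X) c :
  (forall n, norm (minus (a (S n)) (a n)) <= c * (/ 2) ^ n) ->
  forall N n, (N <= n)%nat -> norm (minus (a n) (a N)) <= 2 * c * (/ 2) ^ N - 2 * c * (/ 2) ^ n.
Proof.
  intros Ha N n Hn. induction Hn as [|n Hn IH].
  - rewrite minus_self, norm_zero. lra.
  - apply Rle_trans with (1 := norm_minus_triangle _ (a n) _).
    specialize (Ha n). simpl in *. lra.
Qed.

Lemma geometric_series_converges (hX : is_complete X) (a : nat -> X) c :
  0 <= c -> a O = zero -> (forall n, norm (minus (a (S n)) (a n)) <= c * (/ 2) ^ n) ->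
  exists x, filterlim a eventually (locally x) /\ norm x <= 2 * c.
Proof.
  intros Hc H0 Ha. pose proof (geometric_steps a c Ha) as Hg.
  destruct (cauchy_sequence_converges hX a) as [x Hx].
  - intros eps He. destruct (half_pow_small (2 * c) eps) as [N HN]; [lra|exact He|].
    exists N. intros n Hn. specialize (Hg N n Hn). specialize (HN N (le_n N)).
    assert (0 <= c * (/ 2) ^ n) by (apply Rmult_le_pos; [lra | left; apply half_pow_pos]). lra.
  - exists x. split; [exact Hx|]. apply (limit_norm_le0 eventually a x _ Hx).
    exists O. intros n _. specialize (Hg O n (Nat.le_0_l n)).
    rewrite H0, minus_zero, pow_O in Hg.
    assert (0 <= c * (/ 2) ^ n) by (apply Rmult_le_pos; [lra | left; apply half_pow_pos]).
    lra.
Qed.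

(** Baire's argument: were every sublevel set nowhere dense, nested balls
    avoiding them one after the other would shrink to a point at which [p] has
    no value. *)
Lemma sublevel_dense_in_ball (hX : is_complete X) (p : X -> R) :
  exists (N : nat) (a : X) (r : R), 0 < r /\
    forall (y : X) rho, norm (minus y a) < r -> 0 < rho ->
    exists v : X, norm (minus v y) < rho /\ p v <= INR N.
Proof.
  apply NNPP. intros Hno.
  assert (Hstep : forall q : nat * (X * R), exists q' : X * R,
    0 < snd (snd q) ->
    0 < snd q' /\ snd q' <= snd (snd q) / 2 /\
    norm (minus (fst q') (fst (snd q))) + snd q' <= snd (snd q) /\
    forall v : X, norm (minus v (fst q')) <= snd q' -> INR (fst q) < p v).
  { intros [n [a r]]; simpl. destruct (Rlt_le_dec 0 r) as [Hr|Hr].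
    2: { exists (a, r). simpl. lra. }
    apply NNPP. intros Hn. apply Hno. exists n, a, r. split; [exact Hr|].
    intros y rho Hy Hrho. apply NNPP. intros Hv. apply Hn.
    exists (y, Rmin (rho / 2) (Rmin (r / 2) (r - norm (minus y a)))). simpl. intros _.
    pose proof (Rmin_l (rho / 2) (Rmin (r / 2) (r - norm (minus y a)))).
    pose proof (Rmin_r (rho / 2) (Rmin (r / 2) (r - norm (minus y a)))).
    pose proof (Rmin_l (r / 2) (r - norm (minus y a))).
    pose proof (Rmin_r (r / 2) (r - norm (minus y a))).
    repeat split; try lra.
    - repeat apply Rmin_glb_lt; lra.
    - intros v Hvy. apply Rnot_le_lt. intros Hp. apply Hv. exists v. split; lra. }
  apply functional_choice in Hstep. destruct Hstep as [step Hstep].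
  set (c := fix c (n : nat) : X * R := match n with O => @pair X R zero 1 | S n' => step (n', c n') end).
  assert (Hpos : forall n, 0 < snd (c n)).
  { induction n as [|n IH]; simpl; [lra|]. now apply (Hstep (n, c n)). }
  assert (Hdec : forall n, snd (c n) <= (/ 2) ^ n).
  { induction n as [|n IH]; [simpl; lra|].
    destruct (Hstep (n, c n) (Hpos n)) as [_ [H _]]. change (c (S n)) with (step (n, c n)).
    simpl in *. lra. }
  assert (Hnest : forall n m, (n <= m)%nat ->
    norm (minus (fst (c m)) (fst (c n))) + snd (c m) <= snd (c n)).
  { intros n m Hm. induction Hm as [|m Hm IH].
    - rewrite minus_self, norm_zero. lra.
    - destruct (Hstep (m, c m) (Hpos m)) as [_ [_ [H _]]]. change (c (S m)) with (step (m, c m)).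
      simpl in H. pose proof (norm_minus_triangle (fst (step (m, c m))) (fst (c m)) (fst (c n))).
      lra. }
  destruct (cauchy_sequence_converges hX (fun n => fst (c n))) as [x Hx].
  { intros eps He. destruct (half_pow_small 1 eps) as [N HN]; [lra|exact He|].
    exists N. intros n Hn. specialize (HN N (le_n N)).
    pose proof (Hnest N n Hn). pose proof (Hpos n). pose proof (Hdec N). lra. }
  assert (Hin : forall n, norm (minus x (fst (c n))) <= snd (c n)).
  { intros n. apply (limit_norm_le eventually _ x _ _ Hx). exists n. intros m Hm.
    pose proof (Hnest n m Hm). pose proof (Hpos m). lra. }
  destruct (INR_unbounded (p x)) as [n Hn].
  destruct (Hstep (n, c n) (Hpos n)) as [_ [_ [_ H]]]. simpl in H.
  specialize (H x (Hin (S n))). lra.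
Qed.

(** Zabreiko's lemma.  The last hypothesis is countable subadditivity, for
    series that converge geometrically.  Both the uniform boundedness
    principle and the closed graph theorem are instances. *)
Lemma countably_subadditive_bounded (hX : is_complete X) (p : X -> R) :
  (forall x, 0 <= p x) ->
  (forall x y, p (plus x y) <= p x + p y) ->
  (forall r x, p (scal (ofR r) x) = Rabs r * p x) ->
  (forall (s : nat -> X) x c, 0 <= c -> s O = zero -> filterlim s eventually (locally x) ->
     (forall n, p (minus (s (S n)) (s n)) <= c * (/ 2) ^ n) -> p x <= 2 * c) ->
  exists C, 0 < C /\ forall x, p x <= C * norm x.
Proof.
  intros Hp0 Hpp Hps Hpc.
  destruct (sublevel_dense_in_ball hX p) as [N0 [a [r [Hr Hd]]]].
  set (N := INR N0) in *. assert (HN : 0 <= N) by apply pos_INR.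
  (* The closure of a sublevel set is symmetric and convex, so the ball can be
     centred at the origin. *)
  assert (H1 : forall (y : X) rho, norm y < r -> 0 < rho -> exists v : X, norm (minus v y) < rho /\ p v <= N).
  { intros y rho Hy Hrho.
    destruct (Hd (plus a y) rho) as [v1 [Hv1 Hp1]]; [|exact Hrho|].
    { replace (minus (plus a y) a) with y by vmod. exact Hy. }
    destruct (Hd (minus a y) rho) as [v2 [Hv2 Hp2]]; [|exact Hrho|].
    { replace (minus (minus a y) a) with (opp y) by vmod. rewrite norm_opp. exact Hy. }
    exists (plus (rscal (/ 2) v1) (rscal (- / 2) v2)). split.
    - replace (minus (plus (rscal (/ 2) v1) (rscal (- / 2) v2)) y) with
        (minus (rscal (/ 2) (minus v1 (plus a y))) (rscal (/ 2) (minus v2 (minus a y)))) by vmod.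
      eapply Rle_lt_trans; [apply norm_minus_le|]. rewrite !norm_rscal, Rabs_pos_eq; lra.
    - eapply Rle_trans; [apply Hpp|]. unfold rscal. rewrite !Hps, Rabs_Ropp, Rabs_pos_eq; lra. }
  assert (H2 : forall t (y : X) rho, 0 < t -> norm y < t * r -> 0 < rho ->
    exists v : X, norm (minus v y) < rho /\ p v <= t * N).
  { intros t y rho Ht Hy Hrho.
    destruct (H1 (rscal (/ t) y) (rho / t)) as [v [Hv Hp]].
    { rewrite norm_rscal, Rabs_inv, (Rabs_pos_eq t) by lra.
      apply (Rmult_lt_reg_l t); [exact Ht|]. rewrite <- Rmult_assoc, Rinv_r, Rmult_1_l; lra. }
    { now apply Rdiv_lt_0_compat. }
    exists (rscal t v). split.
    - replace (minus (rscal t v) y) with (rscal t (minus v (rscal (/ t) y))) by vmod.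
      rewrite norm_rscal, Rabs_pos_eq by lra.
      apply (Rmult_lt_compat_l t) in Hv; [|exact Ht].
      replace (t * (rho / t)) with rho in Hv by (field; lra). exact Hv.
    - unfold rscal. rewrite Hps, Rabs_pos_eq by lra. now apply Rmult_le_compat_l; [lra|]. }
  assert (H3 : forall x : X, norm x < r -> p x <= 2 * N).
  { intros x Hx.
    assert (Hstep : forall q : nat * X, exists s' : X,
      norm (minus x (snd q)) < (/ 2) ^ fst q * r ->
      norm (minus x s') < (/ 2) ^ (S (fst q)) * r /\ p (minus s' (snd q)) <= N * (/ 2) ^ fst q).
    { intros [n s]; simpl. destruct (Rlt_le_dec (norm (minus x s)) ((/ 2) ^ n * r)) as [Hs|Hs].
      2: { exists s. lra. }
      destruct (H2 ((/ 2) ^ n) (minus x s) ((/ 2) ^ (S n) * r)) as [v [Hv Hp]].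
      - apply half_pow_pos.
      - exact Hs.
      - apply Rmult_lt_0_compat; [apply half_pow_pos | exact Hr].
      - exists (plus s v). intros _. split.
        + rewrite norm_minus_sym. replace (minus (plus s v) x) with (minus v (minus x s)) by vmod.
          exact Hv.
        + replace (minus (plus s v) s) with v by vmod. lra. }
    apply functional_choice in Hstep. destruct Hstep as [step Hstep].
    set (s := fix s (n : nat) : X := match n with O => (zero : X) | S n' => step (n', s n') end).
    assert (Hs : forall n, norm (minus x (s n)) < (/ 2) ^ n * r).
    { induction n as [|n IH].
      - simpl. replace (minus x (zero : X)) with x by vmod. lra.
      - apply (Hstep (n, s n)). exact IH. }
    apply (Hpc s x N); [exact HN|reflexivity| |].
    - apply limP_seq. intros eps He. destruct (half_pow_small r eps) as [M HM]; [lra|exact He|].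
      exists M. intros n Hn. rewrite norm_minus_sym. specialize (Hs n). specialize (HM n Hn). lra.
    - intros n. apply (Hstep (n, s n)). apply Hs. }
  exists (4 * (N + 1) / r). split; [apply Rdiv_lt_0_compat; lra|].
  intros x. destruct (Req_dec (norm x) 0) as [H0|H0].
  - apply norm_eq_zero in H0. subst x. rewrite norm_zero.
    replace (zero : X) with (scal (ofR 0) (zero : X)) by vmod. rewrite Hps, Rabs_R0. lra.
  - pose proof (norm_ge_0 x).
    assert (Hc : 0 < r / (2 * norm x)) by (apply Rdiv_lt_0_compat; lra).
    specialize (H3 (scal (ofR (r / (2 * norm x))) x)).
    rewrite Hps, Rabs_pos_eq in H3 by lra.
    assert (Hlt : norm (scal (ofR (r / (2 * norm x))) x) < r).
    { change (norm (rscal (r / (2 * norm x)) x) < r). rewrite norm_rscal, Rabs_pos_eq by lra.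
      replace (r / (2 * norm x) * norm x) with (r / 2) by (field; lra). lra. }
    specialize (H3 Hlt).
    apply (Rmult_le_reg_l (r / (2 * norm x))); [exact Hc|].
    replace (r / (2 * norm x) * (4 * (N + 1) / r * norm x)) with (2 * (N + 1)) by (field; lra).
    lra.
Qed.

End Completeness.

(** The supremum of a pointwise bounded family is a countably subadditive
    seminorm. *)
Lemma uniform_boundedness {F : scalar_field} {X Y : NormedModule F} {I : Type}
  (hX : is_complete X) (T : I -> X -> Y) :
  (forall i, is_linear (T i)) ->
  (forall x, exists B, forall i, norm (T i x) <= B) ->
  exists C, 0 < C /\ forall i x, norm (T i x) <= C * norm x.
Proof.
  intros Hlin Hb.
  destruct (classic (inhabited I)) as [[i0]|Hno].
  2: { exists 1. split; [lra|]. intros i. destruct Hno. now constructor. }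
  assert (Hsup : forall x, exists m, is_lub (fun v => exists i, v = norm (T i x)) m).
  { intros x. destruct (completeness (fun v => exists i, v = norm (T i x))) as [m Hm].
    - destruct (Hb x) as [B HB]. exists B. intros v [i ->]. apply HB.
    - now exists (norm (T i0 x)), i0.
    - now exists m. }
  apply functional_choice in Hsup. destruct Hsup as [p Hp].
  assert (Hup : forall i x, norm (T i x) <= p x).
  { intros i x. apply (Hp x). now exists i. }
  assert (Hleast : forall x m, (forall i, norm (T i x) <= m) -> p x <= m).
  { intros x m Hm. apply (Hp x). intros v [i ->]. apply Hm. }
  destruct (countably_subadditive_bounded hX p) as [C [HC HpC]].
  - intros x. apply Rle_trans with (2 := Hup i0 x), norm_ge_0.
  - intros x y. apply Hleast. intros i. rewrite (linear_plus _ (Hlin i)).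
    apply Rle_trans with (1 := norm_triangle _ _). pose proof (Hup i x). pose proof (Hup i y). lra.
  - assert (Hle : forall r x, p (scal (ofR r) x) <= Rabs r * p x).
    { intros r x. apply Hleast. intros i. rewrite (linear_scal _ (Hlin i)).
      change (norm (rscal r (T i x)) <= Rabs r * p x). rewrite norm_rscal.
      apply Rmult_le_compat_l; [apply Rabs_pos | apply Hup]. }
    intros r x. apply Rle_antisym; [apply Hle|].
    destruct (Req_dec r 0) as [->|Hr].
    { rewrite Rabs_R0, Rmult_0_l. eapply Rle_trans; [|apply (Hup i0)]. apply norm_ge_0. }
    apply (Rmult_le_reg_l (/ Rabs r)); [now apply Rinv_0_lt_compat, Rabs_pos_lt|].
    rewrite <- Rmult_assoc, Rinv_l, Rmult_1_l by now apply Rabs_no_R0.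
    rewrite <- Rabs_inv. replace x with (scal (ofR (/ r)) (scal (ofR r) x)) at 1 by vmod.
    apply Hle.
  - intros s x c Hc Hs0 Hs Hpn. apply Hleast. intros i.
    assert (Hlim : filterlim (fun n => T i (s n)) eventually (locally (T i x)))
      by (apply linear_lim; auto).
    apply (limit_norm_le0 eventually _ _ _ Hlim). exists O. intros n _.
    assert (Hn : norm (T i (s n)) <= 2 * c - 2 * c * (/ 2) ^ n).
    { induction n as [|n IH].
      - rewrite Hs0, linear_0, norm_zero by apply Hlin. simpl; lra.
      - apply Rle_trans with (1 := norm_le_minus _ (T i (s n))).
        rewrite <- linear_sub by apply Hlin.
        pose proof (Hup i (minus (s (S n)) (s n))). specialize (Hpn n). simpl. lra. }
    assert (0 <= c * (/ 2) ^ n) by (apply Rmult_le_pos; [lra | left; apply half_pow_pos]). lra.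
  - exists C. split; [exact HC|]. intros i x. apply Rle_trans with (1 := Hup i x), HpC.
Qed.

(** * A bounded operator defined on a dense subspace extends *)

Section DenseExtension.
Context {F : scalar_field} {X Y : NormedModule F}.
Variable G : X -> Y -> Prop.

Definition graph_closure (x : X) (y : Y) : Prop :=
  forall eps, 0 < eps -> exists (x' : X) (y' : Y), G x' y' /\
    norm (minus x' x) < eps /\ norm (minus y' y) < eps.

(** The closure of the graph of a bounded densely defined operator is again
    the graph of an operator with the same bound. *)
Lemma dense_extension (hY : is_complete Y) C :
  0 <= C ->
  (forall (x x' : X) (y y' : Y), G x y -> G x' y' -> G (plus x x') (plus y y')) ->
  (forall (k : F) (x : X) (y : Y), G x y -> G (scal k x) (scal k y)) ->
  (forall (x : X) (y : Y), G x y -> norm y <= C * norm x) ->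
  (forall (x : X) eps, 0 < eps -> exists (x' : X) (y' : Y), G x' y' /\ norm (minus x' x) < eps) ->
  exists T : X -> Y, is_linear T /\ (forall x : X, norm (T x) <= C * norm x) /\
    (forall x y, G x y -> T x = y) /\ (forall x, graph_closure x (T x)).
Proof.
  intros HC Hplus Hscal Hb Hdense.
  assert (Hminus : forall (x x' : X) (y y' : Y), G x y -> G x' y' -> G (minus x x') (minus y y')).
  { intros x x' y y' H H'. apply (Hscal (ofR (-1))) in H'.
    specialize (Hplus _ _ _ _ H H').
    replace (minus x x') with (plus x (scal (ofR (-1)) x')) by vmod.
    replace (minus y y') with (plus y (scal (ofR (-1)) y')) by vmod. exact Hplus. }
  assert (Hcb : forall x y, graph_closure x y -> norm y <= C * norm x).
  { intros x y H. apply le_epsilon. intros eps He.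
    destruct (H (eps / (C + 1))) as [x' [y' [HG [Hx Hy]]]]; [apply Rdiv_lt_0_compat; lra|].
    specialize (Hb _ _ HG). pose proof (norm_le_minus y y') as H1.
    pose proof (norm_le_minus x' x) as H2. rewrite norm_minus_sym in H1.
    set (d := eps / (C + 1)) in *.
    replace eps with ((C + 1) * d) by (unfold d; field; lra). nra. }
  assert (Hcplus : forall x x' y y', graph_closure x y -> graph_closure x' y' ->
    graph_closure (plus x x') (plus y y')).
  { intros x x' y y' H H' eps He.
    destruct (H (eps / 2)) as [a [b [Hab [Ha Hb']]]]; [lra|].
    destruct (H' (eps / 2)) as [a' [b' [Hab' [Ha' Hb'']]]]; [lra|].
    exists (plus a a'), (plus b b'). split; [now apply Hplus|].
    replace (minus (plus a a') (plus x x')) with (plus (minus a x) (minus a' x')) by vmod.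
    replace (minus (plus b b') (plus y y')) with (plus (minus b y) (minus b' y')) by vmod.
    split; (eapply Rle_lt_trans; [apply norm_triangle|lra]). }
  assert (Hcscal : forall k x y, graph_closure x y -> graph_closure (scal k x) (scal k y)).
  { intros k x y H eps He. pose proof (abs_ge_0 k) as Hk.
    destruct (H (eps / (abs k + 1))) as [a [b [Hab [Ha Hb']]]]; [apply Rdiv_lt_0_compat; lra|].
    exists (scal k a), (scal k b). split; [now apply Hscal|].
    set (d := eps / (abs k + 1)) in *.
    assert (He' : eps = (abs k + 1) * d) by (unfold d; field; lra).
    split.
    - rewrite <- (linear_sub (fun v : X => scal k v)) by apply is_linear_scalar.
      eapply Rle_lt_trans; [apply norm_scal|]. pose proof (norm_ge_0 (minus a x)). nra.
    - rewrite <- (linear_sub (fun v : Y => scal k v)) by apply is_linear_scalar.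
      eapply Rle_lt_trans; [apply norm_scal|]. pose proof (norm_ge_0 (minus b y)). nra. }
  assert (Hcunique : forall x y y', graph_closure x y -> graph_closure x y' -> y = y').
  { intros x y y' H H'. apply minus_eq_norm. apply Rle_antisym; [|apply norm_ge_0].
    apply (Hcscal (ofR (-1))) in H'. specialize (Hcplus _ _ _ _ H H').
    apply Hcb in Hcplus.
    replace (plus x (scal (ofR (-1)) x)) with (zero : X) in Hcplus by vmod.
    replace (plus y (scal (ofR (-1)) y')) with (minus y y') in Hcplus by vmod.
    rewrite norm_zero in Hcplus. lra. }
  assert (Hex : forall x, exists y, graph_closure x y).
  { intros x.
    assert (Ha : forall n : nat, exists q : X * Y, G (fst q) (snd q) /\ norm (minus (fst q) x) < (/ 2) ^ n).
    { intros n. destruct (Hdense x ((/ 2) ^ n) (half_pow_pos n)) as [x' [y' [H1 H2]]].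
      now exists (x', y'). }
    apply functional_choice in Ha. destruct Ha as [a Ha].
    assert (Hclose : forall N n, (N <= n)%nat ->
      norm (minus (snd (a n)) (snd (a N))) <= 2 * C * (/ 2) ^ N).
    { intros N n Hn. destruct (Ha N) as [HG1 H1]. destruct (Ha n) as [HG2 H2].
      specialize (Hb _ _ (Hminus _ _ _ _ HG2 HG1)).
      pose proof (norm_minus_triangle (fst (a n)) x (fst (a N))) as H3.
      rewrite (norm_minus_sym x) in H3.
      assert ((/ 2) ^ n <= (/ 2) ^ N).
      { rewrite !pow_inv. apply Rinv_le_contravar; [apply pow_lt; lra|].
        apply Rle_pow; [lra|exact Hn]. }
      nra. }
    destruct (cauchy_sequence_converges hY (fun n => snd (a n))) as [y Hy].
    - intros eps He. destruct (half_pow_small (2 * C) eps) as [N HN]; [lra|exact He|].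
      exists N. intros n Hn. specialize (HN N (le_n N)). specialize (Hclose N n Hn). lra.
    - exists y. intros eps He. apply (limP_seq (X := Y)) with (eps := eps) in Hy; [|exact He].
      destruct Hy as [N1 HN1]. destruct (half_pow_small 1 eps) as [N2 HN2]; [lra|exact He|].
      destruct (Ha (Nat.max N1 N2)) as [HG H].
      exists (fst (a (Nat.max N1 N2))), (snd (a (Nat.max N1 N2))).
      specialize (HN1 _ (Nat.le_max_l N1 N2)). specialize (HN2 _ (Nat.le_max_r N1 N2)).
      repeat split; [exact HG|lra|exact HN1]. }
  apply functional_choice in Hex. destruct Hex as [T HT].
  exists T. repeat split.
  - intros x y. apply (Hcunique (plus x y)); [apply HT|]. apply Hcplus; apply HT.
  - intros k x. apply (Hcunique (scal k x)); [apply HT|]. apply Hcscal; apply HT.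
  - exists (C + 1). split; [lra|]. intros x. specialize (Hcb x (T x) (HT x)).
    pose proof (norm_ge_0 x). nra.
  - intros x. apply Hcb, HT.
  - intros x y H. apply (Hcunique x); [apply HT|]. intros eps He. exists x, y.
    rewrite !minus_self, !norm_zero. auto.
  - exact HT.
Qed.

End DenseExtension.

(** * The mean value inequality for right derivatives *)

(** The derivative of the orbits of a semigroup is only known from the right,
    which rules out integrating it; a supremum argument replaces the
    integral. *)
Lemma right_mean_value {F : scalar_field} {V : NormedModule F} (f : R -> V) a b M :
  a <= b ->
  (forall t, a <= t <= b -> filterlim f (locally t) (locally (f t))) ->
  (forall t eps, a <= t < b -> 0 < eps -> exists d, 0 < d /\ forall h, 0 < h < d ->
     norm (minus (f (t + h)) (f t)) <= (M + eps) * h) ->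
  norm (minus (f b) (f a)) <= M * (b - a).
Proof.
  intros Hab Hc Hd. apply le_epsilon. intros e0 He0.
  set (eps := e0 / (b - a + 1)).
  assert (Heps : 0 < eps) by (apply Rdiv_lt_0_compat; lra).
  set (P := fun t => a <= t <= b /\ forall s, a <= s <= t ->
              norm (minus (f s) (f a)) <= (M + eps) * (s - a)).
  assert (HPa : P a).
  { split; [lra|]. intros s Hs. replace s with a by lra. rewrite minus_self, norm_zero. lra. }
  destruct (completeness P) as [c [Hub Hlub]].
  { exists b. intros t [Ht _]. lra. }
  { now exists a. }
  assert (Hac : a <= c) by now apply Hub.
  assert (Hcb : c <= b) by (apply Hlub; intros t [Ht _]; lra).
  assert (Hlt : forall s, a <= s < c -> norm (minus (f s) (f a)) <= (M + eps) * (s - a)).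
  { intros s Hs. apply NNPP. intros Hn.
    assert (c <= s); [|lra]. apply Hlub. intros t [Ht HPt].
    apply Rnot_lt_le. intros Hst. apply Hn. apply HPt. lra. }
  assert (HPc : P c).
  { split; [lra|]. intros s Hs. destruct (Rlt_le_dec s c) as [Hsc|Hsc]; [apply Hlt; lra|].
    assert (s = c) by lra. subst s. clear Hsc Hs.
    destruct (Req_dec a c) as [->|Hne]; [rewrite minus_self, norm_zero; lra|].
    apply le_epsilon. intros e He. set (K := Rabs (M + eps) + 1).
    assert (HK : Rabs (M + eps) < K) by (unfold K; lra).
    pose proof (Rabs_pos (M + eps)) as HK0. pose proof (Rle_abs (- (M + eps))) as HKn.
    rewrite Rabs_Ropp in HKn.
    assert (H : locally c (fun s => norm (minus (f s) (f c)) < e / 2)).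
    { assert (Hcc : a <= c <= b) by lra. apply (limP (locally c) f (f c)); [exact (Hc c Hcc)|lra]. }
    apply locally_RP in H. destruct H as [d [Hd0 H]].
    pose proof (Rmin_l (d / 2) (Rmin (e / (2 * K)) (c - a))) as m1.
    pose proof (Rmin_r (d / 2) (Rmin (e / (2 * K)) (c - a))) as m2.
    pose proof (Rmin_l (e / (2 * K)) (c - a)) as m3. pose proof (Rmin_r (e / (2 * K)) (c - a)) as m4.
    set (h := Rmin (d / 2) (Rmin (e / (2 * K)) (c - a))) in *.
    assert (Hh : 0 < h) by (repeat apply Rmin_glb_lt; try apply Rdiv_lt_0_compat; lra).
    specialize (H (c - h)). rewrite Rabs_left in H by lra.
    specialize (H ltac:(lra)). specialize (Hlt (c - h) ltac:(lra)).
    pose proof (norm_minus_triangle (f c) (f (c - h)) (f a)) as Ht.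
    rewrite (norm_minus_sym (f c) (f (c - h))) in Ht.
    assert (- (M + eps) * h <= K * h) by (apply Rmult_le_compat_r; lra).
    assert (K * h <= e / 2).
    { apply Rle_trans with (K * (e / (2 * K))); [apply Rmult_le_compat_l; lra|]. right; field; lra. }
    nra. }
  assert (Hc_eq : c = b).
  { apply NNPP. intros Hne. destruct (Hd c eps ltac:(lra) Heps) as [d [Hd0 H]].
    assert (HP : P (c + Rmin (d / 2) (b - c))); [|apply Hub in HP; assert (0 < Rmin (d / 2) (b - c)) by (apply Rmin_glb_lt; lra); lra].
    pose proof (Rmin_l (d / 2) (b - c)). pose proof (Rmin_r (d / 2) (b - c)).
    assert (0 < Rmin (d / 2) (b - c)) by (apply Rmin_glb_lt; lra).
    split; [lra|]. intros s Hs. destruct (Rle_lt_dec s c) as [Hsc|Hsc].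
    - apply HPc. lra.
    - specialize (H (s - c) ltac:(lra)). replace (c + (s - c)) with s in H by ring.
      destruct HPc as [_ HPc]. specialize (HPc c ltac:(lra)).
      pose proof (norm_minus_triangle (f s) (f c) (f a)). nra. }
  subst c. destruct HPc as [_ HPc]. specialize (HPc b ltac:(lra)).
  assert (eps * (b - a) <= e0).
  { replace e0 with (eps * (b - a + 1)) by (unfold eps; field; lra). nra. }
  lra.
Qed.

(** * Strongly continuous semigroups *)

Lemma at_right0_P (P : R -> Prop) :
  at_right 0 P <-> exists d, 0 < d /\ forall h, 0 < h < d -> P h.
Proof.
  unfold at_right, within. rewrite locally_RP. split; intros [d [Hd H]]; exists d; split; auto.
  - intros h Hh. apply H; [|lra]. rewrite Rminus_0_r, Rabs_pos_eq; lra.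
  - intros h Hh H0. apply H. rewrite Rminus_0_r, Rabs_pos_eq in Hh; lra.
Qed.

Definition locally_bounded {F : scalar_field} {V : NormedModule F} (T : R -> V -> V) : Prop :=
  forall c, exists M, 0 < M /\ forall t (x : V), 0 <= t <= c -> norm (T t x) <= M * norm x.

Section Semigroup.
Context {F : scalar_field} {V : NormedModule F}.
Variable T : R -> V -> V.
Hypothesis HT : C0_semigroup T.

Lemma sg_linear t : 0 <= t -> is_linear (T t).
Proof. apply HT. Qed.

Lemma sg_0 x : T 0 x = x.
Proof. apply HT. Qed.

Lemma sg_add s t x : 0 <= s -> 0 <= t -> T (s + t) x = T s (T t x).
Proof. apply HT. Qed.

Lemma sg_comm s t x : 0 <= s -> 0 <= t -> T s (T t x) = T t (T s x).
Proof. intros. rewrite <- !sg_add by assumption. f_equal. ring. Qed.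

Lemma sg_right_limit (x : V) eps : 0 < eps ->
  exists d, 0 < d /\ forall h, 0 <= h < d -> norm (minus (T h x) x) < eps.
Proof.
  intros He. destruct HT as [_ [_ [_ Hc]]].
  specialize (Hc x). apply (limP (at_right 0) (fun t => T t x) x) with (eps := eps) in Hc; [|exact He].
  apply at_right0_P in Hc. destruct Hc as [d [Hd H]]. exists d. split; [exact Hd|].
  intros h Hh. destruct (Req_dec h 0) as [->|Hn].
  - rewrite sg_0, minus_self, norm_zero. exact He.
  - apply H. lra.
Qed.

Lemma locally_bounded_of_short d M :
  0 < d -> (forall t (x : V), 0 <= t <= d -> norm (T t x) <= M * norm x) -> locally_bounded T.
Proof.
  intros Hd HM c. set (M1 := Rmax 1 M).
  assert (H1 : 1 <= M1) by apply Rmax_l. assert (H2 : M <= M1) by apply Rmax_r.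
  assert (Hn : forall n : nat, forall t (x : V), 0 <= t <= INR n * d -> norm (T t x) <= M1 ^ n * norm x).
  { induction n as [|n IH]; intros t x Ht.
    - simpl in Ht. replace t with 0 by lra. rewrite sg_0. simpl. lra.
    - rewrite S_INR in Ht. pose proof (norm_ge_0 x) as Hx.
      assert (1 <= M1 ^ n) by now apply pow_R1_Rle.
      destruct (Rle_lt_dec t d) as [Htd|Htd].
      + eapply Rle_trans; [apply HM; lra|]. simpl. apply Rmult_le_compat_r; [exact Hx|nra].
      + replace t with (d + (t - d)) by ring. rewrite sg_add by lra.
        eapply Rle_trans; [apply HM; lra|].
        specialize (IH (t - d) x ltac:(lra)).
        pose proof (norm_ge_0 (T (t - d) x)). simpl. nra. }
  destruct (INR_unbounded (c / d)) as [n Hcn].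
  exists (M1 ^ n). split; [apply pow_lt; lra|]. intros t x Ht. apply Hn. split; [lra|].
  apply Rmult_lt_compat_r with (r := d) in Hcn; [|exact Hd].
  unfold Rdiv in Hcn. rewrite Rmult_assoc, Rinv_l, Rmult_1_r in Hcn by lra. lra.
Qed.

(** If no bound held near time zero, operators [T t] at times tending to zero
    would be pointwise bounded, their values converging, without being
    uniformly bounded. *)
Lemma C0_semigroup_locally_bounded (hV : is_complete V) : locally_bounded T.
Proof.
  assert (H : exists n : nat, forall t (x : V), 0 <= t <= / (INR n + 1) -> norm (T t x) <= INR n * norm x).
  { apply NNPP. intros Hno.
    assert (Hbad : forall n : nat, exists q : R * V, 0 <= fst q <= / (INR n + 1) /\
      INR n * norm (snd q) < norm (T (fst q) (snd q))).
    { intros n. apply NNPP. intros Hn. apply Hno. exists n. intros t x Ht.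
      apply Rnot_lt_le. intros Hlt. apply Hn. now exists (t, x). }
    apply functional_choice in Hbad. destruct Hbad as [q Hq].
    destruct (uniform_boundedness hV (fun n x => T (fst (q n)) x)) as [C [HC HB]].
    - intros n. apply sg_linear. apply Hq.
    - intros x. destruct (sg_right_limit x 1 Rlt_0_1) as [d [Hd H]].
      destruct (INR_unbounded (/ d)) as [N HN].
      assert (Hbig : forall n, (N <= n)%nat -> norm (T (fst (q n)) x) <= norm x + 1).
      { intros n Hn. apply le_INR in Hn. destruct (Hq n) as [[H0 H1] _].
        assert (/ (INR n + 1) < d).
        { rewrite <- (Rinv_inv d). apply Rinv_lt_contravar; [|lra].
          apply Rmult_lt_0_compat; [now apply Rinv_0_lt_compat|].
          pose proof (pos_INR n). lra. }
        specialize (H (fst (q n)) ltac:(lra)).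
        pose proof (norm_le_minus (T (fst (q n)) x) x). lra. }
      assert (Hfin : forall N, exists B, forall n, (n < N)%nat -> norm (T (fst (q n)) x) <= B).
      { clear. intros N. induction N as [|N [B HB]]; [exists 0; lia|].
        exists (Rmax B (norm (T (fst (q N)) x))). intros n Hn.
        destruct (Nat.eq_dec n N) as [->|Hne]; [apply Rmax_r|].
        eapply Rle_trans; [apply HB; lia | apply Rmax_l]. }
      destruct (Hfin N) as [B HB]. exists (Rmax B (norm x + 1)). intros n.
      destruct (Nat.lt_ge_cases n N) as [Hn|Hn].
      + eapply Rle_trans; [now apply HB | apply Rmax_l].
      + eapply Rle_trans; [now apply Hbig | apply Rmax_r].
    - destruct (INR_unbounded C) as [n Hn].
      destruct (Hq n) as [_ H]. specialize (HB n (snd (q n))). simpl in HB.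
      pose proof (norm_ge_0 (snd (q n))). nra. }
  destruct H as [n Hn].
  apply (locally_bounded_of_short (/ (INR n + 1)) (INR n)); [|exact Hn].
  apply Rinv_0_lt_compat. pose proof (pos_INR n). lra.
Qed.

(** ** The generator *)

Lemma generatorP (x y : V) :
  generator T x y <-> forall eps, 0 < eps -> exists d, 0 < d /\ forall h, 0 < h < d ->
    norm (minus (minus (T h x) x) (scal (ofR h) y)) <= eps * h.
Proof.
  transitivity (forall eps, 0 < eps -> at_right 0
    (fun h => norm (minus (scal (ofR (/ h)) (minus (T h x) x)) y) < eps)).
  { apply limP. typeclasses eauto. }
  split; intros H eps He.
  - specialize (H eps He). apply at_right0_P in H. destruct H as [d [Hd H]].
    exists d; split; [exact Hd|]. intros h Hh. specialize (H h Hh).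
    replace (minus (minus (T h x) x) (scal (ofR h) y)) with
      (rscal h (minus (scal (ofR (/ h)) (minus (T h x) x)) y)) by vmod.
    rewrite norm_rscal, Rabs_pos_eq by lra. nra.
  - destruct (H (eps / 2)) as [d [Hd H']]; [lra|]. apply at_right0_P.
    exists d; split; [exact Hd|]. intros h Hh. specialize (H' h Hh).
    replace (minus (scal (ofR (/ h)) (minus (T h x) x)) y) with
      (rscal (/ h) (minus (minus (T h x) x) (scal (ofR h) y))) by vmod.
    assert (0 < / h) by (apply Rinv_0_lt_compat; lra).
    rewrite norm_rscal, Rabs_pos_eq by lra.
    apply Rle_lt_trans with (/ h * (eps / 2 * h)); [apply Rmult_le_compat_l; lra|].
    field_simplify; lra.
Qed.

Lemma generator_plus (x x' y y' : V) :
  generator T x y -> generator T x' y' -> generator T (plus x x') (plus y y').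
Proof.
  rewrite !generatorP. intros H H' eps He.
  destruct (H (eps / 2)) as [d [Hd H1]]; [lra|].
  destruct (H' (eps / 2)) as [d' [Hd' H1']]; [lra|].
  exists (Rmin d d'). split; [now apply Rmin_glb_lt|]. intros h Hh.
  pose proof (Rmin_l d d'). pose proof (Rmin_r d d').
  specialize (H1 h ltac:(lra)). specialize (H1' h ltac:(lra)).
  rewrite (linear_plus _ (sg_linear h ltac:(lra))).
  replace (minus (minus (plus (T h x) (T h x')) (plus x x')) (scal (ofR h) (plus y y'))) with
    (plus (minus (minus (T h x) x) (scal (ofR h) y)) (minus (minus (T h x') x') (scal (ofR h) y'))) by vmod.
  eapply Rle_trans; [apply norm_triangle|]. lra.
Qed.

Lemma generator_linear_image (A : V -> V) (x y : V) :
  is_linear A -> (forall h, 0 <= h -> A (T h x) = T h (A x)) ->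
  generator T x y -> generator T (A x) (A y).
Proof.
  intros HA Hc H. unfold generator in *.
  apply (filterlim_ext_loc (fun t => A (scal (ofR (/ t)) (minus (T t x) x)))).
  - apply at_right0_P. exists 1. split; [lra|]. intros h Hh.
    rewrite (linear_scal A HA), linear_sub, Hc by (assumption || lra). reflexivity.
  - now apply linear_lim.
Qed.

Lemma generator_scal (k : F) (x y : V) : generator T x y -> generator T (scal k x) (scal k y).
Proof.
  apply (generator_linear_image (fun v => scal k v)); [apply is_linear_scalar|].
  intros h Hh. symmetry. apply (linear_scal _ (sg_linear h Hh)).
Qed.

Lemma generator_minus (x x' y y' : V) :
  generator T x y -> generator T x' y' -> generator T (minus x x') (minus y y').
Proof.
  intros H H'. apply (generator_scal (ofR (-1))) in H'.
  replace (minus x x') with (plus x (scal (ofR (-1)) x')) by vmod.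
  replace (minus y y') with (plus y (scal (ofR (-1)) y')) by vmod.
  now apply generator_plus.
Qed.

Lemma generator_eq (x y x' y' : V) : generator T x y -> x = x' -> y = y' -> generator T x' y'.
Proof. now intros H <- <-. Qed.

Lemma generator_orbit t (x y : V) : 0 <= t -> generator T x y -> generator T (T t x) (T t y).
Proof.
  intros Ht. apply generator_linear_image; [now apply sg_linear|].
  intros h Hh. now apply sg_comm.
Qed.

Section Bounded.
Hypothesis HB : locally_bounded T.

Lemma orbit_cont (x : V) : cont (fun t => T (Rmax 0 t) x).
Proof.
  intros t. apply limP; [typeclasses eauto|]. intros eps He. apply locally_RP.
  destruct (HB (Rmax 0 t + 1)) as [M [HM HMb]].
  destruct (sg_right_limit x (eps / M)) as [d [Hd H]]; [now apply Rdiv_lt_0_compat|].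
  exists (Rmin d 1). split; [apply Rmin_glb_lt; lra|]. intros s Hs.
  pose proof (Rmin_l d 1). pose proof (Rmin_r d 1).
  assert (Hst : Rabs (Rmax 0 s - Rmax 0 t) <= Rabs (s - t)).
  { unfold Rmax. destruct (Rle_dec 0 s), (Rle_dec 0 t); unfold Rabs;
      repeat destruct Rcase_abs; lra. }
  pose proof (Rmax_l 0 s). pose proof (Rmax_l 0 t).
  set (a := Rmax 0 s) in *. set (b := Rmax 0 t) in *.
  assert (Hmain : forall p q, 0 <= p -> 0 <= q < d -> p <= b + 1 ->
    norm (minus (T (p + q) x) (T p x)) < eps).
  { intros p q Hp Hq Hpb. rewrite sg_add, <- linear_sub by (try apply sg_linear; lra).
    eapply Rle_lt_trans; [apply HMb; lra|].
    apply Rlt_le_trans with (M * (eps / M)); [|right; field; lra].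
    apply Rmult_lt_compat_l; [exact HM|]. now apply H. }
  assert (Rabs (a - b) < Rmin d 1) by lra.
  destruct (Rle_lt_dec b a) as [Hab|Hab].
  - rewrite Rabs_pos_eq in * by lra. replace a with (b + (a - b)) by ring. apply Hmain; lra.
  - rewrite Rabs_left in H4 by lra. rewrite norm_minus_sym.
    replace b with (a + (b - a)) by ring. apply Hmain; lra.
Qed.

(** The mean value inequality for [T r x - r v], whose right derivative is
    [T r y - v]. *)
Lemma generator_increment (x y v : V) h B :
  generator T x y -> 0 <= h -> (forall r, 0 <= r < h -> norm (minus (T r y) v) <= B) ->
  norm (minus (minus (T h x) x) (scal (ofR h) v)) <= B * h.
Proof.
  intros Hg Hh Hv.
  set (f := fun r => minus (T (Rmax 0 r) x) (scal (ofR r) v)).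
  assert (Hr : norm (minus (f h) (f 0)) <= B * (h - 0)).
  { apply right_mean_value; [exact Hh| |].
    - intros t _. apply (lim_minus (locally t)); [apply orbit_cont|].
      apply cont_rscal.
    - intros t eps Ht He. destruct (HB h) as [M [HM HMb]].
      destruct (proj1 (generatorP x y) Hg (eps / M)) as [d [Hd Hgd]]; [now apply Rdiv_lt_0_compat|].
      exists d. split; [exact Hd|]. intros k Hk. unfold f.
      rewrite !Rmax_right by lra. rewrite sg_add by lra.
      specialize (Hgd k Hk). specialize (Hv t ltac:(lra)).
      assert (Hlin : is_linear (T t)) by (apply sg_linear; lra).
      replace (minus (minus (T t (T k x)) (scal (ofR (t + k)) v)) (minus (T t x) (scal (ofR t) v)))
        with (plus (T t (minus (minus (T k x) x) (scal (ofR k) y))) (rscal k (minus (T t y) v))).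
      2: { rewrite !linear_sub, (linear_scal _ Hlin) by exact Hlin. vmod. }
      eapply Rle_trans; [apply norm_triangle|]. rewrite norm_rscal, (Rabs_pos_eq k) by lra.
      specialize (HMb t (minus (minus (T k x) x) (scal (ofR k) y)) ltac:(lra)).
      assert (M * norm (minus (minus (T k x) x) (scal (ofR k) y)) <= M * (eps / M * k))
        by (apply Rmult_le_compat_l; lra).
      replace (M * (eps / M * k)) with (eps * k) in * by (field; lra). nra. }
  unfold f in Hr. rewrite (Rmax_right 0 h), (Rmax_right 0 0), sg_0, Rminus_0_r in Hr by lra.
  replace (minus (minus (T h x) x) (scal (ofR h) v)) with
    (minus (minus (T h x) (scal (ofR h) v)) (minus x (scal (ofR 0) v))) by vmod.
  exact Hr.
Qed.

(** [generator_increment] bounds the remainder of the first-order expansion of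
    an orbit uniformly over a bounded piece of the graph, so the expansion
    passes to the limit. *)
Lemma generator_closed (x y : V) :
  (forall eps, 0 < eps -> exists x' y' : V, generator T x' y' /\
     norm (minus x' x) < eps /\ norm (minus y' y) < eps) -> generator T x y.
Proof.
  intros H. apply generatorP. intros eps He.
  destruct (sg_right_limit y (eps / 4)) as [d [Hd Hdy]]; [lra|].
  exists (Rmin d 1). split; [apply Rmin_glb_lt; lra|]. intros h Hh.
  pose proof (Rmin_l d 1). pose proof (Rmin_r d 1).
  destruct (HB 1) as [M [HM HMb]].
  apply le_epsilon. intros e0 He0.
  set (e := Rmin (eps / (4 * M)) (e0 / (M + 3))).
  assert (He1 : 0 < e) by (apply Rmin_glb_lt; apply Rdiv_lt_0_compat; lra).
  assert (M * e <= eps / 4).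
  { apply Rle_trans with (M * (eps / (4 * M))); [apply Rmult_le_compat_l; [lra|apply Rmin_l]|right; field; lra]. }
  assert ((M + 3) * e <= e0).
  { apply Rle_trans with ((M + 3) * (e0 / (M + 3))); [apply Rmult_le_compat_l; [lra|apply Rmin_r]|right; field; lra]. }
  destruct (H e He1) as [x' [y' [Hg [Hx Hy]]]].
  assert (Hi : norm (minus (minus (T h x') x') (scal (ofR h) y')) <= (eps / 2 + e) * h).
  { apply (generator_increment x' y'); [exact Hg|lra|]. intros r Hr.
    replace (minus (T r y') y') with (plus (minus (T r y') (T r y)) (plus (minus (T r y) y) (minus y y'))) by vmod.
    rewrite <- (linear_sub (T r)) by (apply sg_linear; lra).
    eapply Rle_trans; [apply norm_triangle|].
    eapply Rle_trans; [apply Rplus_le_compat_l, norm_triangle|].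
    rewrite (norm_minus_sym y y').
    assert (norm (T r (minus y' y)) <= M * norm (minus y' y)) by (apply HMb; lra).
    assert (M * norm (minus y' y) <= M * e) by (apply Rmult_le_compat_l; lra).
    specialize (Hdy r ltac:(lra)).
    lra. }
  replace (minus (minus (T h x) x) (scal (ofR h) y)) with
    (plus (minus (minus (T h x') x') (scal (ofR h) y'))
      (plus (minus (T h x) (T h x')) (plus (minus x' x) (rscal h (minus y' y))))) by vmod.
  rewrite <- (linear_sub (T h)) by (apply sg_linear; lra).
  eapply Rle_trans; [apply norm_triangle|].
  eapply Rle_trans; [apply Rplus_le_compat_l, norm_triangle|].
  eapply Rle_trans; [apply Rplus_le_compat_l, Rplus_le_compat_l, norm_triangle|].
  rewrite norm_rscal, (Rabs_pos_eq h) by lra.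
  pose proof (HMb h (minus x x') ltac:(lra)) as H5. rewrite (norm_minus_sym x x') in H5.
  assert (M * norm (minus x' x) <= M * e) by (apply Rmult_le_compat_l; lra).
  assert (h * norm (minus y' y) <= h * e) by (apply Rmult_le_compat_l; lra).
  assert (h * e <= 1 * e) by (apply Rmult_le_compat_r; lra).
  assert (0 < eps * h) by (apply Rmult_lt_0_compat; lra).
  lra.
Qed.

End Bounded.
End Semigroup.

(** * Convolution with a semigroup *)

Section ContinuousFunctions.
Context {F : scalar_field} {V : NormedModule F}.

Lemma contP (g : R -> V) : cont g <-> forall t eps, 0 < eps ->
  exists d, 0 < d /\ forall s, Rabs (s - t) < d -> norm (minus (g s) (g t)) < eps.
Proof.
  split.
  - intros H t eps He. apply locally_RP.
    apply (limP (locally t) g (g t)); [apply H | exact He].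
  - intros H t. apply (limP (locally t) g (g t)). intros eps He. apply locally_RP. now apply H.
Qed.

Lemma cont_uniform (g : R -> V) K eps : cont g -> 0 < eps ->
  exists d, 0 < d /\ forall a b, Rabs a <= K -> Rabs b <= K -> Rabs (a - b) < d ->
    norm (minus (g a) (g b)) < eps.
Proof.
  intros Hg He.
  destruct (unifcont_normed_1d g (- K) K (fun x _ => Hg x) (mkposreal eps He)) as [d Hd].
  exists d. split; [apply cond_pos|]. intros a b Ha Hb Hab.
  apply Rabs_le_between in Ha, Hb.
  apply (Hd b a Hb Ha). exact Hab.
Qed.

Lemma cont_norm (g : R -> V) : cont g -> forall t, continuous (fun s => norm (g s)) t.
Proof. intros Hg t. exact (filterlim_comp _ _ _ g norm _ _ _ (Hg t) (filterlim_norm (g t))). Qed.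

Lemma cont_bounded (g : R -> V) K : cont g ->
  exists B, 0 < B /\ forall a, Rabs a <= K -> norm (g a) <= B.
Proof.
  intros Hg. destruct (Rle_lt_dec 0 K) as [HK|HK].
  - destruct (continuity_ab_maj (fun s => norm (g s)) (- K) K) as [m [Hm _]]; [lra| |].
    + intros c _. apply continuity_pt_filterlim. now apply cont_norm.
    + exists (norm (g m) + 1). pose proof (norm_ge_0 (g m)). split; [lra|].
      intros a Ha. apply Rabs_le_between in Ha. specialize (Hm a Ha). simpl in Hm. lra.
  - exists 1. split; [lra|]. intros a Ha. pose proof (Rabs_pos a). lra.
Qed.

Lemma integral_norm_le_abs (hV : is_complete V) (f : R -> V) a b M :
  cont f -> (forall s, Rmin a b <= s <= Rmax a b -> norm (f s) <= M) ->
  norm (integral f a b) <= Rabs (b - a) * M.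
Proof.
  intros Hf HM. destruct (Rle_lt_dec a b) as [Hab|Hab].
  - rewrite Rabs_pos_eq by lra. rewrite Rmin_left, Rmax_right in HM by lra.
    now apply integral_norm_le.
  - rewrite Rabs_left by lra. rewrite Rmin_right, Rmax_left in HM by lra.
    replace (integral f a b) with (opp (integral f b a)).
    + rewrite norm_opp. replace (- (b - a)) with (a - b) by ring. apply integral_norm_le; lra || assumption.
    + pose proof (integral_Chasles hV f a b a Hf) as H. rewrite integral_point in H.
      replace (integral f a b) with (minus (plus (integral f a b) (integral f b a)) (integral f b a)) by vmod.
      rewrite H. vmod.
Qed.

Lemma cont_scal_fun (p : R -> R) (f : R -> V) : (forall s, continuous p s) -> cont f ->
  cont (fun s => scal (ofR (p s)) (f s)).
Proof.
  intros Hp Hf t.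
  exact (filterlim_comp_2 p f (fun r (x : realified V) => scal r x) (Hp t) (Hf t)
    (filterlim_scal (K := R_AbsRing) (V := realified V) (p t) (f t))).
Qed.

Lemma integral_zero a b : integral (fun _ => (zero : V)) a b = zero.
Proof. rewrite integral_const. vmod. Qed.

End ContinuousFunctions.

(** [Rmax 0 s] extends the orbits to negative times by their initial value;
    the integrand is then continuous on the whole line. *)
Definition conv {F : scalar_field} {V : NormedModule F} (T : R -> V -> V) (f : R -> V) (t : R) : V :=
  integral (fun s => T (Rmax 0 s) (f (t - s))) 0 t.

(** The domain of the [n]-th power of the generator. *)
Fixpoint gdom {F : scalar_field} {V : NormedModule F} (T : R -> V -> V) (n : nat) (x : V) : Prop :=
  match n with
  | O => True
  | S n' => exists y, generator T x y /\ gdom T n' y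
  end.

Section Convolution.
Context {F : scalar_field} {V : NormedModule F}.
Hypothesis hV : is_complete V.
Variable T : R -> V -> V.
Hypothesis HT : C0_semigroup T.

Let HB : locally_bounded T := C0_semigroup_locally_bounded T HT hV.

Lemma ext_linear s : is_linear (T (Rmax 0 s)).
Proof. apply sg_linear; [exact HT | apply Rmax_l]. Qed.

Lemma ext_bounded K : exists M, 0 < M /\ forall s (x : V), Rabs s <= K -> norm (T (Rmax 0 s) x) <= M * norm x.
Proof.
  destruct (HB (Rmax 0 K)) as [M [HM HMb]]. exists M. split; [exact HM|].
  intros s x Hs. apply HMb. split; [apply Rmax_l|]. apply Rle_max_compat_l.
  pose proof (Rle_abs s). lra.
Qed.

Lemma ext_apply_cont (f : R -> V) : cont f -> cont (fun s => T (Rmax 0 s) (f s)).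
Proof.
  intros Hf. apply contP. intros t eps He.
  destruct (ext_bounded (Rabs t + 1)) as [M [HM HMb]].
  destruct (proj1 (contP f) Hf t (eps / (2 * M))) as [d1 [Hd1 H1]]; [apply Rdiv_lt_0_compat; lra|].
  destruct (proj1 (contP _) (orbit_cont T HT HB (f t)) t (eps / 2)) as [d2 [Hd2 H2]]; [lra|].
  exists (Rmin 1 (Rmin d1 d2)). split; [repeat apply Rmin_glb_lt; lra|]. intros s Hs.
  pose proof (Rmin_l 1 (Rmin d1 d2)). pose proof (Rmin_r 1 (Rmin d1 d2)).
  pose proof (Rmin_l d1 d2). pose proof (Rmin_r d1 d2).
  specialize (H1 s ltac:(lra)). specialize (H2 s ltac:(lra)).
  eapply Rle_lt_trans; [apply (norm_minus_triangle _ (T (Rmax 0 s) (f t)))|].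
  rewrite <- (linear_sub (T (Rmax 0 s))) by apply ext_linear.
  assert (Rabs s <= Rabs t + 1).
  { pose proof (Rabs_triang (s - t) t) as Htr. replace (s - t + t) with s in Htr by ring. lra. }
  assert (norm (T (Rmax 0 s) (minus (f s) (f t))) <= M * norm (minus (f s) (f t))) by now apply HMb.
  assert (M * norm (minus (f s) (f t)) < M * (eps / (2 * M))) by (apply Rmult_lt_compat_l; lra).
  replace (M * (eps / (2 * M))) with (eps / 2) in * by (field; lra). lra.
Qed.

Lemma cont_reflect (f : R -> V) t : cont f -> cont (fun s => f (t - s)).
Proof.
  intros Hf. apply contP. intros s eps He.
  destruct (proj1 (contP f) Hf (t - s) eps He) as [d [Hd H]]. exists d. split; [exact Hd|].
  intros r Hr. apply H. replace (t - r - (t - s)) with (- (r - s)) by ring. now rewrite Rabs_Ropp.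
Qed.

Lemma cont_shift (f : R -> V) t : cont f -> cont (fun s => f (t + s)).
Proof.
  intros Hf. apply contP. intros s eps He.
  destruct (proj1 (contP f) Hf (t + s) eps He) as [d [Hd H]]. exists d. split; [exact Hd|].
  intros r Hr. apply H. replace (t + r - (t + s)) with (r - s) by ring. exact Hr.
Qed.

Lemma conv_integrand_cont (f : R -> V) t : cont f -> cont (fun s => T (Rmax 0 s) (f (t - s))).
Proof. intros Hf. apply ext_apply_cont. now apply cont_reflect. Qed.

Lemma conv_ext (f g : R -> V) t :
  0 <= t -> cont f -> (forall s, 0 <= s <= t -> g s = f s) -> conv T g t = conv T f t.
Proof.
  intros Ht Hf Hfg. apply (integral_ext hV); [exact Ht| now apply conv_integrand_cont|].
  intros s Hs. rewrite Hfg by lra. reflexivity.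
Qed.

Lemma conv_plus (f g : R -> V) t : cont f -> cont g ->
  conv T (fun s => plus (f s) (g s)) t = plus (conv T f t) (conv T g t).
Proof.
  intros Hf Hg. unfold conv. rewrite <- (integral_plus hV) by now apply conv_integrand_cont.
  f_equal. apply functional_extensionality. intros s. apply (linear_plus _ (ext_linear s)).
Qed.

Lemma conv_minus (f g : R -> V) t : cont f -> cont g ->
  conv T (fun s => minus (f s) (g s)) t = minus (conv T f t) (conv T g t).
Proof.
  intros Hf Hg. unfold conv. rewrite <- (integral_minus hV) by now apply conv_integrand_cont.
  f_equal. apply functional_extensionality. intros s. apply linear_sub, ext_linear.
Qed.

Lemma conv_linear_image (A : V -> V) (f : R -> V) t : is_linear A -> cont f ->
  (forall s x, 0 <= s -> A (T s x) = T s (A x)) ->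
  conv T (fun s => A (f s)) t = A (conv T f t).
Proof.
  intros HA Hf Hc. unfold conv.
  rewrite <- (integral_linear hV A) by (assumption || now apply conv_integrand_cont).
  f_equal. apply functional_extensionality. intros s. symmetry. apply Hc, Rmax_l.
Qed.

Lemma conv_scal (k : F) (f : R -> V) t : cont f ->
  conv T (fun s => scal k (f s)) t = scal k (conv T f t).
Proof.
  intros Hf. apply (conv_linear_image (fun v => scal k v)); [apply is_linear_scalar|exact Hf|].
  intros s x Hs. symmetry. apply (linear_scal _ (sg_linear T HT s Hs)).
Qed.

Lemma conv_zero t : conv T (fun _ => (zero : V)) t = zero.
Proof.
  unfold conv. transitivity (integral (fun _ => (zero : V)) 0 t); [|apply integral_zero].
  f_equal. apply functional_extensionality. intros s. apply linear_0, ext_linear.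
Qed.

Lemma conv_at (f : R -> V) : conv T f 0 = zero.
Proof. apply integral_point. Qed.

Lemma conv_bound (f : R -> V) t M B : 0 <= t -> cont f ->
  (forall s (x : V), 0 <= s <= t -> norm (T s x) <= M * norm x) -> 0 <= M ->
  (forall s, 0 <= s <= t -> norm (f s) <= B) -> norm (conv T f t) <= t * (M * B).
Proof.
  intros Ht Hf HM HM0 HBf. replace (t * (M * B)) with ((t - 0) * (M * B)) by ring.
  apply (integral_norm_le hV); [exact Ht|now apply conv_integrand_cont|].
  intros s Hs. rewrite Rmax_right by lra. eapply Rle_trans; [now apply HM|].
  apply Rmult_le_compat_l; [exact HM0|]. apply HBf. lra.
Qed.

Lemma conv_add (f : R -> V) t s : 0 <= t -> 0 <= s -> cont f ->
  conv T f (t + s) = plus (T t (conv T f s)) (conv T (fun r => f (s + r)) t).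
Proof.
  intros Ht Hs Hf. unfold conv.
  rewrite <- (integral_Chasles hV _ 0 t (t + s)) by now apply conv_integrand_cont.
  rewrite plus_comm. f_equal.
  - rewrite <- (integral_linear hV (T t)) by (now apply sg_linear || now apply conv_integrand_cont).
    pose proof (integral_shift hV (fun r => T (Rmax 0 r) (f (t + s - r))) 0 s t) as H.
    rewrite Rplus_0_l, (Rplus_comm s t) in H. rewrite <- H by now apply conv_integrand_cont. symmetry.
    apply (integral_ext hV); [exact Hs| |].
    + apply (cont_comp (fun r => T (Rmax 0 r) (f (t + s - r))) (fun r => r + t)).
      * intros r. apply (continuous_plus (V := R_NormedModule)); [apply continuous_id|apply continuous_const].
      * now apply conv_integrand_cont.
    + intros r Hr. rewrite !Rmax_right by lra. replace (r + t) with (t + r) by ring.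
      rewrite sg_add by (assumption || lra). do 2 f_equal. f_equal. ring.
  - f_equal. apply functional_extensionality. intros r. do 2 f_equal. ring.
Qed.

Lemma conv_small (f : R -> V) : cont f -> forall eps, 0 < eps -> exists d, 0 < d /\
  forall h, 0 < h < d -> norm (minus (conv T f h) (scal (ofR h) (f 0))) <= eps * h.
Proof.
  intros Hf eps He.
  destruct (ext_bounded 1) as [M [HM HMb]].
  destruct (proj1 (contP f) Hf 0 (eps / (2 * M))) as [d1 [Hd1 H1]]; [apply Rdiv_lt_0_compat; lra|].
  destruct (sg_right_limit T HT (f 0) (eps / 2)) as [d2 [Hd2 H2]]; [lra|].
  exists (Rmin 1 (Rmin d1 d2)). split; [repeat apply Rmin_glb_lt; lra|]. intros h Hh.
  pose proof (Rmin_l 1 (Rmin d1 d2)). pose proof (Rmin_r 1 (Rmin d1 d2)).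
  pose proof (Rmin_l d1 d2). pose proof (Rmin_r d1 d2).
  unfold conv.
  assert (E : scal (ofR h) (f 0) = integral (fun _ => f 0) 0 h)
    by (rewrite integral_const; now rewrite Rminus_0_r).
  rewrite E, <- (integral_minus hV) by (now apply conv_integrand_cont || apply cont_const).
  replace (eps * h) with ((h - 0) * eps) by ring.
  apply (integral_norm_le hV); [lra| |].
  - apply cont_minus; [now apply conv_integrand_cont|apply cont_const].
  - intros s Hs. rewrite Rmax_right by lra.
    eapply Rle_trans; [apply (norm_minus_triangle _ (T s (f 0)))|].
    rewrite <- (linear_sub (T s)) by (apply sg_linear; lra || assumption).
    specialize (H2 s ltac:(lra)). specialize (H1 (h - s)). rewrite Rminus_0_r, Rabs_pos_eq in H1 by lra.
    specialize (H1 ltac:(lra)).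
    specialize (HMb s (minus (f (h - s)) (f 0))). rewrite Rmax_right, Rabs_pos_eq in HMb by lra.
    specialize (HMb ltac:(lra)).
    assert (M * norm (minus (f (h - s)) (f 0)) < M * (eps / (2 * M))) by (apply Rmult_lt_compat_l; lra).
    replace (M * (eps / (2 * M))) with (eps / 2) in * by (field; lra). lra.
Qed.

(** The derivative of a convolution falls on the function; the change of the
    upper limit of integration contributes the second term. *)
Lemma conv_increment (f : R -> V) t h : cont f ->
  minus (conv T f (t + h)) (conv T f t) =
  plus (integral (fun s => T (Rmax 0 s) (minus (f (t + h - s)) (f (t - s)))) 0 t)
       (integral (fun s => T (Rmax 0 s) (f (t + h - s))) t (t + h)).
Proof.
  intros Hf. unfold conv.
  rewrite <- (integral_Chasles hV (fun s => T (Rmax 0 s) (f (t + h - s))) 0 t (t + h)) by now apply conv_integrand_cont.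
  assert (E : integral (fun s => T (Rmax 0 s) (minus (f (t + h - s)) (f (t - s)))) 0 t =
    minus (integral (fun s => T (Rmax 0 s) (f (t + h - s))) 0 t) (integral (fun s => T (Rmax 0 s) (f (t - s))) 0 t)).
  { rewrite <- (integral_minus hV) by now apply conv_integrand_cont.
    f_equal. apply functional_extensionality. intros s. apply linear_sub, ext_linear. }
  rewrite E. vmod.
Qed.

Lemma between_abs t h s : Rmin t (t + h) <= s <= Rmax t (t + h) ->
  Rabs (t + h - s) <= Rabs h /\ Rabs (s - t) <= Rabs h.
Proof.
  unfold Rmin, Rmax. destruct (Rle_dec t (t + h)); intros Hs;
  unfold Rabs; repeat destruct Rcase_abs; lra.
Qed.

Lemma between_abs0 t s : Rmin 0 t <= s <= Rmax 0 t -> Rabs s <= Rabs t /\ Rabs (t - s) <= Rabs t.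
Proof.
  intros Hs. pose proof (between_abs 0 t s) as H. rewrite Rplus_0_l, Rminus_0_r in H.
  destruct (H Hs). auto.
Qed.

Lemma cont_conv (g : R -> V) : cont g -> cont (conv T g).
Proof.
  intros Hg. apply contP. intros t eps He.
  destruct (ext_bounded (Rabs t + 1)) as [M [HM HMb]].
  destruct (cont_bounded g 1 Hg) as [B [HB0 HBb]].
  pose proof (Rabs_pos t) as Ht.
  assert (Hq : 0 < eps / (2 * M * (Rabs t + 1))).
  { apply Rdiv_lt_0_compat; [lra|]. apply Rmult_lt_0_compat; lra. }
  destruct (cont_uniform g (Rabs t + 1) _ Hg Hq) as [d1 [Hd1 H1]].
  assert (Hq2 : 0 < eps / (2 * M * B)).
  { apply Rdiv_lt_0_compat; [lra|]. apply Rmult_lt_0_compat; lra. }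
  exists (Rmin 1 (Rmin d1 (eps / (2 * M * B)))).
  split; [repeat apply Rmin_glb_lt; lra|]. intros r Hr.
  pose proof (Rmin_l 1 (Rmin d1 (eps / (2 * M * B)))). pose proof (Rmin_r 1 (Rmin d1 (eps / (2 * M * B)))).
  pose proof (Rmin_l d1 (eps / (2 * M * B))). pose proof (Rmin_r d1 (eps / (2 * M * B))).
  set (h := r - t) in *. replace r with (t + h) by (unfold h; ring).
  rewrite conv_increment by exact Hg.
  eapply Rle_lt_trans; [apply norm_triangle|].
  assert (I1 : norm (integral (fun s => T (Rmax 0 s) (minus (g (t + h - s)) (g (t - s)))) 0 t)
    <= Rabs (t - 0) * (M * (eps / (2 * M * (Rabs t + 1))))).
  { apply (integral_norm_le_abs hV).
    - apply ext_apply_cont. apply cont_minus; now apply cont_reflect.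
    - intros s Hs. apply between_abs0 in Hs. destruct Hs as [Hs1 Hs2].
      eapply Rle_trans; [apply HMb; lra|]. apply Rmult_le_compat_l; [lra|]. left. apply H1; try lra.
      + replace (t + h - s) with (h + (t - s)) by ring. eapply Rle_trans; [apply Rabs_triang|]. lra.
      + replace (t + h - s - (t - s)) with h by ring. lra. }
  assert (I2 : norm (integral (fun s => T (Rmax 0 s) (g (t + h - s))) t (t + h))
    <= Rabs (t + h - t) * (M * B)).
  { apply (integral_norm_le_abs hV).
    - now apply conv_integrand_cont.
    - intros s Hs. apply between_abs in Hs. destruct Hs as [Hs1 Hs2].
      eapply Rle_trans; [apply HMb|].
      + replace s with ((s - t) + t) by ring. eapply Rle_trans; [apply Rabs_triang|]. lra.
      + apply Rmult_le_compat_l; [lra|]. apply HBb. lra. }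
  rewrite Rminus_0_r in I1. replace (t + h - t) with h in I2 by ring.
  assert (Rabs t * (M * (eps / (2 * M * (Rabs t + 1)))) < eps / 2).
  { replace (Rabs t * (M * (eps / (2 * M * (Rabs t + 1))))) with (eps / 2 * (Rabs t / (Rabs t + 1))) by (field; lra).
    assert (Rabs t / (Rabs t + 1) < 1) by (apply (Rmult_lt_reg_r (Rabs t + 1)); [lra|]; field_simplify; lra).
    apply Rlt_le_trans with (eps / 2 * 1); [apply Rmult_lt_compat_l; lra|lra]. }
  assert (Rabs h * (M * B) <= eps / (2 * M * B) * (M * B)).
  { apply Rmult_le_compat_r; [apply Rmult_le_pos; lra|lra]. }
  replace (eps / (2 * M * B) * (M * B)) with (eps / 2) in * by (field; lra). lra.
Qed.

Lemma deriv_conv (f g : R -> V) t : cont g -> (forall s, deriv f s (g s)) ->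
  deriv (conv T f) t (plus (T (Rmax 0 t) (f 0)) (conv T g t)).
Proof.
  intros Hg Hfg. assert (Hf : cont f) by (intros s; now apply deriv_cont with (g s)).
  apply derivP. intros eps He.
  destruct (ext_bounded (Rabs t + 1)) as [M [HM HMb]].
  pose proof (Rabs_pos t) as Ht.
  set (e1 := eps / (2 * M * (Rabs t + 1))).
  assert (Hq : 0 < e1).
  { apply Rdiv_lt_0_compat; [lra|]. apply Rmult_lt_0_compat; lra. }
  destruct (cont_uniform g (Rabs t + 1) _ Hg Hq) as [d1 [Hd1 H1]].
  destruct (proj1 (contP f) Hf 0 (eps / (4 * M))) as [d2 [Hd2 H2]]; [apply Rdiv_lt_0_compat; lra|].
  destruct (proj1 (contP _) (orbit_cont T HT HB (f 0)) t (eps / 4)) as [d3 [Hd3 H3]]; [lra|].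
  exists (Rmin 1 (Rmin d1 (Rmin d2 d3))).
  split; [repeat apply Rmin_glb_lt; lra|]. intros r Hr.
  pose proof (Rmin_l 1 (Rmin d1 (Rmin d2 d3))). pose proof (Rmin_r 1 (Rmin d1 (Rmin d2 d3))).
  pose proof (Rmin_l d1 (Rmin d2 d3)). pose proof (Rmin_r d1 (Rmin d2 d3)).
  pose proof (Rmin_l d2 d3). pose proof (Rmin_r d2 d3).
  set (h := r - t) in *. replace r with (t + h) by (unfold h; ring).
  rewrite conv_increment by exact Hf.
  set (P := fun s => minus (minus (f (t + h - s)) (f (t - s))) (scal (ofR h) (g (t - s)))).
  set (Q := fun s => minus (T (Rmax 0 s) (f (t + h - s))) (T (Rmax 0 t) (f 0))).
  assert (HP : cont P).
  { unfold P. apply cont_minus; [apply cont_minus; now apply cont_reflect|].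
    apply (cont_linear (fun v => scal (ofR h) v)); [apply is_linear_scalar|now apply cont_reflect]. }
  assert (HQ : cont Q) by (unfold Q; apply cont_minus; [now apply conv_integrand_cont|apply cont_const]).
  assert (E1 : integral (fun s => T (Rmax 0 s) (P s)) 0 t =
    minus (integral (fun s => T (Rmax 0 s) (minus (f (t + h - s)) (f (t - s)))) 0 t)
          (scal (ofR h) (conv T g t))).
  { unfold conv.
    rewrite <- (integral_linear hV (fun v => scal (ofR h) v)) by (apply is_linear_scalar || now apply conv_integrand_cont).
    rewrite <- (integral_minus hV).
    - f_equal. apply functional_extensionality. intros s. unfold P.
      rewrite (linear_sub (T (Rmax 0 s))), (linear_scal _ (ext_linear s)) by apply ext_linear. reflexivity.
    - apply ext_apply_cont. apply cont_minus; now apply cont_reflect.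
    - apply (cont_linear (fun v => scal (ofR h) v)); [apply is_linear_scalar|now apply conv_integrand_cont]. }
  assert (E2 : integral Q t (t + h) =
    minus (integral (fun s => T (Rmax 0 s) (f (t + h - s))) t (t + h)) (scal (ofR h) (T (Rmax 0 t) (f 0)))).
  { unfold Q. rewrite (integral_minus hV), integral_const by (now apply conv_integrand_cont || apply cont_const).
    replace (t + h - t) with h by ring. reflexivity. }
  assert (I1 : norm (integral (fun s => T (Rmax 0 s) (P s)) 0 t) <= Rabs (t - 0) * (M * (Rabs h * e1))).
  { apply (integral_norm_le_abs hV); [now apply ext_apply_cont|].
    intros s Hs. apply between_abs0 in Hs. destruct Hs as [Hs1 Hs2].
    eapply Rle_trans; [apply HMb; lra|]. apply Rmult_le_compat_l; [lra|].
    (* The fundamental theorem turns uniform continuity of [g] into uniform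
       differentiability of [f]. *)
    set (a := t - s) in *.
    assert (EP : P s = integral (fun b => minus (g b) (g a)) a (a + h)).
    { unfold P. rewrite (integral_minus hV), integral_const by (assumption || apply cont_const).
      rewrite (integral_deriv hV f g) by assumption.
      unfold a. replace (t - s + h) with (t + h - s) by ring.
      replace (t + h - s - (t - s)) with h by ring. reflexivity. }
    rewrite EP. replace (Rabs h) with (Rabs (a + h - a)) by (f_equal; ring).
    apply (integral_norm_le_abs hV); [apply cont_minus; [exact Hg|apply cont_const]|].
    intros b Hb. apply between_abs in Hb. destruct Hb as [_ Hb]. left. apply H1; try lra.
    replace b with ((b - a) + a) by ring. eapply Rle_trans; [apply Rabs_triang|]. lra. }
  assert (I2 : norm (integral Q t (t + h)) <= Rabs (t + h - t) * (eps / 2)).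
  { apply (integral_norm_le_abs hV); [exact HQ|].
    intros s Hs. apply between_abs in Hs. destruct Hs as [Hs1 Hs2]. unfold Q.
    eapply Rle_trans; [apply (norm_minus_triangle _ (T (Rmax 0 s) (f 0)))|].
    rewrite <- (linear_sub (T (Rmax 0 s))) by apply ext_linear.
    specialize (H3 s ltac:(lra)). specialize (H2 (t + h - s)). rewrite Rminus_0_r in H2.
    specialize (H2 ltac:(lra)).
    assert (norm (T (Rmax 0 s) (minus (f (t + h - s)) (f 0))) <= M * norm (minus (f (t + h - s)) (f 0))).
    { apply HMb. replace s with ((s - t) + t) by ring. eapply Rle_trans; [apply Rabs_triang|]. lra. }
    assert (M * norm (minus (f (t + h - s)) (f 0)) < M * (eps / (4 * M))) by (apply Rmult_lt_compat_l; lra).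
    replace (M * (eps / (4 * M))) with (eps / 4) in * by (field; lra). lra. }
  replace (t + h - t) with h in * by ring. rewrite Rminus_0_r in I1.
  apply Rle_trans with (norm (plus (integral (fun s => T (Rmax 0 s) (P s)) 0 t) (integral Q t (t + h)))).
  { right. rewrite E1, E2. f_equal. vmod. }
  eapply Rle_trans; [apply norm_triangle|].
  assert (Rabs t * (M * (Rabs h * e1)) <= eps / 2 * Rabs h).
  { replace (Rabs t * (M * (Rabs h * e1))) with (eps / 2 * Rabs h * (Rabs t / (Rabs t + 1))) by (unfold e1; field; lra).
    assert (Rabs t / (Rabs t + 1) < 1) by (apply (Rmult_lt_reg_r (Rabs t + 1)); [lra|]; field_simplify; lra).
    pose proof (Rabs_pos h).
    apply Rle_trans with (eps / 2 * Rabs h * 1); [apply Rmult_le_compat_l; [|lra]|lra].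
    apply Rmult_le_pos; lra. }
  lra.
Qed.

(** Duhamel's formula: the convolution with a continuously differentiable
    function takes its values in the domain of the generator. *)
Lemma generator_conv (f g : R -> V) t : 0 <= t -> cont g -> (forall s, deriv f s (g s)) ->
  generator T (conv T f t) (minus (plus (T t (f 0)) (conv T g t)) (f t)).
Proof.
  intros Ht Hg Hfg. assert (Hf : cont f) by (intros s; now apply deriv_cont with (g s)).
  pose proof (deriv_conv f g t Hg Hfg) as Hd. rewrite Rmax_right in Hd by exact Ht.
  apply generatorP. intros eps He.
  destruct (proj1 (derivP _ _ _) Hd (eps / 2)) as [d1 [Hd1 H1]]; [lra|].
  destruct (conv_small (fun r => f (t + r)) (cont_shift f t Hf) (eps / 2)) as [d2 [Hd2 H2]]; [lra|].
  exists (Rmin d1 d2). split; [now apply Rmin_glb_lt|]. intros h Hh.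
  pose proof (Rmin_l d1 d2). pose proof (Rmin_r d1 d2).
  specialize (H1 (t + h)). specialize (H2 h ltac:(lra)). rewrite Rplus_0_r in H2.
  replace (t + h - t) with h in H1 by ring. rewrite Rabs_pos_eq in H1 by lra. specialize (H1 ltac:(lra)).
  replace (t + h) with (h + t) in H1 by ring.
  rewrite (conv_add f h t) in H1 by (assumption || lra).
  eapply Rle_trans; [|apply Rle_trans with (1 := Rplus_le_compat _ _ _ _ H1 H2); lra].
  eapply Rle_trans; [|apply norm_minus_le]. right. f_equal. vmod.
Qed.

(** [conv T (fun _ => x) t] is the integral of the orbit of [x]. *)
Lemma mean_linear t : 0 <= t -> is_linear (fun x : V => conv T (fun _ => x) t).
Proof.
  intros Ht. constructor.
  - intros x y. apply (conv_plus (fun _ => x) (fun _ => y)); apply cont_const.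
  - intros k x. apply (conv_scal k (fun _ => x)), cont_const.
  - destruct (HB t) as [M [HM HMb]]. exists (t * M + 1). split.
    { assert (0 <= t * M) by (apply Rmult_le_pos; lra). lra. }
    intros x. pose proof (norm_ge_0 x). apply Rle_trans with (t * (M * norm x)); [|nra].
    apply conv_bound; try assumption; try lra; [apply cont_const|]. intros; apply Rle_refl.
Qed.

Lemma mean_comm t h (x : V) : 0 <= h ->
  conv T (fun _ => T h x) t = T h (conv T (fun _ => x) t).
Proof.
  intros Hh. apply (conv_linear_image (T h) (fun _ => x)); [now apply sg_linear|apply cont_const|].
  intros s y Hs. now apply sg_comm.
Qed.

Lemma generator_mean t (x : V) : 0 <= t ->
  generator T (conv T (fun _ => x) t) (minus (T t x) x).
Proof.
  intros Ht. pose proof (generator_conv (fun _ => x) (fun _ => zero) t Ht (cont_const _) (deriv_const x)) as H.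
  simpl in H. rewrite conv_zero in H.
  replace (minus (T t x) x) with (minus (plus (T t x) zero) x) by vmod. exact H.
Qed.

(** The two sides have the same right derivative and the same initial value. *)
Lemma orbit_as_integral t (x y : V) : 0 <= t -> generator T x y ->
  T t x = plus x (conv T (fun _ => y) t).
Proof.
  intros Ht Hg. set (f := fun r => minus (T (Rmax 0 r) x) (conv T (fun _ => y) r)).
  assert (H : norm (minus (f t) (f 0)) <= 0 * (t - 0)).
  { apply right_mean_value; [exact Ht| |].
    - intros s _. apply (lim_minus (locally s)); [now apply orbit_cont|apply cont_conv, cont_const].
    - intros s eps Hs He. destruct (HB t) as [M [HM HMb]].
      destruct (proj1 (generatorP T x y) Hg (eps / (2 * M))) as [d1 [Hd1 H1]]; [apply Rdiv_lt_0_compat; lra|].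
      destruct (conv_small (fun _ => y) (cont_const y) (eps / (2 * M))) as [d2 [Hd2 H2]]; [apply Rdiv_lt_0_compat; lra|].
      exists (Rmin d1 d2). split; [now apply Rmin_glb_lt|]. intros h Hh.
      pose proof (Rmin_l d1 d2). pose proof (Rmin_r d1 d2).
      specialize (H1 h ltac:(lra)). specialize (H2 h ltac:(lra)).
      unfold f. rewrite !Rmax_right by lra. rewrite sg_add by (assumption || lra).
      rewrite (conv_add (fun _ => y) s h) by (lra || apply cont_const).
      assert (Hl : is_linear (T s)) by (apply sg_linear; lra || assumption).
      eapply Rle_trans with (norm (T s (minus (minus (minus (T h x) x) (scal (ofR h) y))
           (minus (conv T (fun _ => y) h) (scal (ofR h) y))))).
      { right. f_equal. rewrite !(linear_sub (T s)) by exact Hl. vmod. }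
      eapply Rle_trans; [apply HMb; lra|].
      eapply Rle_trans; [apply Rmult_le_compat_l; [lra|apply norm_minus_le]|].
      eapply Rle_trans; [apply Rmult_le_compat_l; [lra|apply Rplus_le_compat; [exact H1|exact H2]]|].
      right. field. lra. }
  rewrite Rmult_0_l in H. pose proof (norm_ge_0 (minus (f t) (f 0))).
  assert (E : f t = f 0) by (apply minus_eq_norm; lra).
  unfold f in E. rewrite (Rmax_right 0 t), (Rmax_right 0 0), conv_at, sg_0 in E by (assumption || lra).
  replace (T t x) with (plus (minus (T t x) (conv T (fun _ => y) t)) (conv T (fun _ => y) t)) by vmod.
  rewrite E. vmod.
Qed.

(** ** Domains of the powers of the generator *)

Lemma gdom_plus n : forall x y : V, gdom T n x -> gdom T n y -> gdom T n (plus x y).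
Proof.
  induction n as [|n IH]; intros x y; simpl; [tauto|].
  intros [x' [Hx Hx']] [y' [Hy Hy']]. exists (plus x' y').
  split; [now apply generator_plus | now apply IH].
Qed.

Lemma gdom_linear_image (A : V -> V) n : is_linear A -> (forall h x, 0 <= h -> A (T h x) = T h (A x)) ->
  forall x, gdom T n x -> gdom T n (A x).
Proof.
  intros HA Hc. induction n as [|n IH]; intros x; simpl; [tauto|].
  intros [x' [Hx Hx']]. exists (A x'). split; [|now apply IH].
  apply generator_linear_image; auto.
Qed.

Lemma gdom_scal n (k : F) (x : V) : gdom T n x -> gdom T n (scal k x).
Proof.
  apply (gdom_linear_image (fun v => scal k v)); [apply is_linear_scalar|].
  intros h y Hh. symmetry. apply (linear_scal _ (sg_linear T HT h Hh)).
Qed.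

Lemma gdom_orbit n t (x : V) : 0 <= t -> gdom T n x -> gdom T n (T t x).
Proof.
  intros Ht. apply gdom_linear_image; [now apply sg_linear|]. intros h y Hh. now apply sg_comm.
Qed.

(** Averaging an orbit gains one power of the generator. *)
Lemma gdom_mean n h : 0 <= h -> forall x : V, gdom T n x -> gdom T (S n) (conv T (fun _ => x) h).
Proof.
  intros Hh. induction n as [|n IH]; intros x Hx.
  - exists (minus (T h x) x). split; [now apply generator_mean|exact I].
  - destruct Hx as [y [Hxy Hy]]. exists (conv T (fun _ => y) h). split; [|now apply IH].
    apply (generator_linear_image T (fun v => conv T (fun _ => v) h)).
    + now apply mean_linear.
    + intros k Hk. now apply mean_comm.
    + exact Hxy.
Qed.

Lemma gdom_dense n : forall (x : V) eps, 0 < eps -> exists x' : V, gdom T n x' /\ norm (minus x' x) < eps.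
Proof.
  induction n as [|n IH]; intros x eps He.
  - exists x. split; [exact I|]. rewrite minus_self, norm_zero. exact He.
  - destruct (IH x (eps / 2)) as [y [Hy Hyx]]; [lra|].
    destruct (conv_small (fun _ => y) (cont_const y) (eps / 2)) as [d [Hd H]]; [lra|].
    specialize (H (d / 2) ltac:(lra)).
    exists (scal (ofR (/ (d / 2))) (conv T (fun _ => y) (d / 2))).
    split; [apply gdom_scal, gdom_mean; [lra|exact Hy]|].
    eapply Rle_lt_trans; [apply (norm_minus_triangle _ y)|].
    apply Rle_lt_trans with (norm (rscal (/ (d / 2)) (minus (conv T (fun _ => y) (d / 2)) (scal (ofR (d / 2)) y))) + norm (minus y x)).
    { right. f_equal. f_equal. vmod. }
    rewrite norm_rscal, Rabs_pos_eq by (left; apply Rinv_0_lt_compat; lra).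
    assert (/ (d / 2) * norm (minus (conv T (fun _ => y) (d / 2)) (scal (ofR (d / 2)) y)) <= eps / 2).
    { apply Rle_trans with (/ (d / 2) * (eps / 2 * (d / 2))); [apply Rmult_le_compat_l; [left; apply Rinv_0_lt_compat; lra|exact H]|].
      right. field. lra. }
    lra.
Qed.

End Convolution.

(** * The domain of the generator in its own norm *)

Section Lift.
Context {F : scalar_field} {Z X Ub : NormedModule F}.
Hypothesis hZ : is_complete Z.
Hypothesis hX : is_complete X.
Variables (j fA : Z -> X) (fB : Z -> Ub).
Hypothesis hj : is_linear j.
Hypothesis hjinj : forall z z', j z = j z' -> z = z'.
Hypothesis hfA : is_linear fA.
Hypothesis hfB : is_linear fB.
Variable T : R -> X -> X.
Hypothesis hT : generates (restrict_ker j fA fB) T.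

Let HT : C0_semigroup T := proj1 hT.

(** The inverse of [j] on the domain of the generator: the passage from the
    norm of [X] to that of [Z]. *)
Definition lift (x : X) : Z := epsilon (inhabits zero) (fun z => fB z = zero /\ j z = x).

Lemma lift_j (z : Z) : fB z = zero -> lift (j z) = z.
Proof.
  intros Hz. apply hjinj.
  apply (epsilon_spec (inhabits zero) (fun z' => fB z' = zero /\ j z' = j z)).
  now exists z.
Qed.

Lemma lift_spec (x y : X) : generator T x y -> fB (lift x) = zero /\ j (lift x) = x /\ fA (lift x) = y.
Proof.
  intros H. apply (proj2 hT) in H. destruct H as [z [H0 [<- <-]]]. now rewrite lift_j.
Qed.

Lemma generator_of_kernel (z : Z) : fB z = zero -> generator T (j z) (fA z).
Proof. intros Hz. apply (proj2 hT). now exists z. Qed.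

Lemma lift_plus (x x' y y' : X) : generator T x y -> generator T x' y' ->
  lift (plus x x') = plus (lift x) (lift x').
Proof.
  intros H H'. destruct (lift_spec x y H) as [H0 [H1 _]]. destruct (lift_spec x' y' H') as [H0' [H1' _]].
  rewrite <- H1 at 1. rewrite <- H1' at 1. rewrite <- (linear_plus j hj). apply lift_j.
  rewrite (linear_plus fB hfB), H0, H0'. apply plus_zero_l.
Qed.

Lemma lift_scal (k : F) (x y : X) : generator T x y -> lift (scal k x) = scal k (lift x).
Proof.
  intros H. destruct (lift_spec x y H) as [H0 [H1 _]].
  rewrite <- H1 at 1. rewrite <- (linear_scal j hj). apply lift_j.
  rewrite (linear_scal fB hfB), H0. exact (scal_zero_r (V := NormedModule.ModuleSpace F Ub) k).
Qed.

Lemma lift_minus (x x' y y' : X) : generator T x y -> generator T x' y' ->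
  lift (minus x x') = minus (lift x) (lift x').
Proof.
  intros H H'. replace (minus x x') with (plus x (scal (ofR (-1)) x')) by vmod.
  rewrite (lift_plus _ _ y (scal (ofR (-1)) y')), (lift_scal _ x' y') by
    (assumption || now apply generator_scal).
  vmod.
Qed.

Lemma lift_zero : lift zero = zero.
Proof. rewrite <- (linear_0 j hj). apply lift_j. now apply linear_0. Qed.

(** A form of the closed graph theorem.  As [j] and [fB] are continuous, a sum
    of vectors [lift (A x)] that converges in [Z] can only converge to [lift] of
    the sum in [X], and so the norm of [lift (A x)] is countably subadditive. *)
Lemma lift_bounded (A : X -> X) : is_linear A -> (forall x, exists y, generator T (A x) y) ->
  exists C, 0 < C /\ forall x, norm (lift (A x)) <= C * norm x.
Proof.
  intros HA Hdom.
  apply (countably_subadditive_bounded hX (fun x => norm (lift (A x)))).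
  - intros x. apply norm_ge_0.
  - intros x x'. destruct (Hdom x) as [y Hy]. destruct (Hdom x') as [y' Hy'].
    rewrite (linear_plus A HA), (lift_plus _ _ y y') by assumption. apply norm_triangle.
  - intros r x. destruct (Hdom x) as [y Hy].
    rewrite (linear_scal A HA), (lift_scal _ _ y) by assumption. apply norm_rscal.
  - intros s x c Hc Hs0 Hs Hsteps.
    destruct (geometric_series_converges hZ (fun n => lift (A (s n))) c) as [z [Hz Hzc]].
    + exact Hc.
    + rewrite Hs0, linear_0 by exact HA. apply lift_zero.
    + intros n. destruct (Hdom (s n)) as [y Hy]. destruct (Hdom (s (S n))) as [y' Hy'].
      rewrite <- (lift_minus _ _ y' y), <- (linear_sub A) by assumption. apply Hsteps.
    + assert (Hjz : j z = A x).
      { apply (lim_unique eventually (fun n => A (s n))); [|now apply linear_lim].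
        apply (filterlim_ext (fun n => j (lift (A (s n))))).
        - intros n. destruct (Hdom (s n)) as [y Hy]. now apply (lift_spec _ y).
        - now apply linear_lim. }
      assert (HBz : fB z = zero).
      { apply (lim_unique eventually (fun _ : nat => (zero : Ub))); [|apply filterlim_const].
        apply (filterlim_ext (fun n => fB (lift (A (s n))))).
        - intros n. destruct (Hdom (s n)) as [y Hy]. now apply (lift_spec _ y).
        - now apply linear_lim. }
      rewrite <- Hjz, lift_j by exact HBz. exact Hzc.
Qed.

Lemma deriv_scal_id (y : X) t : deriv (fun s => scal (ofR s) y) t y.
Proof.
  apply derivP. intros eps He. exists 1. split; [lra|]. intros s _.
  apply Rle_trans with (norm (zero : X)); [right; f_equal; vmod|].
  rewrite norm_zero. apply Rmult_le_pos; [lra|apply Rabs_pos].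
Qed.

Lemma is_derive_one_minus s : is_derive (fun r : R => 1 - r) s (-1).
Proof. auto_derive; [exact I|ring]. Qed.

(** Integration of the derivative of [(1 - s) T(s) x] over [[0,1]].  It expresses
    [x] by [x] and [y] through two bounded operators that map the whole space
    into the domain, to which [lift_bounded] applies. *)
Lemma dom_decomposition (x y : X) : generator T x y ->
  x = minus (conv T (fun _ => x) 1) (conv T (fun s => scal (ofR s) y) 1).
Proof.
  intros Hg.
  set (f := fun s => plus x (conv T (fun _ => y) s)).
  set (df := fun s => T (Rmax 0 s) y).
  assert (Hdf : cont df) by (apply (orbit_cont T HT); now apply C0_semigroup_locally_bounded).
  assert (Hf : forall s, deriv f s (df s)).
  { intros s. unfold df.
    replace (T (Rmax 0 s) y) with (plus (zero : X) (plus (T (Rmax 0 s) y) (conv T (fun _ => zero) s))).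
    - apply deriv_plus; [apply deriv_const|].
      apply (deriv_conv hX T HT (fun _ => y) (fun _ => zero)); [apply cont_const|intros; apply deriv_const].
    - rewrite (conv_zero T HT). vmod. }
  assert (Hfc : cont f) by (intros s; now apply deriv_cont with (df s)).
  set (g := fun s => scal (ofR (1 - s)) (f s)).
  set (dg := fun s => plus (scal (ofR (-1)) (f s)) (scal (ofR (1 - s)) (df s))).
  assert (Hg' : forall s, deriv g s (dg s)).
  { intros s. apply (deriv_mult (fun r => 1 - r)); [apply is_derive_one_minus|apply Hf]. }
  assert (Hc1 : cont (fun s => scal (ofR (-1)) (f s))).
  { apply (cont_linear (fun v => scal (ofR (-1)) v)); [apply is_linear_scalar|exact Hfc]. }
  assert (Hc2 : cont (fun s => scal (ofR (1 - s)) (df s))).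
  { apply (cont_ext (fun s => T (Rmax 0 s) (scal (ofR (1 - s)) y))).
    - intros s. apply (linear_scal _ (ext_linear T HT s)).
    - apply (conv_integrand_cont hX T HT (fun s => scal (ofR s) y) 1), cont_rscal. }
  assert (Hdg : cont dg) by now apply cont_plus.
  pose proof (integral_deriv hX g dg 0 1 Hg' Hdg) as HI.
  unfold dg in HI. rewrite (integral_plus hX) in HI by assumption.
  rewrite (integral_linear hX (fun v => scal (ofR (-1)) v)) in HI by (apply is_linear_scalar || assumption).
  assert (E1 : integral f 0 1 = conv T (fun _ => x) 1).
  { symmetry. apply (integral_ext hX); [lra|exact Hfc|]. intros s Hs. rewrite Rmax_right by lra.
    unfold f. symmetry. apply (orbit_as_integral hX T HT); [lra|exact Hg]. }
  assert (E2 : integral (fun s => scal (ofR (1 - s)) (df s)) 0 1 = conv T (fun s => scal (ofR s) y) 1).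
  { unfold conv. f_equal. apply functional_extensionality. intros s. symmetry.
    apply (linear_scal _ (ext_linear T HT s)). }
  rewrite E1, E2 in HI. unfold g, f in HI. rewrite conv_at in HI.
  transitivity (opp (plus (scal (ofR (-1)) (conv T (fun _ => x) 1)) (conv T (fun s => scal (ofR s) y) 1)));
    [|vmod].
  etransitivity; [|exact (f_equal opp (eq_sym HI))]. vmod.
Qed.

(** The norm of [Z] and the graph norm are thus equivalent on the domain. *)
Lemma lift_graph_bound : exists C, 0 < C /\ forall x y : X, generator T x y ->
  norm (lift x) <= C * (norm x + norm y).
Proof.
  destruct (lift_bounded (fun x => conv T (fun _ => x) 1)) as [C1 [HC1 H1]].
  { apply (mean_linear hX T HT). lra. }
  { intros x. eexists. apply (generator_mean hX T HT). lra. }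
  destruct (lift_bounded (fun y => conv T (fun s => scal (ofR s) y) 1)) as [C2 [HC2 H2]].
  { constructor.
    - intros y y'. rewrite <- (conv_plus hX T HT) by apply cont_rscal. f_equal.
      apply functional_extensionality. intros s. vmod.
    - intros k y. rewrite <- (conv_scal hX T HT) by apply cont_rscal. f_equal.
      apply functional_extensionality. intros s.
      exact (linear_scal _ (is_linear_scalar (ofR s)) k y).
    - destruct (C0_semigroup_locally_bounded T HT hX 1) as [M [HM HMb]].
      exists (M + 1). split; [lra|]. intros y. pose proof (norm_ge_0 y).
      apply Rle_trans with (1 * (M * norm y)); [|nra].
      apply (conv_bound hX T HT); try lra; [apply cont_rscal|exact HMb|].
      intros s Hs. change (norm (rscal s y) <= norm y). rewrite norm_rscal, Rabs_pos_eq by lra. nra. }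
  { intros y. eexists.
    apply (generator_conv hX T HT (fun s => scal (ofR s) y) (fun _ => y)); [lra|apply cont_const|].
    intros s. apply deriv_scal_id. }
  exists (C1 + C2). split; [lra|]. intros x y Hg.
  rewrite (dom_decomposition x y Hg) at 1.
  rewrite (lift_minus _ _ (minus (T 1 x) x) (minus (plus (T 1 (scal (ofR 0) y)) (conv T (fun _ => y) 1)) (scal (ofR 1) y))).
  - eapply Rle_trans; [apply norm_minus_le|]. specialize (H1 x). specialize (H2 y).
    pose proof (norm_ge_0 x). pose proof (norm_ge_0 y). nra.
  - apply (generator_mean hX T HT). lra.
  - apply (generator_conv hX T HT (fun s => scal (ofR s) y) (fun _ => y)); [lra|apply cont_const|].
    intros s. apply deriv_scal_id.
Qed.

Lemma lift_cont (f g : R -> X) : cont f -> cont g -> (forall s, generator T (f s) (g s)) ->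
  cont (fun s => lift (f s)).
Proof.
  intros Hf Hg Hfg. apply contP. intros t eps He.
  destruct lift_graph_bound as [C [HC HCb]].
  destruct (proj1 (contP f) Hf t (eps / (2 * C))) as [d1 [Hd1 H1]]; [apply Rdiv_lt_0_compat; lra|].
  destruct (proj1 (contP g) Hg t (eps / (2 * C))) as [d2 [Hd2 H2]]; [apply Rdiv_lt_0_compat; lra|].
  exists (Rmin d1 d2). split; [now apply Rmin_glb_lt|]. intros s Hs.
  pose proof (Rmin_l d1 d2). pose proof (Rmin_r d1 d2).
  specialize (H1 s ltac:(lra)). specialize (H2 s ltac:(lra)).
  rewrite <- (lift_minus _ _ (g s) (g t)) by apply Hfg.
  eapply Rle_lt_trans; [apply HCb; apply generator_minus; [exact HT|apply Hfg|apply Hfg]|].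
  apply Rlt_le_trans with (C * (eps / (2 * C) + eps / (2 * C))); [|right; field; lra].
  apply Rmult_lt_compat_l; [exact HC|]. lra.
Qed.

Lemma lift_orbit_cont (x y : X) : generator T x y -> cont (fun s => lift (T (Rmax 0 s) x)).
Proof.
  intros Hg. pose proof (C0_semigroup_locally_bounded T HT hX) as HB.
  apply (lift_cont _ (fun s => T (Rmax 0 s) y)); try now apply orbit_cont.
  intros s. apply generator_orbit; [exact HT|apply Rmax_l|exact Hg].
Qed.

(** An orbit that starts in the domain of the square of the generator is
    continuously differentiable for the norm of [Z]. *)
Lemma lift_orbit_integral (x y y' : X) t : 0 <= t -> generator T x y -> generator T y y' ->
  lift (T t x) = plus (lift x) (integral (fun s => lift (T (Rmax 0 s) y)) 0 t).
Proof.
  intros Ht Hx Hy. pose proof (lift_orbit_cont y y' Hy) as Hc.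
  destruct (lift_spec x y Hx) as [H0 [H1 _]].
  assert (Hs : forall s, fB (lift (T (Rmax 0 s) y)) = zero /\ j (lift (T (Rmax 0 s) y)) = T (Rmax 0 s) y).
  { intros s. destruct (lift_spec (T (Rmax 0 s) y) (T (Rmax 0 s) y')) as [Ha [Hb _]].
    - apply generator_orbit; [exact HT|apply Rmax_l|exact Hy].
    - now split. }
  rewrite (orbit_as_integral hX T HT t x y Ht Hx).
  replace (plus x (conv T (fun _ => y) t)) with
    (j (plus (lift x) (integral (fun s => lift (T (Rmax 0 s) y)) 0 t))).
  - apply lift_j. rewrite (linear_plus fB hfB), H0, <- (integral_linear hZ fB) by assumption.
    replace (fun s => fB (lift (T (Rmax 0 s) y))) with (fun _ : R => (zero : Ub)).
    + rewrite integral_zero. apply plus_zero_l.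
    + apply functional_extensionality. intros s. symmetry. apply Hs.
  - rewrite (linear_plus j hj), H1, <- (integral_linear hZ j) by assumption. f_equal.
    unfold conv. f_equal. apply functional_extensionality. intros s. apply Hs.
Qed.

End Lift.

(** * Classical solutions *)

Section DeriveOn.
Context {F : scalar_field} {V : NormedModule F}.

Lemma derive_on_of_deriv (D : R -> Prop) (f g df dg : R -> V) :
  (forall s, D s -> f s = g s) -> (forall t, D t -> deriv g t (dg t)) ->
  (forall t, D t -> df t = dg t) -> derive_on D f df.
Proof.
  intros Hfg Hg Hd t Ht. rewrite Hd by exact Ht.
  apply (filterlim_ext_loc (fun s => scal (ofR (/ (s - t))) (minus (g s) (g t)))).
  - apply (filter_forall (F := locally' t)). intros s Hs. now rewrite !Hfg.
  - intros P HP. generalize (Hg t Ht P HP). unfold filtermap.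
    apply (filter_imp (F := locally' t)). now intros s Hs _.
Qed.

Lemma continuous_on_of_cont (D : R -> Prop) (f : R -> V) : cont f -> continuous_on D f.
Proof.
  intros Hf t _ P HP. generalize (Hf t P HP). unfold filtermap.
  apply (filter_imp (F := locally t)). now intros s Hs _.
Qed.

Lemma C2_on_of_deriv (D : R -> Prop) (u u1 u2 : R -> V) :
  (forall s, deriv u s (u1 s)) -> (forall s, deriv u1 s (u2 s)) -> cont u2 -> C2_on D u.
Proof.
  intros H1 H2 Hc. exists u1, u2. repeat split.
  - now apply derive_on_of_deriv with u u1.
  - now apply derive_on_of_deriv with u1 u2.
  - now apply continuous_on_of_cont.
Qed.

End DeriveOn.

Lemma max_continuous t : continuous (fun s : R => Rmax 0 s) t.
Proof.

  intros P [d Hd]. exists d. intros s Hs. apply Hd.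
  change (Rabs (Rmax 0 s - Rmax 0 t) < d). change (Rabs (s - t) < d) in Hs.
  eapply Rle_lt_trans; [|exact Hs].
  unfold Rmax. destruct (Rle_dec 0 s), (Rle_dec 0 t); unfold Rabs;
    repeat destruct Rcase_abs; lra.
Qed.

Section Solutions.
Context {F : scalar_field} {Z X Ub U : NormedModule F}.
Hypothesis hZ : is_complete Z.
Hypothesis hX : is_complete X.
Variables (j fA : Z -> X) (fB : Z -> Ub) (Q : U -> Ub) (Bi : U -> X) (fBr : Ub -> Z).
Hypothesis hj : is_linear j.
Hypothesis hjinj : forall z z', j z = j z' -> z = z'.
Hypothesis hfA : is_linear fA.
Hypothesis hfB : is_linear fB.
Hypothesis hQ : is_linear Q.
Hypothesis hBi : is_linear Bi.
Hypothesis hfBr : is_linear fBr.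
Hypothesis hBr : forall v, fB (fBr v) = v.
Variable T : R -> X -> X.
Hypothesis hT : generates (restrict_ker j fA fB) T.

Let HT : C0_semigroup T := proj1 hT.

(** [input_state u] satisfies the boundary condition of the input [u], and
    [input_rate u] is the rate of change of the state there. *)
Definition input_state (u : U) : X := j (fBr (Q u)).
Definition input_rate (u : U) : X := plus (fA (fBr (Q u))) (Bi u).

Lemma input_state_linear : is_linear input_state.
Proof. apply (is_linear_comp (fun u => fBr (Q u)) j); [now apply is_linear_comp|exact hj]. Qed.

Lemma input_rate_linear : is_linear input_rate.
Proof.
  apply is_linear_sum; [|exact hBi].
  apply (is_linear_comp (fun u => fBr (Q u)) fA); [now apply is_linear_comp|exact hfA].
Qed.

(** The stationary correction [fBr (Q u)] moves the boundary condition
    [fB z = Q u] into the kernel of [fB]. *)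
Lemma controlled_domain (u : U) (x y : X) :
  (exists z, fB z = Q u /\ j z = x /\ plus (fA z) (Bi u) = y) <->
  generator T (minus x (input_state u)) (minus y (input_rate u)).
Proof.
  split.
  - intros [z [Hz [<- <-]]].
    pose proof (generator_of_kernel j fA fB T hT (minus z (fBr (Q u)))) as H.
    rewrite (linear_sub fB), Hz, hBr, minus_self, (linear_sub j), (linear_sub fA) in H by assumption.
    replace (minus (plus (fA z) (Bi u)) (input_rate u)) with (minus (fA z) (fA (fBr (Q u))))
      by (unfold input_rate; vmod).
    now apply H.
  - intros H. destruct (lift_spec j fA fB hjinj T hT _ _ H) as [H0 [H1 H2]].
    exists (plus (fBr (Q u)) (lift j fB (minus x (input_state u)))). repeat split.
    + rewrite (linear_plus fB hfB), H0, hBr. apply plus_zero_r.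
    + rewrite (linear_plus j hj), H1. unfold input_state. vmod.
    + rewrite (linear_plus fA hfA), H2. unfold input_rate. vmod.
Qed.

(** After subtraction of [fBr (Q u)] the boundary condition is homogeneous, and
    what is left solves an inhomogeneous Cauchy problem whose source contains
    the derivative of [u]; [generator_conv] solves it. *)
Lemma classical_input_solution (u u1 u2 : R -> U) (tau : R) :
  0 < tau -> (forall s, deriv u s (u1 s)) -> (forall s, deriv u1 s (u2 s)) -> cont u2 -> u 0 = zero ->
  exists x : R -> Z, x 0 = zero /\ cont x /\
    (forall t, fB (x t) = Q (u t)) /\
    derive_on (Icc 0 tau) (fun t => j (x t)) (fun t => plus (fA (x t)) (Bi (u t))) /\
    j (x tau) = plus (input_state (u tau))
                  (conv T (fun s => minus (input_rate (u s)) (input_state (u1 s))) tau).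
Proof.
  intros Htau Hu1 Hu2 Hc Hu0.
  assert (Hcu : cont u) by (intros s; now apply deriv_cont with (u1 s)).
  assert (Hcu1 : cont u1) by (intros s; now apply deriv_cont with (u2 s)).
  set (f := fun s => minus (input_rate (u s)) (input_state (u1 s))).
  set (g := fun s => minus (input_rate (u1 s)) (input_state (u2 s))).
  pose proof input_rate_linear as HF. pose proof input_state_linear as HE.
  assert (Hg : cont g) by (apply cont_minus; now apply cont_linear).
  assert (Hfg : forall s, deriv f s (g s)).
  { intros s. apply deriv_minus; now apply deriv_linear. }
  assert (Hf : cont f) by (intros s; now apply deriv_cont with (g s)).
  set (w := fun t => conv T f (Rmax 0 t)).
  set (wd := fun t => minus (plus (T (Rmax 0 t) (f 0)) (conv T g (Rmax 0 t))) (f (Rmax 0 t))).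
  assert (Hw : forall t, generator T (w t) (wd t)).
  { intros t. apply (generator_conv hX T HT); [apply Rmax_l|exact Hg|exact Hfg]. }
  assert (Hwc : cont w).
  { apply (cont_comp (conv T f) (Rmax 0)); [apply max_continuous|]. now apply (cont_conv hX T HT). }
  assert (Hwdc : cont wd).
  { apply cont_minus; [apply cont_plus|].
    - apply orbit_cont; [exact HT|]. now apply C0_semigroup_locally_bounded.
    - apply (cont_comp (conv T g) (Rmax 0)); [apply max_continuous|]. now apply (cont_conv hX T HT).
    - apply (cont_comp f (Rmax 0)); [apply max_continuous|]. exact Hf. }
  set (l := fun t => lift j fB (w t)).
  assert (Hl : forall t, fB (l t) = zero /\ j (l t) = w t /\ fA (l t) = wd t)
    by (intros t; now apply (lift_spec j fA fB hjinj T hT)).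
  exists (fun t => plus (fBr (Q (u t))) (l t)).
  repeat split.
  - rewrite Hu0, !linear_0 by assumption. unfold l, w. rewrite Rmax_right, conv_at by lra.
    rewrite lift_zero by assumption. apply plus_zero_l.
  - apply cont_plus.
    + apply (cont_linear (fun v => fBr (Q v))); [now apply is_linear_comp|exact Hcu].
    + now apply (lift_cont hZ hX j fA fB hj hjinj hfB T hT w wd).
  - intros t. rewrite (linear_plus fB hfB), hBr, (proj1 (Hl t)). apply plus_zero_r.
  - apply derive_on_of_deriv with
      (g := fun t => plus (input_state (u t)) (conv T f t))
      (dg := fun t => plus (input_state (u1 t)) (plus (T (Rmax 0 t) (f 0)) (conv T g t))).
    + intros s [Hs _]. rewrite (linear_plus j hj), (proj1 (proj2 (Hl s))). unfold w.
      now rewrite Rmax_right.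
    + intros t _. apply deriv_plus; [now apply deriv_linear|]. now apply (deriv_conv hX T HT).
    + intros t [Ht _]. rewrite (linear_plus fA hfA), (proj2 (proj2 (Hl t))). unfold wd, f at 2.
      rewrite Rmax_right by exact Ht. unfold input_rate at 1. vmod.
  - rewrite (linear_plus j hj), (proj1 (proj2 (Hl tau))). unfold w. now rewrite Rmax_right by lra.
Qed.

Lemma classical_free_solution (x0 y0 : X) (tau : R) : generator T x0 y0 ->
  let x := fun t => lift j fB (T (Rmax 0 t) x0) in
  x 0 = lift j fB x0 /\ cont x /\ (forall t, fB (x t) = zero) /\
  derive_on (Icc 0 tau) (fun t => j (x t)) (fun t => plus (fA (x t)) (Bi zero)).
Proof.
  intros Hg x.
  assert (Hl : forall t, fB (x t) = zero /\ j (x t) = T (Rmax 0 t) x0 /\ fA (x t) = T (Rmax 0 t) y0).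
  { intros t. apply (lift_spec j fA fB hjinj T hT).
    apply generator_orbit; [exact HT|apply Rmax_l|exact Hg]. }
  repeat split.
  - unfold x. now rewrite Rmax_right, (sg_0 T HT) by lra.
  - now apply (lift_orbit_cont hZ hX j fA fB hj hjinj hfB T hT x0 y0).
  - intros t. apply Hl.
  - apply derive_on_of_deriv with
      (g := fun t => plus x0 (conv T (fun _ => y0) t))
      (dg := fun t => plus zero (plus (T (Rmax 0 t) y0) (conv T (fun _ => zero) t))).
    + intros s [Hs _]. rewrite (proj1 (proj2 (Hl s))), Rmax_right by exact Hs.
      now apply (orbit_as_integral hX T HT).
    + intros t _. apply deriv_plus; [apply deriv_const|].
      apply (deriv_conv hX T HT (fun _ => y0) (fun _ => zero)); [apply cont_const|intros; apply deriv_const].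
    + intros t _. rewrite (proj2 (proj2 (Hl t))), (conv_zero T HT), (linear_0 Bi hBi). vmod.
Qed.

End Solutions.

Lemma input_map_estimate {F : scalar_field} {Z Ub U X Y : HilbertSpace F}
    (j : Z -> X) (fB : Z -> Ub) (fA : Z -> X) (fC : Z -> Y) (Q : U -> Ub) (Bi : U -> X)
    (fBr : Ub -> Z) (T : R -> X -> X) :
  boundary_node j fB fA fC Q Bi -> wellposed_input_map j fB fA fC Q Bi ->
  is_linear fBr -> (forall v, fB (fBr v) = v) -> generates (restrict_ker j fA fB) T ->
  exists tau M, 0 < tau /\ 0 < M /\ forall u u1 u2 : R -> U,
    (forall s, deriv u s (u1 s)) -> (forall s, deriv u1 s (u2 s)) -> cont u2 -> u 0 = zero ->
    norm (plus (input_state (X := X) (U := U) j Q fBr (u tau))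
      (conv T (fun s => minus (input_rate (X := X) (U := U) fA Q Bi fBr (u s)) (input_state (X := X) (U := U) j Q fBr (u1 s))) tau))
    <= M * sqrt (RInt (fun t => norm (u t) ^ 2) 0 tau).
Proof.
  intros Hnode [tau [M [Htau [HM H]]]] HBrl HBr HT.
  exists tau, M. split; [exact Htau|]. split; [exact HM|]. intros u u1 u2 H1 H2 Hc H0.
  destruct Hnode.
  destruct (classical_input_solution (is_complete_CompleteNormedModule Z) (is_complete_CompleteNormedModule X)
    j fA fB Q Bi fBr node_j node_j_inj node_fA node_fB node_Q node_Bi HBrl HBr T HT u u1 u2 tau
    Htau H1 H2 Hc H0) as [x [Hx0 [Hxc [HxB [Hxd Hxt]]]]].
  rewrite <- Hxt. apply (H x u (fun t => fC (x t))).
  - now apply (C2_on_of_deriv (V := U)) with u1 u2.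
  - exact H0.
  - repeat split.
    + exact Hx0.
    + exact Hxd.
    + apply (continuous_on_of_cont (V := X)).
      apply (cont_plus (V := X)); [now apply (cont_linear (V := Z) (W := X) fA)|].
      apply (cont_linear (V := U) (W := X) Bi); [assumption|].
      intros s. apply deriv_cont with (u1 s), H1.
    + apply (continuous_on_of_cont (V := Y)). now apply (cont_linear (V := Z) (W := Y) fC).
    + apply HxB.
Qed.

Lemma output_map_estimate {F : scalar_field} {Z Ub U X Y : HilbertSpace F}
    (j : Z -> X) (fB : Z -> Ub) (fA : Z -> X) (fC : Z -> Y) (Q : U -> Ub) (Bi : U -> X)
    (T : R -> X -> X) :
  boundary_node j fB fA fC Q Bi -> wellposed_output_map j fB fA fC Q Bi ->
  generates (restrict_ker j fA fB) T ->
  exists tau M, 0 < tau /\ 0 < M /\ forall x y : X, generator T x y ->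
    sqrt (RInt (fun t => norm (fC (lift j fB (T (Rmax 0 t) x))) ^ 2) 0 tau) <= M * norm x.
Proof.
  intros Hnode [tau [M [Htau [HM H]]]] HT.
  exists tau, M. split; [exact Htau|]. split; [exact HM|]. intros x y Hg.
  destruct Hnode.
  destruct (classical_free_solution (Z := Z) (X := X) (Ub := Ub) (is_complete_CompleteNormedModule Z) (is_complete_CompleteNormedModule X)
    j fA fB Bi node_j node_j_inj node_fB node_Bi T HT x y tau Hg) as [Hx0 [Hxc [HxB Hxd]]].
  destruct (lift_spec (Z := Z) (X := X) (Ub := Ub) j fA fB node_j_inj T HT x y Hg) as [Hl0 [Hl1 _]].
  apply Rle_trans with (M * norm (j (lift j fB x))); [|right; do 2 f_equal; exact Hl1].
  apply (H (lift j fB x) (fun t => lift j fB (T (Rmax 0 t) x))); [exact Hl0|].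
  repeat split.
  - exact Hx0.
  - exact Hxd.
  - apply (continuous_on_of_cont (V := X)).
    apply (cont_plus (V := X)); [now apply (cont_linear (V := Z) (W := X) fA)|].
    apply (cont_const (V := X)).
  - apply (continuous_on_of_cont (V := Y)). now apply (cont_linear (V := Z) (W := Y) fC).
  - etransitivity; [apply HxB|]. symmetry. exact (linear_0 (V := U) (W := Ub) Q node_Q).
Qed.

(** * Smooth cut-off functions *)

Definition clip (s : R) : R := Rmin 1 (Rmax 0 s).

Lemma clip_bounds s : 0 <= clip s <= 1.
Proof. unfold clip, Rmin, Rmax. destruct (Rle_dec 0 s); destruct Rle_dec; lra. Qed.

Lemma clip_lipschitz r s : Rabs (clip r - clip s) <= Rabs (r - s).
Proof.
  unfold clip, Rmin, Rmax.
  destruct (Rle_dec 0 r), (Rle_dec 0 s); repeat destruct Rle_dec; unfold Rabs;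
    repeat destruct Rcase_abs; lra.
Qed.

Lemma clip_left s : s <= 0 -> clip s = 0.
Proof. intros H. unfold clip. rewrite (Rmax_left 0 s), Rmin_right; lra. Qed.

Lemma clip_right s : 1 <= s -> clip s = 1.
Proof. intros H. unfold clip. rewrite (Rmax_right 0 s), Rmin_left; lra. Qed.

Lemma clip_inside s : 0 <= s <= 1 -> clip s = s.
Proof. intros H. unfold clip. rewrite (Rmax_right 0 s), Rmin_right; lra. Qed.

Lemma clip_continuous s : continuous clip s.
Proof.
  intros P [d Hd]. exists d. intros r Hr. apply Hd.
  change (Rabs (clip r - clip s) < d). change (Rabs (r - s) < d) in Hr.
  eapply Rle_lt_trans; [apply clip_lipschitz|exact Hr].
Qed.

Lemma is_derive_RP (f : R -> R) t l : is_derive f t l <->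
  forall eps, 0 < eps -> exists d, 0 < d /\ forall s, Rabs (s - t) < d ->
    Rabs (f s - f t - (s - t) * l) <= eps * Rabs (s - t).
Proof.
  split.
  - intros [_ H] eps He. specialize (H t (fun P HP => HP) (mkposreal eps He)).
    apply locally_RP in H. exact H.
  - intros H. split; [apply is_linear_scal_l|]. intros x Hx.
    apply (is_filter_lim_locally_unique t x) in Hx. subst x.
    intros eps. apply locally_RP. exact (H eps (cond_pos eps)).
Qed.

(** Truncating the argument keeps a function continuously differentiable when
    its derivative vanishes at both ends. *)
Lemma is_derive_clip (p dp : R -> R) s : (forall x, is_derive p x (dp x)) -> dp 0 = 0 -> dp 1 = 0 ->
  is_derive (fun r => p (clip r)) s (dp (clip s)).
Proof.
  intros Hp H0 H1. apply is_derive_RP. intros eps He.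
  destruct (proj1 (is_derive_RP p (clip s) _) (Hp (clip s)) eps He) as [d [Hd H]].
  destruct (classic (0 < s < 1)) as [Hs|Hs].
  - exists (Rmin d (Rmin s (1 - s))). split; [repeat apply Rmin_glb_lt; lra|]. intros r Hr.
    pose proof (Rmin_l d (Rmin s (1 - s))). pose proof (Rmin_r d (Rmin s (1 - s))).
    pose proof (Rmin_l s (1 - s)). pose proof (Rmin_r s (1 - s)).
    assert (Hr' : Rabs (r - s) < Rmin s (1 - s)) by lra.
    apply Rabs_lt_between in Hr'.
    rewrite (clip_inside s) in * by lra. rewrite (clip_inside r) by lra. apply H. lra.
  - assert (Hz : dp (clip s) = 0).
    { destruct (Rle_lt_dec s 0); [now rewrite clip_left|]. rewrite clip_right by lra. exact H1. }
    exists d. split; [exact Hd|]. intros r Hr. pose proof (clip_lipschitz r s) as Hl.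
    specialize (H (clip r) ltac:(lra)). rewrite Hz, Rmult_0_r in *.
    eapply Rle_trans; [exact H|]. apply Rmult_le_compat_l; lra.
Qed.

Record cutoff (eps : R) (p p1 p2 : R -> R) : Prop := {
  cutoff_deriv : forall s, is_derive p s (p1 s);
  cutoff_deriv1 : forall s, is_derive p1 s (p2 s);
  cutoff_cont : forall s, continuous p2 s;
  cutoff_le0 : forall s, s <= 0 -> p s = 0;
  cutoff_ge : forall s, eps <= s -> p s = 1;
  cutoff_range : forall s, 0 <= p s <= 1;
  cutoff1_le0 : forall s, s <= 0 -> p1 s = 0;
  cutoff1_ge : forall s, eps <= s -> p1 s = 0;
  cutoff1_pos : forall s, 0 <= p1 s
}.

Lemma cutoff_exists eps : 0 < eps -> exists p p1 p2, cutoff eps p p1 p2.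
Proof.
  intros He.
  (* [q] rises from 0 to 1, and its first two derivatives vanish at both ends. *)
  set (q := fun c : R => c ^ 3 * (10 - 15 * c + 6 * c ^ 2)).
  set (q1 := fun c : R => 30 * c ^ 2 * (1 - c) ^ 2).
  set (q2 := fun c : R => 60 * c * (1 - c) * (1 - 2 * c)).
  assert (Hq : forall x, is_derive q x (q1 x)).
  { intros x. unfold q, q1. auto_derive; [exact I|ring]. }
  assert (Hq1 : forall x, is_derive q1 x (q2 x)).
  { intros x. unfold q1, q2. auto_derive; [exact I|ring]. }
  assert (Hsc : forall s, is_derive (fun r => / eps * r) s (/ eps)).
  { intros s. auto_derive; [exact I|ring]. }
  assert (Hie : 0 < / eps) by now apply Rinv_0_lt_compat.
  assert (Hl : forall s, s <= 0 -> clip (/ eps * s) = 0) by (intros s Hs; apply clip_left; nra).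
  assert (Hr : forall s, eps <= s -> clip (/ eps * s) = 1).
  { intros s Hs. apply clip_right. rewrite <- (Rinv_l eps) by lra. apply Rmult_le_compat_l; lra. }
  exists (fun s => q (clip (/ eps * s))), (fun s => / eps * q1 (clip (/ eps * s))),
    (fun s => / eps * (/ eps * q2 (clip (/ eps * s)))).
  constructor.
  - intros s. apply (is_derive_comp (fun r => q (clip r)) (fun r => / eps * r)); [|apply Hsc].
    apply is_derive_clip; [exact Hq| |]; unfold q1; ring.
  - intros s. apply is_derive_scal.
    apply (is_derive_comp (fun r => q1 (clip r)) (fun r => / eps * r)); [|apply Hsc].
    apply is_derive_clip; [exact Hq1| |]; unfold q2; ring.
  - intros s. apply (continuous_scal_r (V := R_NormedModule)), (continuous_scal_r (V := R_NormedModule)).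
    apply (continuous_comp (fun r => clip (/ eps * r)) q2).
    + apply (continuous_comp (fun r => / eps * r) clip); [|apply clip_continuous].
      apply (ex_derive_continuous (V := R_NormedModule)). eexists. apply Hsc.
    + apply (ex_derive_continuous (V := R_NormedModule)). unfold q2. auto_derive. exact I.
  - intros s Hs. rewrite Hl by exact Hs. unfold q. ring.
  - intros s Hs. rewrite Hr by exact Hs. unfold q. ring.
  - intros s. pose proof (clip_bounds (/ eps * s)). set (c := clip (/ eps * s)) in *. unfold q.
    assert (0 <= c ^ 3) by (apply pow_le; lra). assert (0 <= (1 - c) ^ 3) by (apply pow_le; lra).
    split; [nra|].
    assert (1 - c ^ 3 * (10 - 15 * c + 6 * c ^ 2) = (1 - c) ^ 3 * (1 + 3 * c + 6 * c ^ 2)) by ring.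
    assert (0 <= (1 - c) ^ 3 * (1 + 3 * c + 6 * c ^ 2)) by (apply Rmult_le_pos; nra). lra.
  - intros s Hs. rewrite Hl by exact Hs. unfold q1. ring.
  - intros s Hs. rewrite Hr by exact Hs. unfold q1. ring.
  - intros s. apply Rmult_le_pos; [lra|]. unfold q1.
    apply Rmult_le_pos; [|apply pow2_ge_0]. apply Rmult_le_pos; [lra|apply pow2_ge_0].
Qed.

(** * The coupling operators *)

Lemma RInt_cont_shift (g : R -> R) a b c : (forall t, continuous g t) ->
  RInt (fun s => g (s + c)) a b = RInt g (a + c) (b + c).
Proof.
  intros Hg. apply (is_RInt_unique (V := R_CompleteNormedModule)).
  apply (is_RInt_ext (V := R_NormedModule) (fun s => scal 1 (g (1 * s + c)))).
  - intros s _. unfold scal; simpl. unfold mult; simpl. now rewrite !Rmult_1_l.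
  - apply (is_RInt_comp_lin (V := R_NormedModule) g 1 c a b). rewrite !Rmult_1_l.
    apply (RInt_correct (V := R_CompleteNormedModule)), (ex_RInt_continuous (V := R_CompleteNormedModule)).
    intros; apply Hg.
Qed.

Lemma ex_RInt_cont (g : R -> R) a b : (forall t, continuous g t) -> ex_RInt g a b.
Proof.
  intros Hg. apply (ex_RInt_continuous (V := R_CompleteNormedModule)). intros; apply Hg.
Qed.

Lemma cont_sqr_norm {F : scalar_field} {V : NormedModule F} (u : R -> V) :
  cont u -> forall t, continuous (fun s => norm (u s) ^ 2) t.
Proof.
  intros Hu t. apply (continuous_comp (fun s => norm (u s)) (fun r => r ^ 2)); [now apply cont_norm|].
  apply (ex_derive_continuous (V := R_NormedModule)). auto_derive. exact I.
Qed.

Lemma continuous_add_const c t : continuous (fun s : R => s + c) t.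
Proof.
  apply (continuous_plus (V := R_NormedModule)); [apply continuous_id|apply continuous_const].
Qed.

Section Coupling.
Context {F : scalar_field} {X U : NormedModule F}.
Hypothesis hX : is_complete X.
Hypothesis hU : is_complete U.
Variables TK TL : R -> X -> X.
Hypothesis HK : C0_semigroup TK.
Hypothesis HL : C0_semigroup TL.
Variables E G : U -> X.
Hypothesis hE : is_linear E.
Hypothesis hG : is_linear G.
Variable kappa : X -> U.

Hypothesis kappa_plus : forall x x' y y', generator TL x y -> generator TL x' y' ->
  kappa (plus x x') = plus (kappa x) (kappa x').
Hypothesis kappa_scal : forall (k : F) x y, generator TL x y -> kappa (scal k x) = scal k (kappa x).
Hypothesis kappa_cont : forall x y, generator TL x y -> cont (fun s => kappa (TL (Rmax 0 s) x)).
Hypothesis kappa_integral : forall x y y' t, 0 <= t -> generator TL x y -> generator TL y y' ->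
  kappa (TL t x) = plus (kappa x) (integral (fun s => kappa (TL (Rmax 0 s) y)) 0 t).

Definition input_bound (tau M : R) : Prop := forall u u1 u2 : R -> U,
  (forall s, deriv u s (u1 s)) -> (forall s, deriv u1 s (u2 s)) -> cont u2 -> u 0 = zero ->
  norm (plus (E (u tau)) (conv TK (fun s => minus (G (u s)) (E (u1 s))) tau))
    <= M * sqrt (RInt (fun t => norm (u t) ^ 2) 0 tau).

Definition output_bound (tau M : R) : Prop := forall x y : X, generator TL x y ->
  sqrt (RInt (fun t => norm (kappa (TL (Rmax 0 t) x)) ^ 2) 0 tau) <= M * norm x.

Hypothesis hinput : exists tau M, 0 < tau /\ 0 < M /\ input_bound tau M.
Hypothesis houtput : exists tau M, 0 < tau /\ 0 < M /\ output_bound tau M.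

Let BK : locally_bounded TK := C0_semigroup_locally_bounded TK HK hX.
Let BL : locally_bounded TL := C0_semigroup_locally_bounded TL HL hX.

(** ** Removing the initial jump of the input *)

(** The state reached from zero at time [t] under an input [u] with derivative
    [u1].  The orbit of [E (u 0)] is subtracted because the initial state does
    not match [u 0]: the formula is that of the classical solution starting from
    [E (u 0)], minus the free motion of that initial state. *)
Definition response (u u1 : R -> U) (t : R) : X :=
  plus (minus (E (u t)) (TK t (E (u 0)))) (conv TK (fun s => minus (G (u s)) (E (u1 s))) t).

(** A source that stops at time [e] contributes proportionally to [e]. *)
Lemma conv_vanishing (f : R -> X) e t M B : 0 <= e <= t -> cont f -> 0 <= M ->
  (forall s (x : X), 0 <= s <= t -> norm (TK s x) <= M * norm x) ->
  (forall s, e <= s -> f s = zero) -> (forall s, 0 <= s <= e -> norm (f s) <= B) ->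
  norm (conv TK f t) <= M * (e * (M * B)).
Proof.
  intros He Hf HM HMb Hz HB.
  replace t with ((t - e) + e) by ring.
  rewrite (conv_add hX TK HK f (t - e) e) by (lra || assumption).
  assert (E0 : conv TK (fun r => f (e + r)) (t - e) = zero).
  { rewrite <- (conv_zero TK HK (t - e)). apply (conv_ext hX TK HK); [lra|apply cont_const|].
    intros s Hs. apply Hz. lra. }
  rewrite E0. eapply Rle_trans; [apply norm_triangle|]. rewrite norm_zero, Rplus_0_r.
  eapply Rle_trans; [apply HMb; lra|]. apply Rmult_le_compat_l; [exact HM|].
  apply (conv_bound hX TK HK); try assumption; try lra. intros s x Hs. apply HMb. lra.
Qed.

(** The derivative of a cut-off function is an approximate identity at the
    origin. *)
Lemma conv_approximate_identity (p p1 p2 : R -> R) (v : R -> X) e t M eta :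
  cutoff e p p1 p2 -> 0 < e <= t -> cont v -> 0 <= M -> 0 <= eta ->
  (forall s (x : X), 0 <= s <= t -> norm (TK s x) <= M * norm x) ->
  (forall s, 0 <= s <= e -> norm (minus (TK s (v (e - s))) (v 0)) <= eta) ->
  norm (minus (conv TK (fun s => scal (ofR (p1 s)) (v s)) t) (TK t (v 0)))
    <= M * (eta + norm (minus (TK e (v 0)) (v 0))).
Proof.
  intros Hp He Hv HM Heta HMb Hclose.
  assert (Hp1c : forall s, continuous p1 s).
  { intros s. apply (ex_derive_continuous (V := R_NormedModule)). eexists. apply Hp. }
  assert (Hf : cont (fun s => scal (ofR (p1 s)) (v s))).
  { now apply cont_scal_fun. }
  replace t with ((t - e) + e) by ring.
  rewrite (conv_add hX TK HK _ (t - e) e) by (lra || exact Hf).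
  assert (E0 : conv TK (fun r => scal (ofR (p1 (e + r))) (v (e + r))) (t - e) = zero).
  { rewrite <- (conv_zero TK HK (t - e)). apply (conv_ext hX TK HK); [lra|apply cont_const|].
    intros s Hs. rewrite (cutoff1_ge e p p1 p2 Hp) by lra. vmod. }
  rewrite E0, (sg_add TK HK) by lra.
  assert (Hl : is_linear (TK (t - e))) by (apply (sg_linear TK HK); lra).
  set (c := conv TK (fun s => scal (ofR (p1 s)) (v s)) e).
  apply Rle_trans with (norm (TK (t - e) (minus c (TK e (v 0))))).
  { right. f_equal. rewrite (linear_sub (TK (t - e))) by exact Hl. vmod. }
  eapply Rle_trans; [apply HMb; lra|]. apply Rmult_le_compat_l; [exact HM|].
  eapply Rle_trans; [apply (norm_minus_triangle _ (v 0))|].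
  rewrite (norm_minus_sym (v 0)). apply Rplus_le_compat_r.
  (* The weights [p1] have total mass one. *)
  assert (Hr : forall s, is_derive (fun r => - p (e - r)) s (p1 (e - s))).
  { intros s. evar_last.
    - apply (is_derive_opp (V := R_NormedModule)).
      apply (is_derive_comp p (fun r => e - r)); [apply Hp|]. auto_derive; [exact I|reflexivity].
    - unfold scal, opp; simpl. unfold mult; simpl. ring. }
  assert (Hp1r : forall s, continuous (fun r => p1 (e - r)) s).
  { intros s. apply (continuous_comp (fun r => e - r) p1); [|apply Hp1c].
    apply (ex_derive_continuous (V := R_NormedModule)). auto_derive. exact I. }
  assert (Hmass : is_RInt (fun r => p1 (e - r)) 0 e 1).
  { evar_last.
    - apply (is_RInt_derive (V := R_CompleteNormedModule) (fun r => - p (e - r)) (fun r => p1 (e - r)));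
        intros; [apply Hr|apply Hp1r].
    - unfold minus, plus, opp; simpl. rewrite Rminus_0_r, Rminus_diag_eq by reflexivity.
      rewrite (cutoff_le0 e p p1 p2 Hp) by lra. rewrite (cutoff_ge e p p1 p2 Hp) by lra. ring. }
  assert (Ev : v 0 = integral (fun s => scal (ofR (p1 (e - s))) (v 0)) 0 e).
  { assert (Hd : forall s, deriv (fun r => scal (ofR (- p (e - r))) (v 0)) s
        (plus (scal (ofR (p1 (e - s))) (v 0)) (scal (ofR (- p (e - s))) zero))).
    { intros s. apply (deriv_mult (fun r => - p (e - r)) (fun _ => v 0)); [apply Hr|apply deriv_const]. }
    transitivity (integral (fun s => plus (scal (ofR (p1 (e - s))) (v 0)) (scal (ofR (- p (e - s))) zero)) 0 e).
    - rewrite (integral_deriv hX _ _ 0 e Hd).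
      + rewrite Rminus_0_r, Rminus_diag_eq by reflexivity.
        rewrite (cutoff_le0 e p p1 p2 Hp) by lra. rewrite (cutoff_ge e p p1 p2 Hp) by lra. vmod.
      + apply (cont_ext (fun s => scal (ofR (p1 (e - s))) (v 0))); [intros s; vmod|].
        apply (cont_scal_fun (fun s => p1 (e - s)) (fun _ => v 0)); [exact Hp1r|apply cont_const].
    - f_equal. apply functional_extensionality. intros s. vmod. }
  unfold c, conv. rewrite Ev. rewrite <- (integral_minus hX).
  2: now apply (conv_integrand_cont hX TK HK (fun s => scal (ofR (p1 s)) (v s))).
  2: apply (cont_scal_fun (fun s => p1 (e - s)) (fun _ => v 0)); [exact Hp1r|apply cont_const].
  eapply Rle_trans.
  - apply (integral_norm_le_fun hX) with (g := fun s => p1 (e - s) * eta); [lra| | |].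
    + apply cont_minus.
      * now apply (conv_integrand_cont hX TK HK (fun s => scal (ofR (p1 s)) (v s))).
      * apply (cont_scal_fun (fun s => p1 (e - s)) (fun _ => v 0)); [exact Hp1r|apply cont_const].
    + intros s. apply (continuous_mult (fun r => p1 (e - r)) (fun _ => eta)); [apply Hp1r|apply continuous_const].
    + intros s Hs. rewrite Rmax_right by lra.
      rewrite (linear_scal (TK s)) by (apply (sg_linear TK HK); lra).
      apply Rle_trans with (norm (rscal (p1 (e - s)) (minus (TK s (v (e - s))) (v 0)))).
      { right. f_equal. vmod. }
      rewrite norm_rscal, Rabs_pos_eq by apply Hp.
      apply Rmult_le_compat_l; [apply Hp|]. now apply Hclose.
  - right. apply (is_RInt_unique (V := R_CompleteNormedModule)).
    apply (is_RInt_ext (V := R_NormedModule) (fun s => scal eta (p1 (e - s)))).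
    + intros s _. unfold scal; simpl. unfold mult; simpl. ring.
    + evar_last; [apply (is_RInt_scal (V := R_NormedModule)), Hmass|].
      unfold scal; simpl. unfold mult; simpl. ring.
Qed.

(** Well-posedness only speaks of inputs that vanish initially, and of the one
    final time [tau].  The input [u] on [[0,t]] is therefore delayed to start at
    [tau - t] and switched on by a cut-off of width [e].  Its response tends to
    [response u u1 t] as [e] tends to zero: the derivative of the cut-off
    produces the term [TK t (E (u 0))] in the limit, and the norm of the
    input is never larger than that of [u]. *)
Lemma response_bound tau M (u u1 u2 : R -> U) t : 0 < tau -> 0 < M -> input_bound tau M ->
  (forall s, deriv u s (u1 s)) -> (forall s, deriv u1 s (u2 s)) -> cont u2 -> 0 < t <= tau ->
  norm (response u u1 t) <= M * sqrt (RInt (fun s => norm (u s) ^ 2) 0 t).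
Proof.
  intros Htau HM Hin Hu1 Hu2 Hc Ht.
  assert (Hcu : cont u) by (intros s; now apply deriv_cont with (u1 s)).
  assert (Hcu1 : cont u1) by (intros s; now apply deriv_cont with (u2 s)).
  set (r0 := tau - t).
  set (g := (fun s => minus (G (u s)) (E (u1 s))) : R -> X).
  set (v := fun s => E (u s)).
  assert (Hg : cont g) by (apply cont_minus; now apply cont_linear).
  assert (Hv : cont v) by now apply (cont_linear E u).
  destruct (BK t) as [MK [HMK HMKb]].
  destruct (cont_bounded g 1 Hg) as [B [HB HBb]].
  apply le_epsilon. intros eta Heta.
  set (a := eta / (4 * MK)). assert (Ha : 0 < a) by (apply Rdiv_lt_0_compat; lra).
  destruct (sg_right_limit TK HK (v 0) (a / 2)) as [d1 [Hd1 H1]]; [lra|].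
  destruct (proj1 (contP v) Hv 0 (a / (2 * MK))) as [d2 [Hd2 H2]]; [apply Rdiv_lt_0_compat; lra|].
  set (b := eta / (4 * (MK * (MK * B)))).
  assert (HMB : 0 < MK * (MK * B)) by (repeat apply Rmult_lt_0_compat; lra).
  assert (Hb : 0 < b) by (apply Rdiv_lt_0_compat; lra).
  set (e := Rmin (Rmin 1 t) (Rmin b (Rmin (d1 / 2) (d2 / 2)))).
  pose proof (Rmin_l (Rmin 1 t) (Rmin b (Rmin (d1 / 2) (d2 / 2)))).
  pose proof (Rmin_r (Rmin 1 t) (Rmin b (Rmin (d1 / 2) (d2 / 2)))).
  pose proof (Rmin_l 1 t). pose proof (Rmin_r 1 t).
  pose proof (Rmin_l b (Rmin (d1 / 2) (d2 / 2))). pose proof (Rmin_r b (Rmin (d1 / 2) (d2 / 2))).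
  pose proof (Rmin_l (d1 / 2) (d2 / 2)). pose proof (Rmin_r (d1 / 2) (d2 / 2)).
  fold e in H, H0. assert (He : 0 < e) by (repeat apply Rmin_glb_lt; lra).
  destruct (cutoff_exists e He) as [p [p1 [p2 Hp]]].
  assert (Hpc : forall s, continuous p s).
  { intros s. apply (ex_derive_continuous (V := R_NormedModule)). eexists. apply Hp. }
  assert (Hp1c : forall s, continuous p1 s).
  { intros s. apply (ex_derive_continuous (V := R_NormedModule)). eexists. apply Hp. }
  (* The admissible input: [u] delayed by [tau - t] and switched on smoothly. *)
  set (w := (fun s => scal (ofR (p s)) (u s)) : R -> U).
  set (w1 := (fun s => plus (scal (ofR (p1 s)) (u s)) (scal (ofR (p s)) (u1 s))) : R -> U).
  set (w2 := (fun s => plus (plus (scal (ofR (p2 s)) (u s)) (scal (ofR (p1 s)) (u1 s)))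
                            (plus (scal (ofR (p1 s)) (u1 s)) (scal (ofR (p s)) (u2 s)))) : R -> U).
  assert (Hw : forall s, deriv w s (w1 s)).
  { intros s. apply deriv_mult; [apply Hp|apply Hu1]. }
  assert (Hw1 : forall s, deriv w1 s (w2 s)).
  { intros s. apply deriv_plus; apply deriv_mult; try apply Hp; [apply Hu1|apply Hu2]. }
  assert (Hw2 : cont w2).
  { apply cont_plus; apply cont_plus; apply cont_scal_fun; try assumption. apply Hp. }
  assert (Hw0 : forall s, s <= 0 -> w s = zero /\ w1 s = zero).
  { intros s Hs. unfold w, w1. rewrite (cutoff_le0 e p p1 p2 Hp), (cutoff1_le0 e p p1 p2 Hp) by exact Hs.
    split; vmod. }
  assert (Hwc : cont w) by (intros s; now apply deriv_cont with (w1 s)).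
  assert (Hw1c : cont w1) by (intros s; now apply deriv_cont with (w2 s)).
  pose proof (Hin (fun s => w (s + - r0)) (fun s => w1 (s + - r0)) (fun s => w2 (s + - r0))
    (fun s => deriv_shift w s (w1 (s + - r0)) (- r0) (Hw (s + - r0)))
    (fun s => deriv_shift w1 s (w2 (s + - r0)) (- r0) (Hw1 (s + - r0)))) as HI.
  assert (Hsh : cont (fun s => w2 (s + - r0))).
  { apply (cont_comp w2 (fun s => s + - r0)); [apply continuous_add_const|exact Hw2]. }
  specialize (HI Hsh). assert (Hwr : w (0 + - r0) = zero) by (apply Hw0; unfold r0; lra).
  specialize (HI Hwr). clear Hwr Hsh.
  (* Before the delayed input starts there is nothing to convolve. *)
  set (f := (fun s => minus (G (w s)) (E (w1 s))) : R -> X).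
  assert (Hf : cont f) by (apply cont_minus; now apply cont_linear).
  assert (Hf0 : forall s, s <= 0 -> f s = zero).
  { intros s Hs. unfold f. destruct (Hw0 s Hs) as [-> ->]. rewrite !linear_0 by assumption. vmod. }
  assert (Econv : conv TK (fun s => minus (G (w (s + - r0))) (E (w1 (s + - r0)))) tau = conv TK f t).
  { replace tau with (t + r0) by (unfold r0; ring).
    etransitivity; [apply (conv_add hX TK HK (fun s => f (s + - r0)) t r0); [lra|unfold r0; lra|]|].
    - apply (cont_comp f (fun s => s + - r0)); [apply continuous_add_const|exact Hf].
    - assert (E0 : conv TK (fun s => f (s + - r0)) r0 = zero).
      { rewrite <- (conv_zero TK HK r0). apply (conv_ext hX TK HK); [unfold r0; lra|apply cont_const|].
        intros s Hs. apply Hf0. lra. }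
      rewrite E0, linear_0 by (apply (sg_linear TK HK); lra).
      replace (fun r => f (r0 + r + - r0)) with f by (apply functional_extensionality; intros s; f_equal; ring).
      apply plus_zero_l. }
  cbv beta in HI.
  assert (HI0 : norm (plus (E (w t)) (conv TK f t)) <= M * sqrt (RInt (fun s => norm (w (s + - r0)) ^ 2) 0 tau)).
  { rewrite <- Econv. replace t with (tau + - r0) at 1 by (unfold r0; ring). exact HI. }
  clear HI. rename HI0 into HI.
  assert (Ewt : w t = u t).
  { unfold w. rewrite (cutoff_ge e p p1 p2 Hp) by lra. vmod. }
  rewrite Ewt in HI.
  (* Only the part of the input on [0,t] contributes to its norm. *)
  assert (Hint : RInt (fun s => norm (w (s + - r0)) ^ 2) 0 tau <= RInt (fun s => norm (u s) ^ 2) 0 t).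
  { rewrite (RInt_cont_shift (fun s => norm (w s) ^ 2)) by now apply cont_sqr_norm.
    rewrite <- (RInt_Chasles (V := R_CompleteNormedModule) _ _ 0) by (apply ex_RInt_cont; now apply cont_sqr_norm).
    replace (tau + - r0) with t by (unfold r0; ring).
    assert (I1 : RInt (fun s => norm (w s) ^ 2) (0 + - r0) 0 <= 0).
    { right. apply (is_RInt_unique (V := R_CompleteNormedModule)).
      apply (is_RInt_ext (V := R_NormedModule) (fun _ => 0)).
      - rewrite Rmin_left, Rmax_right by (unfold r0; lra). intros s Hs.
        rewrite (proj1 (Hw0 s ltac:(lra))), norm_zero. simpl. ring.
      - evar_last; [apply (is_RInt_const (V := R_NormedModule))|].
        unfold scal; simpl. unfold mult; simpl. ring. }
    assert (I2 : RInt (fun s => norm (w s) ^ 2) 0 t <= RInt (fun s => norm (u s) ^ 2) 0 t).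
    { apply RInt_le; [lra|apply ex_RInt_cont; now apply cont_sqr_norm|apply ex_RInt_cont; now apply cont_sqr_norm|].
      intros s Hs. unfold w. change (norm (rscal (p s) (u s)) ^ 2 <= norm (u s) ^ 2).
      rewrite norm_rscal. pose proof (cutoff_range e p p1 p2 Hp s). rewrite Rabs_pos_eq by lra.
      pose proof (norm_ge_0 (u s)). apply pow_incr. nra. }
    apply Rle_trans with (0 + RInt (fun s => norm (u s) ^ 2) 0 t); [exact (Rplus_le_compat _ _ _ _ I1 I2)|lra]. }
  assert (HI' : norm (plus (E (u t)) (conv TK f t)) <= M * sqrt (RInt (fun s => norm (u s) ^ 2) 0 t)).
  { eapply Rle_trans; [exact HI|]. apply Rmult_le_compat_l; [lra|]. now apply sqrt_le_1_alt. }
  (* What separates the switched response from [response u u1 t] is a source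
     supported in [[0,e]] and the defect of the approximate identity. *)
  set (f1 := (fun s => scal (ofR (p s - 1)) (g s)) : R -> X).
  set (f2 := (fun s => scal (ofR (p1 s)) (v s)) : R -> X).
  assert (Hf1 : cont f1).
  { apply cont_scal_fun; [|exact Hg]. intros s.
    apply (continuous_minus (V := R_NormedModule)); [apply Hpc|apply continuous_const]. }
  assert (Hf2 : cont f2) by now apply cont_scal_fun.
  assert (Edecomp : conv TK f t = minus (plus (conv TK g t) (conv TK f1 t)) (conv TK f2 t)).
  { rewrite <- (conv_plus hX TK HK g f1) by assumption.
    rewrite <- (conv_minus hX TK HK (fun s => plus (g s) (f1 s)) f2) by (assumption || now apply cont_plus).
    f_equal. apply functional_extensionality. intros s. cbv beta delta [f g f1 f2 w w1 v].
    rewrite (linear_plus E hE), !(linear_scal E hE), (linear_scal G hG). vmod. }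
  assert (N1 : norm (conv TK f1 t) <= MK * (e * (MK * B))).
  { apply conv_vanishing; try assumption; try lra.
    - intros s Hs. unfold f1. rewrite (cutoff_ge e p p1 p2 Hp) by exact Hs. vmod.
    - intros s Hs. unfold f1. change (norm (rscal (p s - 1) (g s)) <= B).
      rewrite norm_rscal. pose proof (cutoff_range e p p1 p2 Hp s).
      assert (Rabs (p s - 1) <= 1) by (apply Rabs_le; lra).
      specialize (HBb s). rewrite Rabs_pos_eq in HBb by lra. specialize (HBb ltac:(lra)).
      pose proof (norm_ge_0 (g s)). pose proof (Rabs_pos (p s - 1)). nra. }
  assert (N2 : norm (minus (conv TK f2 t) (TK t (v 0))) <= MK * (a + norm (minus (TK e (v 0)) (v 0)))).
  { apply (conv_approximate_identity p p1 p2 v e t MK a Hp); try assumption; try lra.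
    intros s Hs. specialize (H1 s ltac:(lra)). specialize (H2 (e - s)).
    rewrite Rminus_0_r, Rabs_pos_eq in H2 by lra. specialize (H2 ltac:(lra)).
    eapply Rle_trans; [apply (norm_minus_triangle _ (TK s (v 0)))|].
    rewrite <- (linear_sub (TK s)) by (apply (sg_linear TK HK); lra).
    assert (norm (TK s (minus (v (e - s)) (v 0))) <= MK * norm (minus (v (e - s)) (v 0))) by (apply HMKb; lra).
    assert (MK * norm (minus (v (e - s)) (v 0)) <= MK * (a / (2 * MK))) by (apply Rmult_le_compat_l; lra).
    replace (MK * (a / (2 * MK))) with (a / 2) in * by (field; lra). lra. }
  apply Rle_trans with (norm (plus (plus (E (u t)) (conv TK f t))
     (minus (minus (conv TK f2 t) (TK t (v 0))) (conv TK f1 t)))).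
  { right. unfold response. f_equal. rewrite Edecomp. unfold v, g. vmod. }
  eapply Rle_trans; [apply norm_triangle|]. apply Rplus_le_compat; [exact HI'|].
  eapply Rle_trans; [apply norm_minus_le|].
  specialize (H1 e ltac:(lra)).
  assert (MK * (e * (MK * B)) <= eta / 4).
  { apply Rle_trans with (b * (MK * (MK * B))); [|right; unfold b; field; lra].
    replace (MK * (e * (MK * B))) with (e * (MK * (MK * B))) by ring. apply Rmult_le_compat_r; lra. }
  assert (MK * (a + norm (minus (TK e (v 0)) (v 0))) <= MK * (a + a)).
  { apply Rmult_le_compat_l; lra. }
  assert (MK * (a + a) = eta / 2) by (unfold a; field; lra). lra.
Qed.

(** ** Smooth orbits as inputs *)

Definition orbit_output (e : X) (s : R) : U := kappa (TL (Rmax 0 s) e).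

(** Three derivatives of the orbit make the observation twice continuously
    differentiable. *)
Definition smooth (e e1 : X) : Prop := generator TL e e1 /\ gdom TL 2 e1.

(** The effect at time [t] on the first component of an initial error [e],
    whose derivative is [e1]. *)
Definition coupling (t : R) (e e1 : X) : X := response (orbit_output e) (orbit_output e1) t.

Definition coupling_source (e e1 : X) (s : R) : X :=
  minus (G (orbit_output e s)) (E (orbit_output e1 s)).

Lemma deriv_primitive {V : NormedModule F} (hV : is_complete V) (c : V) (g : R -> V) t :
  cont g -> deriv (fun s => plus c (integral g 0 s)) t (g t).
Proof.
  intros Hg. replace (g t) with (plus (zero : V) (g t)) by apply plus_zero_l.
  apply deriv_plus; [apply deriv_const|now apply deriv_integral].
Qed.

Lemma smooth_cont (e e1 : X) : smooth e e1 ->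
  cont (orbit_output e) /\ cont (orbit_output e1) /\ cont (coupling_source e e1).
Proof.
  intros [H1 [e2 [H2 _]]].
  assert (A : cont (orbit_output e)) by exact (kappa_cont e e1 H1).
  assert (B : cont (orbit_output e1)) by exact (kappa_cont e1 e2 H2).
  repeat split; [exact A|exact B|].
  apply cont_minus; [now apply (cont_linear G)|now apply (cont_linear E)].
Qed.

Lemma smooth_input (e e1 : X) : smooth e e1 -> exists u u1 u2 : R -> U,
  (forall s, deriv u s (u1 s)) /\ (forall s, deriv u1 s (u2 s)) /\ cont u2 /\
  (forall s, 0 <= s -> u s = orbit_output e s) /\ (forall s, 0 <= s -> u1 s = orbit_output e1 s).
Proof.
  intros [H1 [e2 [H2 [e3 [H3 _]]]]].
  pose proof (kappa_cont e2 e3 H3) as Hc2. pose proof (kappa_cont e1 e2 H2) as Hc1.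
  set (u1 := (fun s => plus (kappa e1) (integral (orbit_output e2) 0 s)) : R -> U).
  assert (Hu1 : forall s, deriv u1 s (orbit_output e2 s)) by (intros s; now apply deriv_primitive).
  assert (Hcu1 : cont u1) by (intros s; now apply deriv_cont with (orbit_output e2 s)).
  assert (E1 : forall s, 0 <= s -> u1 s = orbit_output e1 s).
  { intros s Hs. unfold orbit_output. rewrite Rmax_right by exact Hs.
    symmetry. now apply (kappa_integral e1 e2 e3). }
  exists (fun s => plus (kappa e) (integral u1 0 s)), u1, (orbit_output e2).
  repeat split; try assumption.
  - intros s. now apply deriv_primitive.
  - intros s Hs. unfold orbit_output. rewrite Rmax_right by exact Hs.
    rewrite (kappa_integral e e1 e2 s) by assumption. f_equal.
    symmetry. apply (integral_ext hU); [exact Hs|exact Hcu1|]. intros r Hr. apply E1. lra.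
Qed.

Lemma coupling_0 (e e1 : X) : coupling 0 e e1 = zero.
Proof. unfold coupling, response. rewrite conv_at, (sg_0 TK HK). vmod. Qed.

(** The response is bounded by the norm of the input, which is the observation
    of an orbit and hence bounded by its initial value. *)
Lemma coupling_bound_short : exists d C, 0 < d /\ 0 < C /\
  forall t e e1, 0 <= t <= d -> smooth e e1 -> norm (coupling t e e1) <= C * norm e.
Proof.
  destruct hinput as [tau [M [Htau [HM Hin]]]]. destruct houtput as [tau' [M' [Htau' [HM' Hout]]]].
  exists (Rmin tau tau'), (M * M'). split; [now apply Rmin_glb_lt|].
  split; [now apply Rmult_lt_0_compat|]. intros t e e1 Ht Hs.
  pose proof (Rmin_l tau tau'). pose proof (Rmin_r tau tau').
  destruct (Req_dec t 0) as [->|Hne].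
  { rewrite coupling_0, norm_zero. apply Rmult_le_pos; [|apply norm_ge_0].
    left. now apply Rmult_lt_0_compat. }
  destruct (smooth_input e e1 Hs) as [u [u1 [u2 [Hu [Hu1 [Hu2 [Hue Hu1e]]]]]]].
  destruct (smooth_cont e e1 Hs) as [Hc [Hc1 Hcs]].
  assert (Hcu : cont u) by (intros s; now apply deriv_cont with (u1 s)).
  assert (Er : coupling t e e1 = response u u1 t).
  { assert (Ec : conv TK (fun s => minus (G (u s)) (E (u1 s))) t = conv TK (coupling_source e e1) t).
    { apply (conv_ext hX TK HK); [lra|exact Hcs|]. intros s Hs'. rewrite Hue, Hu1e by lra. reflexivity. }
    unfold coupling, response. rewrite Ec, !Hue by lra. reflexivity. }
  rewrite Er. eapply Rle_trans.
  { apply (response_bound tau M u u1 u2 t); try assumption. lra. }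
  rewrite Rmult_assoc. apply Rmult_le_compat_l; [lra|].
  eapply Rle_trans; [|apply (Hout e e1 (proj1 Hs))].
  apply sqrt_le_1_alt.
  assert (Hcq : forall a b, ex_RInt (fun s => norm (orbit_output e s) ^ 2) a b)
    by (intros a b; apply ex_RInt_cont; now apply cont_sqr_norm).
  apply Rle_trans with (RInt (fun s => norm (orbit_output e s) ^ 2) 0 t).
  - apply RInt_le; [lra|apply ex_RInt_cont; now apply cont_sqr_norm|apply Hcq|].
    intros s Hs'. rewrite Hue by lra. lra.
  - pose proof (RInt_Chasles (V := R_CompleteNormedModule) _ 0 t tau' (Hcq 0 t) (Hcq t tau')) as HC.
    change (RInt (fun s => norm (orbit_output e s) ^ 2) 0 t + RInt (fun s => norm (orbit_output e s) ^ 2) t tau' =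
      RInt (fun s => norm (orbit_output e s) ^ 2) 0 tau') in HC.
    assert (0 <= RInt (fun s => norm (orbit_output e s) ^ 2) t tau').
    { apply RInt_ge_0; [lra|apply Hcq|]. intros s _. apply pow2_ge_0. }
    unfold orbit_output in *. lra.
Qed.

Lemma smooth_orbit s (e e1 : X) : 0 <= s -> smooth e e1 -> smooth (TL s e) (TL s e1).
Proof.
  intros Hs [H1 H2]. split; [now apply (generator_orbit TL HL)|now apply (gdom_orbit TL HL)].
Qed.

Lemma orbit_output_shift s r (e : X) : 0 <= s -> 0 <= r ->
  orbit_output (TL s e) r = orbit_output e (s + r).
Proof.
  intros Hs Hr. unfold orbit_output. rewrite !Rmax_right by lra.
  rewrite <- (sg_add TL HL) by assumption. do 2 f_equal. ring.
Qed.

(** The state at time [s] is propagated by [TK], and the error at time [s] acts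
    as a new initial error. *)
Lemma coupling_law t s (e e1 : X) : 0 <= t -> 0 <= s -> smooth e e1 ->
  coupling (t + s) e e1 = plus (TK t (coupling s e e1)) (coupling t (TL s e) (TL s e1)).
Proof.
  intros Ht Hs Hsm. destruct (smooth_cont e e1 Hsm) as [_ [_ Hcs]].
  unfold coupling, response.
  rewrite !orbit_output_shift, Rplus_0_r by lra.
  change (fun s => minus (G (orbit_output e s)) (E (orbit_output e1 s))) with (coupling_source e e1).
  assert (Ec : conv TK (fun r => minus (G (orbit_output (TL s e) r)) (E (orbit_output (TL s e1) r))) t
    = conv TK (fun r => coupling_source e e1 (s + r)) t).
  { apply (conv_ext hX TK HK); [exact Ht|now apply cont_shift|].
    intros r Hr. unfold coupling_source. rewrite !orbit_output_shift by lra. reflexivity. }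
  rewrite Ec, (conv_add hX TK HK (coupling_source e e1) t s) by assumption.
  assert (Hl : is_linear (TK t)) by now apply (sg_linear TK HK).
  rewrite (linear_plus (TK t) Hl), (linear_sub (TK t)), <- (sg_add TK HK) by assumption.
  rewrite (Rplus_comm s t). vmod.
Qed.

Lemma coupling_bound c : exists C, 0 < C /\
  forall t e e1, 0 <= t <= c -> smooth e e1 -> norm (coupling t e e1) <= C * norm e.
Proof.
  destruct coupling_bound_short as [d [C [Hd [HC H]]]].
  assert (Hn : forall n : nat, exists C', 0 < C' /\ forall t e e1, 0 <= t <= INR n * d ->
    smooth e e1 -> norm (coupling t e e1) <= C' * norm e).
  { induction n as [|n [C' [HC' IH]]].
    - exists 1. split; [lra|]. intros t e e1 Ht Hs. simpl in Ht.
      replace t with 0 by lra. rewrite coupling_0, norm_zero. pose proof (norm_ge_0 e). lra.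
    - destruct (BK (INR n * d)) as [MK [HMK HMKb]]. destruct (BL d) as [ML [HML HMLb]].
      exists (C + MK * C + C' * ML).
      assert (0 < MK * C) by now apply Rmult_lt_0_compat.
      assert (0 < C' * ML) by now apply Rmult_lt_0_compat.
      split; [lra|]. intros t e e1 Ht Hs. rewrite S_INR in Ht.
      pose proof (norm_ge_0 e) as Hne.
      destruct (Rle_lt_dec t d) as [Htd|Htd].
      + specialize (H t e e1 ltac:(lra) Hs). nra.
      + replace t with ((t - d) + d) by ring. rewrite coupling_law by (lra || exact Hs).
        eapply Rle_trans; [apply norm_triangle|].
        pose proof (HMKb (t - d) (coupling d e e1) ltac:(lra)) as B1.
        pose proof (H d e e1 ltac:(lra) Hs) as B2.
        pose proof (IH (t - d) (TL d e) (TL d e1) ltac:(lra) (smooth_orbit d e e1 (Rlt_le _ _ Hd) Hs)) as B3.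
        pose proof (HMLb d e ltac:(lra)) as B4.
        assert (MK * norm (coupling d e e1) <= MK * (C * norm e)) by (apply Rmult_le_compat_l; lra).
        assert (C' * norm (TL d e) <= C' * (ML * norm e)) by (apply Rmult_le_compat_l; lra).
        assert (0 <= C * norm e) by (apply Rmult_le_pos; lra). lra. }
  destruct (INR_unbounded (c / d)) as [n Hcn]. destruct (Hn n) as [C' [HC' H']].
  exists C'. split; [exact HC'|]. intros t e e1 Ht. apply H'. split; [lra|].
  apply Rmult_lt_compat_r with (r := d) in Hcn; [|exact Hd].
  unfold Rdiv in Hcn. rewrite Rmult_assoc, Rinv_l, Rmult_1_r in Hcn by lra. lra.
Qed.

Lemma orbit_output_plus (e e1 e' e1' : X) s : generator TL e e1 -> generator TL e' e1' ->
  orbit_output (plus e e') s = plus (orbit_output e s) (orbit_output e' s).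
Proof.
  intros H H'. unfold orbit_output.
  rewrite (linear_plus _ (sg_linear TL HL _ (Rmax_l 0 s))).
  apply (kappa_plus _ _ (TL (Rmax 0 s) e1) (TL (Rmax 0 s) e1'));
    apply (generator_orbit TL HL); assumption || apply Rmax_l.
Qed.

Lemma orbit_output_scal (k : F) (e e1 : X) s : generator TL e e1 ->
  orbit_output (scal k e) s = scal k (orbit_output e s).
Proof.
  intros H. unfold orbit_output.
  rewrite (linear_scal _ (sg_linear TL HL _ (Rmax_l 0 s))).
  apply (kappa_scal k _ (TL (Rmax 0 s) e1)).
  apply (generator_orbit TL HL); assumption || apply Rmax_l.
Qed.

Lemma smooth_plus (e e1 e' e1' : X) : smooth e e1 -> smooth e' e1' -> smooth (plus e e') (plus e1 e1').
Proof.
  intros [H1 H2] [H1' H2']. split; [now apply (generator_plus TL HL)|now apply (gdom_plus TL HL)].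
Qed.

Lemma smooth_scal (k : F) (e e1 : X) : smooth e e1 -> smooth (scal k e) (scal k e1).
Proof.
  intros [H1 H2]. split; [now apply (generator_scal TL HL)|now apply (gdom_scal TL HL)].
Qed.

Lemma coupling_plus t (e e1 e' e1' : X) : 0 <= t -> smooth e e1 -> smooth e' e1' ->
  coupling t (plus e e') (plus e1 e1') = plus (coupling t e e1) (coupling t e' e1').
Proof.
  intros Ht Hs Hs'.
  destruct (smooth_cont e e1 Hs) as [_ [_ Hc]]. destruct (smooth_cont e' e1' Hs') as [_ [_ Hc']].
  destruct Hs as [H1 [e2 [H2 _]]]. destruct Hs' as [H1' [e2' [H2' _]]].
  unfold coupling, response.
  assert (Ec : conv TK (fun s => minus (G (orbit_output (plus e e') s)) (E (orbit_output (plus e1 e1') s))) t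
    = plus (conv TK (coupling_source e e1) t) (conv TK (coupling_source e' e1') t)).
  { rewrite <- (conv_plus hX TK HK) by assumption. f_equal. apply functional_extensionality.
    intros s. unfold coupling_source.
    rewrite (orbit_output_plus e e1 e' e1'), (orbit_output_plus e1 e2 e1' e2') by assumption.
    rewrite (linear_plus G hG), (linear_plus E hE). vmod. }
  rewrite Ec, !(orbit_output_plus e e1 e' e1'), !(linear_plus E hE) by assumption.
  rewrite (linear_plus (TK t)) by now apply (sg_linear TK HK).
  unfold coupling_source. vmod.
Qed.

Lemma coupling_scal t (k : F) (e e1 : X) : 0 <= t -> smooth e e1 ->
  coupling t (scal k e) (scal k e1) = scal k (coupling t e e1).
Proof.
  intros Ht Hs. destruct (smooth_cont e e1 Hs) as [_ [_ Hc]].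
  destruct Hs as [H1 [e2 [H2 _]]]. unfold coupling, response.
  assert (Hk : forall x y : X, scal k (minus x y) = minus (scal k x) (scal k y))
    by exact (fun x y => linear_sub (fun v => scal k v) x y (is_linear_scalar k)).
  assert (Ec : conv TK (fun s => minus (G (orbit_output (scal k e) s)) (E (orbit_output (scal k e1) s))) t
    = scal k (conv TK (coupling_source e e1) t)).
  { rewrite <- (conv_scal hX TK HK) by assumption. f_equal. apply functional_extensionality.
    intros s. unfold coupling_source.
    rewrite (orbit_output_scal k e e1), (orbit_output_scal k e1 e2) by assumption.
    rewrite (linear_scal G hG), (linear_scal E hE). symmetry. apply Hk. }
  rewrite Ec, !(orbit_output_scal k e e1), !(linear_scal E hE) by assumption.
  rewrite (linear_scal (TK t)) by now apply (sg_linear TK HK).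
  rewrite <- Hk. symmetry. exact (linear_plus _ (is_linear_scalar k) _ _).
Qed.

(** The jump of the orbit of [E (kappa e)] and the response cancel to first
    order, up to the rate of the input. *)
Lemma coupling_derivative (e e1 : X) : smooth e e1 -> forall eps, 0 < eps ->
  exists d, 0 < d /\ forall h, 0 < h < d ->
  norm (minus (plus (minus (TK h (E (kappa e))) (E (kappa e))) (coupling h e e1))
              (scal (ofR h) (G (kappa e)))) <= eps * h.
Proof.
  intros Hs eps He.
  destruct (smooth_input e e1 Hs) as [u [u1 [u2 [Hu [_ [_ [Hue Hu1e]]]]]]].
  destruct (smooth_cont e e1 Hs) as [_ [_ Hcs]].
  pose proof (deriv_linear E u 0 _ hE (Hu 0)) as HEu.
  destruct (proj1 (derivP _ _ _) HEu (eps / 2)) as [d1 [Hd1 H1]]; [lra|].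
  destruct (conv_small hX TK HK (coupling_source e e1) Hcs (eps / 2)) as [d2 [Hd2 H2]]; [lra|].
  exists (Rmin d1 d2). split; [now apply Rmin_glb_lt|]. intros h Hh.
  pose proof (Rmin_l d1 d2). pose proof (Rmin_r d1 d2).
  specialize (H1 h). rewrite Rminus_0_r, Rabs_pos_eq in H1 by lra. specialize (H1 ltac:(lra)).
  specialize (H2 h ltac:(lra)).
  assert (E0 : kappa e = orbit_output e 0) by (unfold orbit_output; now rewrite Rmax_right, (sg_0 TL HL) by lra).
  rewrite !Hue, Hu1e in H1 by lra.
  eapply Rle_trans; [|apply Rle_trans with (1 := Rplus_le_compat _ _ _ _ H1 H2); lra].
  eapply Rle_trans; [|apply norm_triangle]. right. f_equal.
  rewrite E0. unfold coupling, response, coupling_source. vmod.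
Qed.

Lemma coupling_small (e e1 : X) : smooth e e1 -> forall eps, 0 < eps ->
  exists d, 0 < d /\ forall h, 0 <= h < d -> norm (coupling h e e1) < eps.
Proof.
  intros Hs eps He.
  destruct (coupling_derivative e e1 Hs 1 Rlt_0_1) as [d1 [Hd1 H1]].
  destruct (sg_right_limit TK HK (E (kappa e)) (eps / 2)) as [d2 [Hd2 H2]]; [lra|].
  set (N := norm (G (kappa e)) + 1).
  assert (HN : 0 < N) by (unfold N; pose proof (norm_ge_0 (G (kappa e))); lra).
  exists (Rmin d1 (Rmin d2 (eps / (2 * N)))).
  assert (0 < eps / (2 * N)) by (apply Rdiv_lt_0_compat; lra).
  split; [repeat apply Rmin_glb_lt; lra|]. intros h Hh.
  pose proof (Rmin_l d1 (Rmin d2 (eps / (2 * N)))). pose proof (Rmin_r d1 (Rmin d2 (eps / (2 * N)))).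
  pose proof (Rmin_l d2 (eps / (2 * N))). pose proof (Rmin_r d2 (eps / (2 * N))).
  destruct (Req_dec h 0) as [->|Hne]; [rewrite coupling_0, norm_zero; exact He|].
  specialize (H1 h ltac:(lra)). specialize (H2 h ltac:(lra)).
  set (a := minus (TK h (E (kappa e))) (E (kappa e))) in *.
  apply Rle_lt_trans with (norm (plus (minus (minus (plus a (coupling h e e1)) (scal (ofR h) (G (kappa e)))) a)
      (rscal h (G (kappa e))))); [right; f_equal; vmod|].
  eapply Rle_lt_trans; [apply norm_triangle|].
  eapply Rle_lt_trans; [apply Rplus_le_compat_r, norm_minus_le|].
  rewrite norm_rscal, Rabs_pos_eq by lra.
  assert (h * N < eps / (2 * N) * N) by (apply Rmult_lt_compat_r; lra).
  replace (eps / (2 * N) * N) with (eps / 2) in * by (field; lra).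
  unfold N in *. lra.
Qed.

(** ** The coupling operators on the whole space *)

Lemma smooth_dense (x : X) eps : 0 < eps -> exists e e1 : X, smooth e e1 /\ norm (minus e x) < eps.
Proof.
  intros He. destruct (gdom_dense hX TL HL 3 x eps He) as [e [[e1 [H1 H2]] H]].
  now exists e, e1.
Qed.

Lemma linear_eq_of_smooth (A B : X -> X) : is_linear A -> is_linear B ->
  (forall e e1, smooth e e1 -> A e = B e) -> forall x, A x = B x.
Proof.
  intros HA HB HAB x. apply eq_of_norm_small. intros eps He.
  destruct (linear_norm A HA) as [M [HM HAM]]. destruct (linear_norm B HB) as [N [HN HBN]].
  destruct (smooth_dense x (eps / (M + N))) as [e [e1 [Hs H]]]; [apply Rdiv_lt_0_compat; lra|].
  eapply Rle_trans; [apply (norm_minus_triangle _ (A e))|].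
  rewrite (HAB e e1 Hs) at 2. rewrite (norm_minus_sym (A x)).
  rewrite <- (linear_sub A), <- (linear_sub B) by assumption.
  specialize (HAM (minus e x)). specialize (HBN (minus e x)).
  assert ((M + N) * norm (minus e x) <= (M + N) * (eps / (M + N))) by (apply Rmult_le_compat_l; lra).
  replace ((M + N) * (eps / (M + N))) with eps in * by (field; lra). lra.
Qed.

(** The smooth initial errors are dense, and the bounds on [coupling] do not
    see their derivatives. *)
Theorem coupling_operators : exists Gam : R -> X -> X,
  (forall t, 0 <= t -> is_linear (Gam t)) /\
  locally_bounded Gam /\
  (forall t e e1, 0 <= t -> smooth e e1 -> Gam t e = coupling t e e1) /\
  (forall t s x, 0 <= t -> 0 <= s -> Gam (t + s) x = plus (TK t (Gam s x)) (Gam t (TL s x))) /\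
  (forall (x : X) eps, 0 < eps -> exists d, 0 < d /\ forall h, 0 <= h < d -> norm (Gam h x) < eps).
Proof.
  set (graph := fun t (e x : X) => exists e1, smooth e e1 /\ x = coupling t e e1).
  assert (Hex : forall t, exists T : X -> X, 0 <= t ->
    is_linear T /\ (forall e e1, smooth e e1 -> T e = coupling t e e1) /\
    forall C, (forall e e1, smooth e e1 -> norm (coupling t e e1) <= C * norm e) -> 0 <= C ->
      forall x, norm (T x) <= C * norm x).
  { intros t. destruct (Rle_lt_dec 0 t) as [Ht|Ht].
    2: { exists (fun x => x). lra. }
    destruct (coupling_bound t) as [C0 [HC0 Hb0]].
    assert (Hgplus : forall x x' y y' : X, graph t x y -> graph t x' y' -> graph t (plus x x') (plus y y')).
    { intros x x' y y' [x1 [Hx ->]] [x1' [Hx' ->]]. exists (plus x1 x1').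
      split; [now apply smooth_plus|]. symmetry. now apply coupling_plus. }
    assert (Hgscal : forall (k : F) (x y : X), graph t x y -> graph t (scal k x) (scal k y)).
    { intros k x y [x1 [Hx ->]]. exists (scal k x1).
      split; [now apply smooth_scal|]. symmetry. now apply coupling_scal. }
    assert (Hgdense : forall (x : X) eps, 0 < eps -> exists x' y' : X, graph t x' y' /\ norm (minus x' x) < eps).
    { intros x eps He. destruct (smooth_dense x eps He) as [e [e1 [Hs H]]].
      exists e, (coupling t e e1). split; [now exists e1|exact H]. }
    destruct (dense_extension (graph t) hX C0) as [T [HT1 [HT2 [HT3 HT4]]]]; try assumption; try lra.
    { intros x y [x1 [Hx ->]]. apply Hb0; [lra|exact Hx]. }
    exists T. intros _. split; [exact HT1|]. split.
    { intros e e1 Hs. apply HT3. now exists e1. }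
    intros C HC HC' x. apply le_epsilon. intros eps He.
    destruct (HT4 x (eps / (C + 1))) as [x' [y' [[x1 [Hx ->]] [Hn1 Hn2]]]]; [apply Rdiv_lt_0_compat; lra|].
    specialize (HC x' x1 Hx).
    pose proof (norm_le_minus (T x) (coupling t x' x1)) as B1. rewrite norm_minus_sym in B1.
    pose proof (norm_le_minus x' x) as B2. set (d := eps / (C + 1)) in *.
    assert (eps = (C + 1) * d) by (unfold d; field; lra). nra. }
  apply functional_choice in Hex. destruct Hex as [Gam HGam].
  assert (Hlin : forall t, 0 <= t -> is_linear (Gam t)) by (intros t Ht; apply (HGam t Ht)).
  assert (Hbd : locally_bounded Gam).
  { intros c. destruct (coupling_bound c) as [C [HC Hb]]. exists C. split; [exact HC|].
    intros t x Ht. apply (HGam t (proj1 Ht)); [|lra]. intros e e1. now apply Hb. }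
  assert (Hval : forall t e e1, 0 <= t -> smooth e e1 -> Gam t e = coupling t e e1).
  { intros t e e1 Ht. now apply HGam. }
  exists Gam. split; [exact Hlin|]. split; [exact Hbd|]. split; [exact Hval|]. split.
  - intros t s x Ht Hs.
    apply (linear_eq_of_smooth (Gam (t + s)) (fun x => plus (TK t (Gam s x)) (Gam t (TL s x)))).
    + apply Hlin. lra.
    + apply is_linear_sum.
      * apply (is_linear_comp (Gam s) (TK t)); [now apply Hlin|now apply (sg_linear TK HK)].
      * apply (is_linear_comp (TL s) (Gam t)); [now apply (sg_linear TL HL)|now apply Hlin].
    + intros e e1 Hsm. rewrite (Hval (t + s) e e1), (Hval s e e1) by (assumption || lra).
      rewrite (Hval t (TL s e) (TL s e1)) by (assumption || now apply smooth_orbit).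
      now apply coupling_law.
  - intros x eps He. destruct (Hbd 1) as [C [HC HCb]].
    destruct (smooth_dense x (eps / (2 * C))) as [e [e1 [Hs H]]]; [apply Rdiv_lt_0_compat; lra|].
    destruct (coupling_small e e1 Hs (eps / 2)) as [d [Hd Hd']]; [lra|].
    exists (Rmin 1 d). split; [apply Rmin_glb_lt; lra|]. intros h Hh.
    pose proof (Rmin_l 1 d). pose proof (Rmin_r 1 d).
    specialize (Hd' h ltac:(lra)). rewrite <- Hval in Hd' by (assumption || lra).
    eapply Rle_lt_trans; [apply (norm_le_minus _ (Gam h e))|].
    rewrite norm_minus_sym, <- (linear_sub (Gam h)) by (apply Hlin; lra).
    specialize (HCb h (minus e x) ltac:(lra)).
    assert (C * norm (minus e x) < C * (eps / (2 * C))) by (apply Rmult_lt_compat_l; lra).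
    replace (C * (eps / (2 * C))) with (eps / 2) in * by (field; lra). lra.
Qed.

End Coupling.

(** * The triangular semigroup *)

Lemma exp_mono x y : x <= y -> exp x <= exp y.
Proof. intros [H|H]; [left; now apply exp_increasing|right; now rewrite H]. Qed.

Section ProductNorm.
Context {F : scalar_field} {X Y : NormedModule F}.

Lemma norm_fst_le (z : prod_NormedModule F X Y) : norm (fst z) <= norm z.
Proof.
  change (norm (fst z) <= sqrt (norm (fst z) ^ 2 + norm (snd z) ^ 2)).
  pose proof (norm_ge_0 (fst z)). rewrite <- (sqrt_pow2 (norm (fst z))) at 1 by assumption.
  apply sqrt_le_1_alt. pose proof (pow2_ge_0 (norm (snd z))). lra.
Qed.

Lemma norm_snd_le (z : prod_NormedModule F X Y) : norm (snd z) <= norm z.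
Proof.
  change (norm (snd z) <= sqrt (norm (fst z) ^ 2 + norm (snd z) ^ 2)).
  pose proof (norm_ge_0 (snd z)). rewrite <- (sqrt_pow2 (norm (snd z))) at 1 by assumption.
  apply sqrt_le_1_alt. pose proof (pow2_ge_0 (norm (fst z))). lra.
Qed.

Lemma norm_pair_le (x : X) (y : Y) : norm ((x, y) : prod_NormedModule F X Y) <= norm x + norm y.
Proof.
  change (sqrt (norm x ^ 2 + norm y ^ 2) <= norm x + norm y).
  pose proof (norm_ge_0 x). pose proof (norm_ge_0 y).
  rewrite <- (sqrt_pow2 (norm x + norm y)) by lra. apply sqrt_le_1_alt. nra.
Qed.

End ProductNorm.

(** Averages of orbits approximate in the graph norm, and averaging commutes
    with the generator. *)
Lemma graph_dense {F : scalar_field} {X : NormedModule F} (hX : is_complete X) (T : R -> X -> X)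
  (HT : C0_semigroup T) n : forall (x y : X) eps, generator T x y -> 0 < eps ->
  exists x' y' : X, generator T x' y' /\ gdom T n y' /\ norm (minus x' x) < eps /\ norm (minus y' y) < eps.
Proof.
  induction n as [|n IH]; intros x y eps Hg He.
  - exists x, y. rewrite !minus_self, !norm_zero. repeat split; assumption.
  - destruct (IH x y (eps / 2) Hg) as [x' [y' [Hg' [Hd [Hx Hy]]]]]; [lra|].
    assert (Hmean : forall v : X, exists d, 0 < d /\ forall h, 0 < h < d ->
      norm (minus (scal (ofR (/ h)) (conv T (fun _ => v) h)) v) <= eps / 2).
    { intros v. destruct (conv_small hX T HT (fun _ => v) (cont_const v) (eps / 2)) as [d [Hd0 H]]; [lra|].
      exists d. split; [exact Hd0|]. intros h Hh. specialize (H h Hh).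
      assert (Hih : 0 < / h) by (apply Rinv_0_lt_compat; lra).
      apply Rle_trans with (norm (rscal (/ h) (minus (conv T (fun _ => v) h) (scal (ofR h) v)))); [right; f_equal; vmod|].
      rewrite norm_rscal, Rabs_pos_eq by lra.
      apply Rle_trans with (/ h * (eps / 2 * h)); [apply Rmult_le_compat_l; lra|].
      right. field. lra. }
    destruct (Hmean x') as [d1 [Hd1 H1]]. destruct (Hmean y') as [d2 [Hd2 H2]].
    set (h := Rmin d1 d2 / 2).
    pose proof (Rmin_l d1 d2). pose proof (Rmin_r d1 d2).
    assert (Hh : 0 < Rmin d1 d2) by now apply Rmin_glb_lt.
    specialize (H1 h ltac:(unfold h; lra)). specialize (H2 h ltac:(unfold h; lra)).
    exists (scal (ofR (/ h)) (conv T (fun _ => x') h)), (scal (ofR (/ h)) (conv T (fun _ => y') h)).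
    repeat split.
    + apply (generator_scal T HT).
      apply (generator_linear_image T (fun v => conv T (fun _ => v) h)); [| |exact Hg'].
      * apply (mean_linear hX T HT). unfold h; lra.
      * intros k Hk. now apply (mean_comm hX T HT).
    + apply (gdom_scal T HT), (gdom_mean hX T HT); [unfold h; lra|exact Hd].
    + eapply Rle_lt_trans; [apply (norm_minus_triangle _ x')|]. apply Rlt_le_trans with (eps / 2 + eps / 2); [exact (Rplus_le_lt_compat _ _ _ _ H1 Hx)|lra].
    + eapply Rle_lt_trans; [apply (norm_minus_triangle _ y')|]. apply Rlt_le_trans with (eps / 2 + eps / 2); [exact (Rplus_le_lt_compat _ _ _ _ H2 Hy)|lra].
Qed.

Section Triangular.
Context {F : scalar_field} {X U : NormedModule F}.
Hypothesis hX : is_complete X.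
Variables TK TL Gam : R -> X -> X.
Hypothesis HK : C0_semigroup TK.
Hypothesis HL : C0_semigroup TL.
Hypothesis Gam_linear : forall t, 0 <= t -> is_linear (Gam t).
Hypothesis Gam_bounded : locally_bounded Gam.
Hypothesis Gam_law : forall t s x, 0 <= t -> 0 <= s ->
  Gam (t + s) x = plus (TK t (Gam s x)) (Gam t (TL s x)).
Hypothesis Gam_small : forall (x : X) eps, 0 < eps ->
  exists d, 0 < d /\ forall h, 0 <= h < d -> norm (Gam h x) < eps.

Let XX := prod_NormedModule F X X.
Let BK : locally_bounded TK := C0_semigroup_locally_bounded TK HK hX.
Let BL : locally_bounded TL := C0_semigroup_locally_bounded TL HL hX.

Definition triangular (t : R) (z : XX) : XX :=
  (plus (TK t (fst z)) (Gam t (snd z)), TL t (snd z)).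

Lemma norm_triangular_le t (z : XX) M1 M2 M3 : 0 <= M1 -> 0 <= M2 -> 0 <= M3 ->
  norm (TK t (fst z)) <= M1 * norm (fst z) -> norm (TL t (snd z)) <= M2 * norm (snd z) ->
  norm (Gam t (snd z)) <= M3 * norm (snd z) -> norm (triangular t z) <= (M1 + M2 + M3) * norm z.
Proof.
  intros P1 P2 P3 H1 H2 H3.
  apply Rle_trans with (M1 * norm (fst z) + M3 * norm (snd z) + M2 * norm (snd z)).
  - eapply Rle_trans; [apply norm_pair_le|]. apply Rplus_le_compat; [|exact H2].
    eapply Rle_trans; [apply norm_triangle|]. now apply Rplus_le_compat.
  - pose proof (Rmult_le_compat_l M1 _ _ P1 (norm_fst_le z)).
    pose proof (Rmult_le_compat_l M2 _ _ P2 (norm_snd_le z)).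
    pose proof (Rmult_le_compat_l M3 _ _ P3 (norm_snd_le z)).
    replace ((M1 + M2 + M3) * norm z) with (M1 * norm z + M3 * norm z + M2 * norm z) by ring.
    repeat apply Rplus_le_compat; assumption.
Qed.

Lemma triangular_bounded : locally_bounded triangular.
Proof.
  intros c. destruct (BK c) as [M1 [HM1 H1]]. destruct (BL c) as [M2 [HM2 H2]].
  destruct (Gam_bounded c) as [M3 [HM3 H3]].
  exists (M1 + M2 + M3). split; [lra|]. intros t z Ht.
  apply (norm_triangular_le t z M1 M2 M3); try lra; [apply H1|apply H2|apply H3]; exact Ht.
Qed.

Lemma Gam_0 x : Gam 0 x = zero.
Proof.
  apply eq_of_norm_small. intros eps He. rewrite minus_zero.
  destruct (Gam_small x eps He) as [d [Hd H]]. left. apply H. lra.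
Qed.

Lemma triangular_C0 : C0_semigroup triangular.
Proof.
  split; [|split; [|split]].
  - intros t Ht. constructor.
    + intros z z'. unfold triangular. apply injective_projections; simpl.
      * rewrite (linear_plus (TK t)), (linear_plus (Gam t)) by (now apply Gam_linear || now apply (sg_linear TK HK)).
        vmod.
      * apply (linear_plus (TL t)). now apply (sg_linear TL HL).
    + intros k z. unfold triangular. apply injective_projections; simpl.
      * rewrite (linear_scal (TK t)), (linear_scal (Gam t)) by (now apply Gam_linear || now apply (sg_linear TK HK)).
        symmetry. exact (linear_plus _ (is_linear_scalar k) _ _).
      * apply (linear_scal (TL t)). now apply (sg_linear TL HL).
    + destruct (triangular_bounded t) as [M [HM H]]. exists M. split; [exact HM|].
      intros z. apply H. lra.
  - intros [x e]. unfold triangular; simpl.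
    rewrite (sg_0 TK HK), (sg_0 TL HL), Gam_0. f_equal. apply plus_zero_r.
  - intros s t [x e] Hs Ht. unfold triangular; simpl.
    rewrite (sg_add TK HK), (sg_add TL HL), Gam_law by assumption. f_equal.
    rewrite (linear_plus (TK s)) by now apply (sg_linear TK HK). vmod.
  - intros z. apply (limP (at_right 0) (fun t => triangular t z) z). intros eps He.
    apply at_right0_P.
    destruct (sg_right_limit TK HK (fst z) (eps / 3)) as [d1 [Hd1 H1]]; [lra|].
    destruct (sg_right_limit TL HL (snd z) (eps / 3)) as [d2 [Hd2 H2]]; [lra|].
    destruct (Gam_small (snd z) (eps / 3)) as [d3 [Hd3 H3]]; [lra|].
    exists (Rmin d1 (Rmin d2 d3)). split; [repeat apply Rmin_glb_lt; lra|]. intros h Hh.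
    pose proof (Rmin_l d1 (Rmin d2 d3)). pose proof (Rmin_r d1 (Rmin d2 d3)).
    pose proof (Rmin_l d2 d3). pose proof (Rmin_r d2 d3).
    specialize (H1 h ltac:(lra)). specialize (H2 h ltac:(lra)). specialize (H3 h ltac:(lra)).
    apply Rle_lt_trans with (norm ((plus (minus (TK h (fst z)) (fst z)) (Gam h (snd z)),
       minus (TL h (snd z)) (snd z)) : XX)).
    { right. f_equal. apply injective_projections; simpl; [|reflexivity].
      change (minus (plus (TK h (fst z)) (Gam h (snd z))) (fst z) =
        plus (minus (TK h (fst z)) (fst z)) (Gam h (snd z))). vmod. }
    eapply Rle_lt_trans; [apply norm_pair_le|].
    eapply Rle_lt_trans; [apply Rplus_le_compat_r, norm_triangle|]. lra.
Qed.

(** ** Its generator *)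

Variables E G : U -> X.
Hypothesis hE : is_linear E.
Hypothesis hG : is_linear G.
Variable kappa : X -> U.
Hypothesis kappa_minus : forall x x' y y', generator TL x y -> generator TL x' y' ->
  kappa (minus x x') = minus (kappa x) (kappa x').
Hypothesis kappa_bound : exists C, 0 < C /\ forall x y : X, generator TL x y ->
  norm (kappa x) <= C * (norm x + norm y).
Hypothesis Gam_derivative : forall e e1 : X, smooth TL e e1 -> forall eps, 0 < eps ->
  exists d, 0 < d /\ forall h, 0 < h < d ->
  norm (minus (plus (minus (TK h (E (kappa e))) (E (kappa e))) (Gam h e))
              (scal (ofR h) (G (kappa e)))) <= eps * h.

Lemma triangular_generator_smooth (x y e e1 : X) : smooth TL e e1 ->
  generator TK (minus x (E (kappa e))) (minus y (G (kappa e))) ->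
  generator triangular ((x, e) : XX) ((y, e1) : XX).
Proof.
  intros Hs Hg. apply (generatorP (V := XX)). intros eps He.
  destruct (Gam_derivative e e1 Hs (eps / 3)) as [d1 [Hd1 H1]]; [lra|].
  destruct (proj1 (generatorP TK _ _) Hg (eps / 3)) as [d2 [Hd2 H2]]; [lra|].
  destruct (proj1 (generatorP TL _ _) (proj1 Hs) (eps / 3)) as [d3 [Hd3 H3]]; [lra|].
  exists (Rmin d1 (Rmin d2 d3)). split; [repeat apply Rmin_glb_lt; lra|]. intros h Hh.
  pose proof (Rmin_l d1 (Rmin d2 d3)). pose proof (Rmin_r d1 (Rmin d2 d3)).
  pose proof (Rmin_l d2 d3). pose proof (Rmin_r d2 d3).
  specialize (H1 h ltac:(lra)). specialize (H2 h ltac:(lra)). specialize (H3 h ltac:(lra)).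
  rewrite (linear_sub (TK h)) in H2 by (apply (sg_linear TK HK); lra).
  eapply Rle_trans; [|apply Rle_trans with (1 := Rplus_le_compat _ _ _ _ (Rplus_le_compat _ _ _ _ H1 H2) H3); lra].
  eapply Rle_trans; [|apply Rplus_le_compat_r, norm_triangle].
  eapply Rle_trans; [|apply norm_pair_le]. right. f_equal.
  apply injective_projections; simpl; [|reflexivity].
  change (minus (minus (plus (TK h x) (Gam h e)) x) (scal (ofR h) y) =
    plus (minus (plus (minus (TK h (E (kappa e))) (E (kappa e))) (Gam h e)) (scal (ofR h) (G (kappa e))))
     (minus (minus (minus (TK h x) (TK h (E (kappa e)))) (minus x (E (kappa e))))
       (scal (ofR h) (minus y (G (kappa e)))))).
  vmod.
Qed.

(** For smooth errors the orbit is expanded directly; the general case follows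
    since the generator is closed and the smooth errors are dense in the graph
    norm.  Conversely, [(E (kappa e), e)] lies in the domain for every [e] in
    the domain of the generator of [TL], and subtracting it leaves a vector
    with second component zero, on which the semigroup acts by [TK] alone. *)
Theorem triangular_generator (x y e e1 : X) :
  generator triangular ((x, e) : XX) ((y, e1) : XX) <->
  generator TL e e1 /\ generator TK (minus x (E (kappa e))) (minus y (G (kappa e))).
Proof.
  assert (Hif : forall x y e e1 : X,
    generator TL e e1 -> generator TK (minus x (E (kappa e))) (minus y (G (kappa e))) ->
    generator triangular ((x, e) : XX) ((y, e1) : XX)).
  { clear x y e e1. intros x y e e1 HgL HgK.
    apply (generator_closed triangular triangular_C0 triangular_bounded). intros eps He.
    destruct kappa_bound as [C [HC HCb]].
    destruct (linear_norm E hE) as [ME [HME HEb]]. destruct (linear_norm G hG) as [MG [HMG HGb]].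
    set (D := 1 + 2 * C * (ME + MG)).
    assert (HD : 0 < 2 * C * (ME + MG)) by (apply Rmult_lt_0_compat; lra).
    assert (Hed : 0 < eps / D) by (apply Rdiv_lt_0_compat; unfold D; lra).
    destruct (graph_dense hX TL HL 2 e e1 (eps / D) HgL Hed) as [e' [e1' [Hg' [Hd' [Hn1 Hn2]]]]].
    exists (plus x (E (minus (kappa e') (kappa e))), e'), (plus y (G (minus (kappa e') (kappa e))), e1').
    rewrite <- (kappa_minus e' e e1' e1) by assumption.
    pose proof (HCb _ _ (generator_minus TL HL _ _ _ _ Hg' HgL)) as Hk.
    set (d := eps / D) in *. assert (Ed : eps = D * d) by (unfold d; field; unfold D; lra). clearbody d.
    assert (Hk2 : norm (kappa (minus e' e)) <= 2 * C * d) by nra.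
    repeat split.
    - apply triangular_generator_smooth; [now split|].
      rewrite (kappa_minus e' e e1' e1), (linear_sub E), (linear_sub G) by assumption.
      apply (generator_eq TK _ _ _ _ HgK); vmod.
    - apply Rle_lt_trans with (norm ((E (kappa (minus e' e)), minus e' e) : XX)).
      { right. f_equal. apply injective_projections; simpl; [|reflexivity].
        change (minus (plus x (E (kappa (minus e' e)))) x = E (kappa (minus e' e))). vmod. }
      eapply Rle_lt_trans; [apply norm_pair_le|]. specialize (HEb (kappa (minus e' e))).
      assert (ME * norm (kappa (minus e' e)) <= ME * (2 * C * d)) by (apply Rmult_le_compat_l; lra).
      assert (0 < MG * (2 * C * d)) by (repeat apply Rmult_lt_0_compat; lra).
      unfold D in Ed. lra.
    - apply Rle_lt_trans with (norm ((G (kappa (minus e' e)), minus e1' e1) : XX)).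
      { right. f_equal. apply injective_projections; simpl; [|reflexivity].
        change (minus (plus y (G (kappa (minus e' e)))) y = G (kappa (minus e' e))). vmod. }
      eapply Rle_lt_trans; [apply norm_pair_le|]. specialize (HGb (kappa (minus e' e))).
      assert (MG * norm (kappa (minus e' e)) <= MG * (2 * C * d)) by (apply Rmult_le_compat_l; lra).
      assert (0 < ME * (2 * C * d)) by (repeat apply Rmult_lt_0_compat; lra).
      unfold D in Ed. lra. }
  split; [|intros [H1 H2]; now apply Hif].
  intros H.
  assert (HgL : generator TL e e1).
  { apply generatorP. intros eps He.
    destruct (proj1 (generatorP (V := XX) triangular _ _) H eps He) as [d [Hd H']].
    exists d. split; [exact Hd|]. intros h Hh. specialize (H' h Hh).
    eapply Rle_trans; [|exact H'].
    exact (norm_snd_le (minus (minus (triangular h (x, e)) (x, e)) (scal (ofR h) ((y, e1) : XX)))). }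
  split; [exact HgL|].
  assert (H0 : generator triangular ((E (kappa e), e) : XX) ((G (kappa e), e1) : XX)).
  { apply Hif; [exact HgL|]. rewrite !minus_self.
    apply generatorP. intros eps He. exists 1. split; [lra|]. intros h Hh.
    apply Rle_trans with (norm (zero : X)); [|rewrite norm_zero; apply Rmult_le_pos; lra].
    right. f_equal. rewrite (linear_0 (TK h)) by (apply (sg_linear TK HK); lra). vmod. }
  pose proof (generator_minus triangular triangular_C0 _ _ _ _ H H0) as Hd.
  apply generatorP. intros eps He.
  destruct (proj1 (generatorP (V := XX) triangular _ _) Hd eps He) as [d [Hd0 H']].
  exists d. split; [exact Hd0|]. intros h Hh. specialize (H' h Hh).
  eapply Rle_trans; [|exact H'].
  eapply Rle_trans; [|apply norm_fst_le]. right. f_equal. simpl.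
  change (minus (minus (TK h (minus x (E (kappa e)))) (minus x (E (kappa e)))) (scal (ofR h) (minus y (G (kappa e)))) =
    minus (minus (plus (TK h (minus x (E (kappa e)))) (Gam h (minus e e))) (minus x (E (kappa e)))) (scal (ofR h) (minus y (G (kappa e))))).
  rewrite minus_self, (linear_0 (Gam h)) by (apply Gam_linear; lra). vmod.
Qed.

(** ** Growth of the coupling operators *)

(** With [a <> b], the sequence [(exp (a n) - exp (b n)) / (exp a - exp b)]
    solves the recursion produced by the composition law of [Gam]: it is the
    discrete convolution of the two exponentials. *)
Lemma coupling_growth a b MK ML : a <> b -> 0 <= MK -> 0 <= ML ->
  (forall t x, 0 <= t -> norm (TK t x) <= MK * exp (a * t) * norm x) ->
  (forall t x, 0 <= t -> norm (TL t x) <= ML * exp (b * t) * norm x) ->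
  exists K, 0 <= K /\ forall t x, 0 <= t -> norm (Gam t x) <= K * exp (Rmax a b * t) * norm x.
Proof.
  intros Hab HMK HML HTK HTL.
  destruct (Gam_bounded 1) as [C [HC HCb]].
  set (D := exp a - exp b).
  assert (HD : D <> 0).
  { unfold D. intros H0. apply Hab. apply exp_inv. lra. }
  set (sig := fun n : nat => (exp (a * INR n) - exp (b * INR n)) / D).
  set (K0 := MK * C * ML). assert (HK0 : 0 <= K0) by (unfold K0; repeat apply Rmult_le_pos; lra).
  assert (Hrec : forall n (s : R) x, 0 <= s ->
    norm (TK s (Gam (INR n) x)) <= K0 * exp (a * s) * sig n * norm x).
  { induction n as [|n IH]; intros s x Hs.
    - simpl. rewrite Gam_0, (linear_0 (TK s)), norm_zero by now apply (sg_linear TK HK).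
      unfold sig. simpl. rewrite !Rmult_0_r. right. field. exact HD.
    - assert (Esig : sig (S n) = exp a * sig n + exp (b * INR n)).
      { unfold sig. rewrite S_INR, !Rmult_plus_distr_l, !Rmult_1_r, !exp_plus. unfold D in *. field. exact HD. }
      rewrite S_INR, Rplus_comm, Gam_law by (lra || apply pos_INR).
      rewrite (linear_plus (TK s)), <- (sg_add TK HK) by (now apply (sg_linear TK HK) || lra).
      eapply Rle_trans; [apply norm_triangle|].
      specialize (IH (s + 1) x ltac:(lra)).
      pose proof (pos_INR n) as Hn. pose proof (exp_pos (a * s)) as Hea. pose proof (exp_pos (b * INR n)) as Heb.
      pose proof (norm_ge_0 x) as Hx.
      assert (B2 : norm (TK s (Gam 1 (TL (INR n) x))) <= K0 * exp (a * s) * exp (b * INR n) * norm x).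
      { eapply Rle_trans; [now apply HTK|].
        replace (K0 * exp (a * s) * exp (b * INR n) * norm x) with
          (MK * exp (a * s) * (C * (ML * exp (b * INR n) * norm x))) by (unfold K0; ring).
        apply Rmult_le_compat_l; [apply Rmult_le_pos; lra|].
        eapply Rle_trans; [apply HCb; lra|]. apply Rmult_le_compat_l; [lra|]. now apply HTL. }
      rewrite Esig. rewrite Rmult_plus_distr_l, Rmult_1_r, exp_plus in IH.
      apply Rle_trans with (K0 * (exp (a * s) * exp a) * sig n * norm x + K0 * exp (a * s) * exp (b * INR n) * norm x);
        [now apply Rplus_le_compat|]. right. ring. }
  set (m := Rmax a b). pose proof (Rmax_l a b). pose proof (Rmax_r a b). fold m in H, H0.
  assert (Hsig : forall n, sig n <= exp (m * INR n) / Rabs D).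
  { intros n. pose proof (pos_INR n) as Hn.
    assert (exp (a * INR n) <= exp (m * INR n)) by (apply exp_mono, Rmult_le_compat_r; assumption).
    assert (exp (b * INR n) <= exp (m * INR n)) by (apply exp_mono, Rmult_le_compat_r; assumption).
    pose proof (exp_pos (a * INR n)). pose proof (exp_pos (b * INR n)).
    eapply Rle_trans; [apply Rle_abs|]. unfold sig, Rdiv. rewrite Rabs_mult, Rabs_inv.
    apply Rmult_le_compat_r; [left; apply Rinv_0_lt_compat; now apply Rabs_pos_lt|].
    apply Rabs_le. lra. }
  assert (HDp : 0 < Rabs D) by now apply Rabs_pos_lt.
  set (K1 := K0 * exp (Rabs a) / Rabs D + C * ML).
  assert (HK1 : 0 <= K1).
  { unfold K1. apply Rplus_le_le_0_compat; [|apply Rmult_le_pos; lra].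
    apply Rmult_le_pos; [apply Rmult_le_pos; [lra|left; apply exp_pos]|left; now apply Rinv_0_lt_compat]. }
  exists (K1 * exp (Rabs m)). split; [apply Rmult_le_pos; [exact HK1|left; apply exp_pos]|].
  intros t x Ht. destruct (nfloor_ex t Ht) as [n [Hn1 Hn2]].
  set (r := t - INR n). replace t with (r + INR n) by (unfold r; ring).
  pose proof (pos_INR n) as Hn. assert (Hr : 0 <= r <= 1) by (unfold r; lra).
  rewrite Gam_law by lra. eapply Rle_trans; [apply norm_triangle|].
  pose proof (norm_ge_0 x) as Hx.
  assert (Har : exp (a * r) <= exp (Rabs a)).
  { apply exp_mono. pose proof (Rle_abs a). pose proof (Rabs_pos a). nra. }
  assert (Hmr : exp (m * INR n) <= exp (Rabs m) * exp (m * (r + INR n))).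
  { rewrite <- exp_plus. apply exp_mono. pose proof (Rle_abs (- m)) as Hm. rewrite Rabs_Ropp in Hm.
    pose proof (Rabs_pos m). nra. }
  assert (B1 : norm (TK r (Gam (INR n) x)) <= K0 * exp (Rabs a) / Rabs D * exp (m * INR n) * norm x).
  { eapply Rle_trans; [apply Hrec; lra|]. apply Rmult_le_compat_r; [exact Hx|].
    apply Rle_trans with (K0 * exp (a * r) * (exp (m * INR n) / Rabs D)).
    - apply Rmult_le_compat_l; [|apply Hsig]. apply Rmult_le_pos; [exact HK0|left; apply exp_pos].
    - replace (K0 * exp (Rabs a) / Rabs D * exp (m * INR n)) with
        (K0 * exp (Rabs a) * (exp (m * INR n) / Rabs D)) by (field; lra).
      apply Rmult_le_compat_r.
      + apply Rmult_le_pos; [left; apply exp_pos|left; now apply Rinv_0_lt_compat].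
      + now apply Rmult_le_compat_l. }
  assert (B2 : norm (Gam r (TL (INR n) x)) <= C * ML * exp (m * INR n) * norm x).
  { eapply Rle_trans; [now apply HCb|].
    replace (C * ML * exp (m * INR n) * norm x) with (C * (ML * exp (m * INR n) * norm x)) by ring.
    apply Rmult_le_compat_l; [lra|]. eapply Rle_trans; [now apply HTL|].
    apply Rmult_le_compat_r; [exact Hx|]. apply Rmult_le_compat_l; [exact HML|].
    apply exp_mono, Rmult_le_compat_r; assumption. }
  apply Rle_trans with (K1 * exp (m * INR n) * norm x).
  - eapply Rle_trans; [apply (Rplus_le_compat _ _ _ _ B1 B2)|]. right. unfold K1. ring.
  - apply Rmult_le_compat_r; [exact Hx|]. rewrite Rmult_assoc. now apply Rmult_le_compat_l.
Qed.

End Triangular.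

(** * Stability *)

Definition growth_rate {F : scalar_field} {V : NormedModule F} (T : R -> V -> V) (w : R) : Prop :=
  exists M, forall t x, 0 <= t -> norm (T t x) <= M * exp (w * t) * norm x.

Section Growth.
Context {F : scalar_field} {V : NormedModule F}.
Variable T : R -> V -> V.

Lemma growth_rate_pos w : growth_rate T w ->
  exists M, 0 < M /\ forall t x, 0 <= t -> norm (T t x) <= M * exp (w * t) * norm x.
Proof.
  intros [M H]. exists (Rabs M + 1). pose proof (Rabs_pos M). split; [lra|].
  intros t x Ht. eapply Rle_trans; [now apply H|].
  apply Rmult_le_compat_r; [apply norm_ge_0|]. apply Rmult_le_compat_r; [left; apply exp_pos|].
  pose proof (Rle_abs M). lra.
Qed.

Lemma growth_rate_le w w' : w <= w' -> growth_rate T w -> growth_rate T w'.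
Proof.
  intros Hw HT. destruct (growth_rate_pos w HT) as [M [HM H]]. exists M.
  intros t x Ht. eapply Rle_trans; [now apply H|].
  apply Rmult_le_compat_r; [apply norm_ge_0|]. apply Rmult_le_compat_l; [lra|].
  now apply exp_mono, Rmult_le_compat_r.
Qed.

Lemma growth_rate_0 M : (forall t x, 0 <= t -> norm (T t x) <= M * norm x) -> growth_rate T 0.
Proof. intros H. exists M. intros t x Ht. rewrite Rmult_0_l, exp_0, Rmult_1_r. now apply H. Qed.

Lemma growth_rate_0_bounded : growth_rate T 0 ->
  exists M, 0 < M /\ forall t x, 0 <= t -> norm (T t x) <= M * norm x.
Proof.
  intros HT. destruct (growth_rate_pos 0 HT) as [M [HM H]]. exists M. split; [exact HM|].
  intros t x Ht. specialize (H t x Ht). now rewrite Rmult_0_l, exp_0, Rmult_1_r in H.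
Qed.

Lemma exponentially_stable_rate : exponentially_stable T <-> exists w, w < 0 /\ growth_rate T w.
Proof.
  unfold exponentially_stable, growth_bound.
  destruct (Glb_Rbar_correct (growth_rate T)) as [Hlb Hglb]. fold (growth_rate T) in *.
  change (Glb_Rbar (fun w => exists M, forall t x, 0 <= t -> norm (T t x) <= M * exp (w * t) * norm x))
    with (Glb_Rbar (growth_rate T)).
  split.
  - intros H. apply NNPP. intros Hno. apply Rbar_lt_not_le in H. apply H. apply Hglb.
    intros w Hw. simpl. apply Rnot_lt_le. intros Hw0. apply Hno. now exists w.
  - intros [w [Hw H]]. apply Rbar_le_lt_trans with w; [now apply Hlb|exact Hw].
Qed.

End Growth.

(** The strict inequality in the second hypothesis allows for the loss in the
    convolution of two exponentials with equal rates. *)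
Lemma growth_bound_max {F : scalar_field} {V V1 V2 : NormedModule F}
  (T : R -> V -> V) (T1 : R -> V1 -> V1) (T2 : R -> V2 -> V2) :
  (forall w, growth_rate T w -> growth_rate T1 w /\ growth_rate T2 w) ->
  (forall w w', w < w' -> growth_rate T1 w -> growth_rate T2 w -> growth_rate T w') ->
  growth_bound T = Rbar_max (growth_bound T1) (growth_bound T2).
Proof.
  intros Hdown Hup. apply is_glb_Rbar_unique. fold (growth_rate T).
  pose proof (Glb_Rbar_correct (growth_rate T1)) as [Hlb1 Hglb1].
  pose proof (Glb_Rbar_correct (growth_rate T2)) as [Hlb2 Hglb2].
  change (Glb_Rbar (growth_rate T1)) with (growth_bound T1) in *.
  change (Glb_Rbar (growth_rate T2)) with (growth_bound T2) in *.
  set (k := growth_bound T1) in *. set (l := growth_bound T2) in *.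
  assert (Hk : Rbar_le k (Rbar_max k l)).
  { unfold Rbar_max. destruct (Rbar_le_dec k l); [assumption|apply Rbar_le_refl]. }
  assert (Hl : Rbar_le l (Rbar_max k l)).
  { unfold Rbar_max. destruct (Rbar_le_dec k l); [apply Rbar_le_refl|].
    now apply Rbar_lt_le, Rbar_not_le_lt. }
  split.
  - intros w Hw. destruct (Hdown w Hw) as [H1 H2]. unfold Rbar_max.
    destruct (Rbar_le_dec k l); [now apply Hlb2|now apply Hlb1].
  - intros b Hb. apply Rbar_not_lt_le. intros Hlt.
    assert (Hex : forall (P : R -> Prop) (m : Rbar), (forall b, is_lb_Rbar P b -> Rbar_le b m) ->
      Rbar_lt m b -> exists w, P w /\ Rbar_lt w b).
    { intros P m Hm Hmb. apply NNPP. intros Hno. apply Rbar_lt_not_le in Hmb. apply Hmb. apply Hm.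
      intros w Hw. apply Rbar_not_lt_le. intros Hwb. apply Hno. now exists w. }
    destruct (Hex _ _ Hglb1 (Rbar_le_lt_trans _ _ _ Hk Hlt)) as [w1 [H1 Hb1]].
    destruct (Hex _ _ Hglb2 (Rbar_le_lt_trans _ _ _ Hl Hlt)) as [w2 [H2 Hb2]].
    assert (Hw : exists w', Rmax w1 w2 < w' /\ Rbar_lt w' b).
    { destruct b as [b| |]; simpl in Hb1, Hb2.
      - exists ((Rmax w1 w2 + b) / 2). assert (Rmax w1 w2 < b) by now apply Rmax_lub_lt. simpl. lra.
      - exists (Rmax w1 w2 + 1). simpl. split; [lra|exact I].
      - contradiction. }
    destruct Hw as [w' [Hw1 Hw2]].
    apply (Rbar_lt_not_le _ _ Hw2). apply Hb.
    apply (Hup (Rmax w1 w2)); [exact Hw1| |].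
    + apply (growth_rate_le T1 w1); [apply Rmax_l|exact H1].
    + apply (growth_rate_le T2 w2); [apply Rmax_r|exact H2].
Qed.

Section Decay.
Context {F : scalar_field} {V : NormedModule F}.
Variable T : R -> V -> V.

Lemma lim_infty_P (f : R -> V) (l : V) : filterlim f (Rbar_locally p_infty) (locally l) <->
  forall eps, 0 < eps -> exists N, forall t, N < t -> norm (minus (f t) l) < eps.
Proof. exact (limP (Rbar_locally p_infty) f l). Qed.

Lemma exp_rate_small w : w < 0 -> forall eps, 0 < eps -> exists N, forall t, N < t -> exp (w * t) < eps.
Proof.
  intros Hw eps He. exists (ln eps / w). intros t Ht. rewrite <- (exp_ln eps He).
  apply exp_increasing. apply (Rmult_lt_gt_compat_neg_l w) in Ht; [|exact Hw].
  replace (w * (ln eps / w)) with (ln eps) in Ht by (field; lra). lra.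
Qed.

Lemma exponentially_strongly_stable : exponentially_stable T -> strongly_stable T.
Proof.
  intros H. apply exponentially_stable_rate in H. destruct H as [w [Hw HT]].
  destruct (growth_rate_pos T w HT) as [M [HM Hb]].
  intros x. apply lim_infty_P. intros eps He. pose proof (norm_ge_0 x) as Hx.
  destruct (exp_rate_small w Hw (eps / (M * (norm x + 1)))) as [N HN].
  { apply Rdiv_lt_0_compat; [lra|]. apply Rmult_lt_0_compat; lra. }
  exists (Rmax N 0). intros t Ht. pose proof (Rmax_l N 0). pose proof (Rmax_r N 0).
  specialize (HN t ltac:(lra)). rewrite minus_zero. eapply Rle_lt_trans; [apply Hb; lra|].
  apply Rle_lt_trans with (exp (w * t) * (M * (norm x + 1))).
  - replace (M * exp (w * t) * norm x) with (exp (w * t) * (M * norm x)) by ring.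
    apply Rmult_le_compat_l; [left; apply exp_pos|]. apply Rmult_le_compat_l; lra.
  - apply Rlt_le_trans with (eps / (M * (norm x + 1)) * (M * (norm x + 1))).
    + apply Rmult_lt_compat_r; [apply Rmult_lt_0_compat; lra|exact HN].
    + right. field. split; lra.
Qed.

(** The uniform boundedness principle, since convergent orbits are bounded. *)
Lemma strongly_stable_bounded (hV : is_complete V) : C0_semigroup T -> strongly_stable T -> growth_rate T 0.
Proof.
  intros HT Hs.
  destruct (uniform_boundedness hV (fun (t : R) x => T (Rmax 0 t) x)) as [C [HC HB]].
  - intros t. apply (sg_linear T HT), Rmax_l.
  - intros x. destruct (proj1 (lim_infty_P _ _) (Hs x) 1 Rlt_0_1) as [N HN].
    destruct (C0_semigroup_locally_bounded T HT hV (Rmax 0 N)) as [M [HM HMb]].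
    exists (Rmax 1 (M * norm x)). intros t.
    destruct (Rle_lt_dec (Rmax 0 t) (Rmax 0 N)) as [Ht|Ht].
    + eapply Rle_trans; [apply HMb; split; [apply Rmax_l|exact Ht]|apply Rmax_r].
    + assert (HN' : N < Rmax 0 t) by (eapply Rle_lt_trans; [apply Rmax_r|exact Ht]).
      specialize (HN _ HN'). rewrite minus_zero in HN. pose proof (Rmax_l 1 (M * norm x)). lra.
  - apply (growth_rate_0 T C). intros t x Ht. specialize (HB t x). simpl in HB.
    now rewrite Rmax_right in HB.
Qed.

(** The decay estimate that distinguishes polynomial stability among bounded
    semigroups. *)
Definition polynomial_decay (alpha : R) : Prop := exists M t0, 0 < M /\ 0 < t0 /\
  forall t x Ax, t0 <= t -> generator T x Ax ->
    norm (T t x) <= M * Rpower t (- alpha) * (norm Ax + norm x).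

Lemma Rpower_pos x y : 0 < Rpower x y.
Proof. apply exp_pos. Qed.

Lemma exp_rate_Rpower w alpha : w < 0 -> 0 < alpha ->
  exists C, 0 < C /\ forall t, 0 < t -> exp (w * t) <= C * Rpower t (- alpha).
Proof.
  intros Hw Ha. set (d := - w / alpha).
  assert (Hd : 0 < d) by (apply Rdiv_lt_0_compat; lra).
  exists (exp (alpha * (- 1 - ln d))). split; [apply exp_pos|]. intros t Ht.
  unfold Rpower. rewrite <- exp_plus. apply exp_mono.
  assert (Hln : ln (d * t) <= d * t - 1).
  { pose proof (exp_ineq1_le (ln (d * t))) as H. rewrite exp_ln in H by now apply Rmult_lt_0_compat. lra. }
  rewrite ln_mult in Hln by assumption.
  assert (alpha * (ln d + ln t) <= alpha * (d * t - 1)) by (apply Rmult_le_compat_l; lra).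
  replace (alpha * (d * t - 1)) with (- w * t - alpha) in * by (unfold d; field; lra). lra.
Qed.

Lemma exponentially_polynomial_decay alpha : 0 < alpha -> exponentially_stable T -> polynomial_decay alpha.
Proof.
  intros Ha H. apply exponentially_stable_rate in H. destruct H as [w [Hw HT]].
  destruct (growth_rate_pos T w HT) as [M [HM Hb]].
  destruct (exp_rate_Rpower w alpha Hw Ha) as [C [HC HCb]].
  exists (M * C), 1. split; [now apply Rmult_lt_0_compat|]. split; [lra|].
  intros t x Ax Ht _. eapply Rle_trans; [apply Hb; lra|].
  pose proof (norm_ge_0 x). pose proof (norm_ge_0 Ax). specialize (HCb t ltac:(lra)).
  pose proof (Rpower_pos t (- alpha)).
  apply Rle_trans with (M * (C * Rpower t (- alpha)) * norm x).
  - apply Rmult_le_compat_r; [assumption|]. apply Rmult_le_compat_l; lra.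
  - rewrite <- !Rmult_assoc. apply Rmult_le_compat_l; [|lra].
    repeat apply Rmult_le_pos; lra.
Qed.

Lemma exponentially_stable_bounded : exponentially_stable T -> growth_rate T 0.
Proof.
  intros H. apply exponentially_stable_rate in H. destruct H as [w [Hw HT]].
  apply (growth_rate_le T w); [lra|exact HT].
Qed.

Lemma polynomially_stable_bounded alpha : polynomially_stable alpha T -> growth_rate T 0.
Proof. intros [[M H] _]. now apply growth_rate_0 with M. Qed.

End Decay.

Section TriangularStability.
Context {F : scalar_field} {X U : NormedModule F}.
Hypothesis hX : is_complete X.
Variables TK TL Gam : R -> X -> X.
Hypothesis HK : C0_semigroup TK.
Hypothesis HL : C0_semigroup TL.
Hypothesis Gam_linear : forall t, 0 <= t -> is_linear (Gam t).
Hypothesis Gam_bounded : locally_bounded Gam.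
Hypothesis Gam_law : forall t s x, 0 <= t -> 0 <= s ->
  Gam (t + s) x = plus (TK t (Gam s x)) (Gam t (TL s x)).
Hypothesis Gam_small : forall (x : X) eps, 0 < eps ->
  exists d, 0 < d /\ forall h, 0 <= h < d -> norm (Gam h x) < eps.

Let XX := prod_NormedModule F X X.
Let S : R -> XX -> XX := triangular TK TL Gam.

Lemma Gam_growth_rate a b : a <> b -> growth_rate TK a -> growth_rate TL b ->
  growth_rate Gam (Rmax a b).
Proof.
  intros Hab HTK HTL.
  destruct (growth_rate_pos TK a HTK) as [MK [HMK HbK]].
  destruct (growth_rate_pos TL b HTL) as [ML [HML HbL]].
  destruct (coupling_growth TK TL Gam HK Gam_bounded Gam_law Gam_small a b MK ML Hab)
    as [K [HK0 HKb]]; try assumption; try lra.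
  now exists K.
Qed.

Lemma triangular_growth_rate w : growth_rate TK w -> growth_rate TL w -> growth_rate Gam w -> growth_rate S w.
Proof.
  intros HTK HTL HG.
  destruct (growth_rate_pos TK w HTK) as [M1 [HM1 H1]].
  destruct (growth_rate_pos TL w HTL) as [M2 [HM2 H2]].
  destruct (growth_rate_pos Gam w HG) as [M3 [HM3 H3]].
  exists (M1 + M2 + M3). intros t z Ht. pose proof (exp_pos (w * t)) as He.
  eapply Rle_trans; [apply (norm_triangular_le TK TL Gam t z (M1 * exp (w * t)) (M2 * exp (w * t)) (M3 * exp (w * t)))|].
  - apply Rmult_le_pos; lra.
  - apply Rmult_le_pos; lra.
  - apply Rmult_le_pos; lra.
  - now apply H1.
  - now apply H2.
  - now apply H3.
  - right. rewrite <- !Rmult_plus_distr_r. reflexivity.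
Qed.

Lemma triangular_growth_bound : growth_bound S = Rbar_max (growth_bound TK) (growth_bound TL).
Proof.
  apply growth_bound_max.
  - intros w HS. destruct (growth_rate_pos S w HS) as [M [HM H]]. split; exists M; intros t x Ht.
    + specialize (H t ((x, zero) : XX) Ht).
      assert (E : norm ((x, zero) : XX) <= norm x).
      { eapply Rle_trans; [apply norm_pair_le|]. rewrite norm_zero. lra. }
      apply Rle_trans with (norm (S t (x, zero))).
      { eapply Rle_trans; [|apply norm_fst_le]. right. f_equal. unfold S, triangular. simpl.
        rewrite (linear_0 (Gam t)) by now apply Gam_linear. symmetry. apply plus_zero_r. }
      eapply Rle_trans; [exact H|]. apply Rmult_le_compat_l; [|exact E].
      apply Rmult_le_pos; [lra|left; apply exp_pos].
    + specialize (H t ((zero, x) : XX) Ht).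
      assert (E : norm ((zero, x) : XX) <= norm x).
      { eapply Rle_trans; [apply norm_pair_le|]. rewrite norm_zero. lra. }
      apply Rle_trans with (norm (S t (zero, x))).
      { eapply Rle_trans; [|apply norm_snd_le]. right. reflexivity. }
      eapply Rle_trans; [exact H|]. apply Rmult_le_compat_l; [|exact E].
      apply Rmult_le_pos; [lra|left; apply exp_pos].
  - intros w w' Hw H1 H2. assert (H1' : growth_rate TK w') by (apply (growth_rate_le TK w); lra || assumption).
    apply triangular_growth_rate; [exact H1'| |].
    + apply (growth_rate_le TL w); lra || assumption.
    + replace w' with (Rmax w' w) by (apply Rmax_left; lra). apply Gam_growth_rate; lra || assumption.
Qed.

(** When one factor is bounded and the other decays exponentially, the
    convolution of the two rates is bounded. *)
Lemma Gam_uniformly_bounded :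
  growth_rate TK 0 /\ exponentially_stable TL \/ exponentially_stable TK /\ growth_rate TL 0 ->
  growth_rate Gam 0.
Proof.
  intros [[H1 H2]|[H1 H2]].
  - apply exponentially_stable_rate in H2. destruct H2 as [w [Hw H2]].
    replace 0 with (Rmax 0 w) by (apply Rmax_left; lra). apply Gam_growth_rate; lra || assumption.
  - apply exponentially_stable_rate in H1. destruct H1 as [w [Hw H1]].
    replace 0 with (Rmax w 0) by (apply Rmax_right; lra). apply Gam_growth_rate; lra || assumption.
Qed.

Lemma triangular_strongly_stable : strongly_stable TK -> strongly_stable TL -> growth_rate Gam 0 ->
  strongly_stable S.
Proof.
  intros H1 H2 HG z.
  destruct (growth_rate_0_bounded Gam HG) as [K [HK0 HKb]].
  destruct z as [x e].
  apply (lim_infty_P (V := XX)). intros eps He.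
  (* The composition law separates a time [s], after which the second
     component is small, from a later time that damps what was produced
     before [s]. *)
  destruct (proj1 (lim_infty_P _ _) (H2 e) (eps / (4 * K))) as [N0 HN0]; [apply Rdiv_lt_0_compat; lra|].
  set (s := Rmax 0 N0 + 1). pose proof (Rmax_l 0 N0). pose proof (Rmax_r 0 N0).
  specialize (HN0 s ltac:(unfold s; lra)). rewrite minus_zero in HN0.
  destruct (proj1 (lim_infty_P _ _) (H1 x) (eps / 4)) as [N1 HN1]; [lra|].
  destruct (proj1 (lim_infty_P _ _) (H1 (Gam s e)) (eps / 4)) as [N2 HN2]; [lra|].
  destruct (proj1 (lim_infty_P _ _) (H2 e) (eps / 4)) as [N3 HN3]; [lra|].
  exists (Rmax (Rmax N1 N3) (Rmax s (N2 + s))). intros t Ht.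
  pose proof (Rmax_l (Rmax N1 N3) (Rmax s (N2 + s))). pose proof (Rmax_r (Rmax N1 N3) (Rmax s (N2 + s))).
  pose proof (Rmax_l N1 N3). pose proof (Rmax_r N1 N3). pose proof (Rmax_l s (N2 + s)). pose proof (Rmax_r s (N2 + s)).
  specialize (HN1 t ltac:(lra)). specialize (HN2 (t - s) ltac:(lra)). specialize (HN3 t ltac:(lra)).
  rewrite minus_zero in HN1, HN2, HN3.
  rewrite (minus_zero (V := XX)).
  eapply Rle_lt_trans; [apply norm_pair_le|]. simpl.
  eapply Rle_lt_trans; [apply Rplus_le_compat_r, norm_triangle|].
  assert (HGt : norm (Gam t e) < eps / 2).
  { replace t with ((t - s) + s) by ring. rewrite Gam_law by (unfold s in *; lra).
    eapply Rle_lt_trans; [apply norm_triangle|].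
    specialize (HKb (t - s) (TL s e) ltac:(lra)).
    assert (K * norm (TL s e) < K * (eps / (4 * K))) by (apply Rmult_lt_compat_l; lra).
    replace (K * (eps / (4 * K))) with (eps / 4) in * by (field; lra). lra. }
  lra.
Qed.

Variables E G : U -> X.
Hypothesis hE : is_linear E.
Hypothesis hG : is_linear G.
Variable kappa : X -> U.
Hypothesis kappa_bound : exists C, 0 < C /\ forall x y : X, generator TL x y ->
  norm (kappa x) <= C * (norm x + norm y).
Hypothesis S_generator : forall x y e e1 : X,
  generator S ((x, e) : XX) ((y, e1) : XX) <->
  generator TL e e1 /\ generator TK (minus x (E (kappa e))) (minus y (G (kappa e))).

(** Damping by [TK], during a time [s], of the first component that an orbit
    in the domain has reached at time [s]. *)
Definition damped_first_component (alpha : R) : Prop := exists C t1, 0 < C /\ 0 < t1 /\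
  forall s x y e e1, t1 <= s -> generator S ((x, e) : XX) ((y, e1) : XX) ->
    norm (TK s (fst (S s (x, e)))) <=
      C * Rpower s (- alpha) * (norm ((y, e1) : XX) + norm ((x, e) : XX)).

Lemma damped_of_exponential alpha : 0 < alpha -> growth_rate S 0 -> exponentially_stable TK ->
  damped_first_component alpha.
Proof.
  intros Ha HS H. apply exponentially_stable_rate in H. destruct H as [w [Hw HTK]].
  destruct (growth_rate_pos TK w HTK) as [M [HM Hb]].
  destruct (growth_rate_0_bounded S HS) as [B [HB HBb]].
  destruct (exp_rate_Rpower w alpha Hw Ha) as [C [HC HCb]].
  exists (M * C * B), 1. split; [repeat apply Rmult_lt_0_compat; lra|]. split; [lra|].
  intros s x y e e1 Hs _. specialize (HCb s ltac:(lra)). pose proof (Rpower_pos s (- alpha)) as Hp.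
  pose proof (norm_ge_0 ((y, e1) : XX)) as Hy. pose proof (norm_ge_0 ((x, e) : XX)) as Hx.
  eapply Rle_trans; [apply Hb; lra|].
  apply Rle_trans with (M * (C * Rpower s (- alpha)) * (B * norm ((x, e) : XX))).
  - apply Rmult_le_compat.
    + apply Rmult_le_pos; [lra|left; apply exp_pos].
    + apply norm_ge_0.
    + apply Rmult_le_compat_l; lra.
    + eapply Rle_trans; [apply norm_fst_le|]. apply (HBb s (x, e)). lra.
  - replace (M * (C * Rpower s (- alpha)) * (B * norm ((x, e) : XX))) with
      (M * C * B * Rpower s (- alpha) * norm ((x, e) : XX)) by ring.
    apply Rmult_le_compat_l; [|lra]. repeat apply Rmult_le_pos; lra.
Qed.

(** The first component need not lie in the domain of the generator of [TK];
    it does so after subtraction of [E (kappa e)], and this term decays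
    exponentially with the error.  The estimate of the remaining part involves
    the rate of change of the orbit, which is bounded. *)
Lemma damped_of_polynomial alpha : 0 < alpha -> C0_semigroup S -> growth_rate S 0 -> growth_rate TK 0 ->
  polynomial_decay TK alpha -> exponentially_stable TL -> damped_first_component alpha.
Proof.
  intros Ha HSC HS HTK0 [M [t0 [HM [Ht0 Hdec]]]] H.
  destruct (growth_rate_0_bounded TK HTK0) as [BK [HBK HBKb]].
  destruct (growth_rate_0_bounded S HS) as [B [HB HBb]].
  apply exponentially_stable_rate in H. destruct H as [w [Hw HTL]].
  destruct (growth_rate_pos TL w HTL) as [ML [HML HbL]].
  destruct (exp_rate_Rpower w alpha Hw Ha) as [C [HC HCb]].
  destruct kappa_bound as [Ck [HCk Hk]].
  destruct (linear_norm E hE) as [ME [HME HEb]]. destruct (linear_norm G hG) as [MG [HMG HGb]].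
  destruct (growth_rate_0_bounded TL (growth_rate_le TL w 0 (Rlt_le _ _ Hw) HTL)) as [BL [HBL HBLb]].
  set (C1 := M * (B + MG * (Ck * BL) + ME * (Ck * BL)) + BK * (ME * (Ck * (ML * C)))).
  assert (P1 : 0 < Ck * BL) by now apply Rmult_lt_0_compat.
  assert (P2 : 0 < MG * (Ck * BL)) by now apply Rmult_lt_0_compat.
  assert (P3 : 0 < ME * (Ck * BL)) by now apply Rmult_lt_0_compat.
  assert (P4 : 0 < BK * (ME * (Ck * (ML * C)))) by (repeat apply Rmult_lt_0_compat; lra).
  assert (P5 : 0 < M * (B + MG * (Ck * BL) + ME * (Ck * BL))) by (apply Rmult_lt_0_compat; lra).
  exists C1, (Rmax t0 1). pose proof (Rmax_l t0 1). pose proof (Rmax_r t0 1).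
  split; [unfold C1; lra|]. split; [lra|]. intros s x y e e1 Hs Hg.
  assert (Hs0 : 0 <= s) by lra.
  set (N := norm ((y, e1) : XX) + norm ((x, e) : XX)).
  assert (HNe : norm e + norm e1 <= N).
  { pose proof (norm_snd_le ((x, e) : XX)) as Q1. pose proof (norm_snd_le ((y, e1) : XX)) as Q2.
    simpl in Q1, Q2. unfold N. rewrite Rplus_comm. now apply Rplus_le_compat. }
  pose proof (proj1 (proj1 (S_generator x y e e1) Hg)) as HgL.
  set (xs := fst (S s (x, e))). set (ys := fst (S s (y, e1))).
  set (es := TL s e). set (es1 := TL s e1).
  assert (Hgs : generator S ((xs, es) : XX) ((ys, es1) : XX)) by exact (generator_orbit S HSC s _ _ Hs0 Hg).
  apply S_generator in Hgs. destruct Hgs as [HgLs HgKs].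
  set (k := kappa es) in *.
  assert (HN0 : 0 <= N) by (pose proof (norm_ge_0 e); pose proof (norm_ge_0 e1); lra).
  assert (Hk1 : norm k <= Ck * BL * N).
  { eapply Rle_trans; [apply (Hk es es1 HgLs)|]. rewrite Rmult_assoc. apply Rmult_le_compat_l; [lra|].
    pose proof (HBLb s e Hs0). pose proof (HBLb s e1 Hs0). unfold es, es1.
    apply Rle_trans with (BL * (norm e + norm e1)); [lra|]. apply Rmult_le_compat_l; lra. }
  assert (Hk2 : norm k <= Ck * (ML * C) * Rpower s (- alpha) * N).
  { eapply Rle_trans; [apply (Hk es es1 HgLs)|].
    replace (Ck * (ML * C) * Rpower s (- alpha) * N) with (Ck * (ML * (C * Rpower s (- alpha)) * N)) by ring.
    apply Rmult_le_compat_l; [lra|].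
    pose proof (HbL s e Hs0). pose proof (HbL s e1 Hs0). unfold es, es1.
    specialize (HCb s ltac:(lra)). pose proof (exp_pos (w * s)).
    apply Rle_trans with (ML * exp (w * s) * (norm e + norm e1)); [lra|].
    apply Rmult_le_compat.
    - apply Rmult_le_pos; lra.
    - pose proof (norm_ge_0 e); pose proof (norm_ge_0 e1); lra.
    - apply Rmult_le_compat_l; lra.
    - exact HNe. }
  assert (Hsum : norm xs + norm ys <= B * N).
  { pose proof (HBb s (x, e) Hs0) as Q1. pose proof (HBb s (y, e1) Hs0) as Q2.
    pose proof (Rle_trans _ _ _ (norm_fst_le (S s (x, e))) Q1) as Q3.
    pose proof (Rle_trans _ _ _ (norm_fst_le (S s (y, e1))) Q2) as Q4.
    unfold N. rewrite Rmult_plus_distr_l, (Rplus_comm (norm xs)). now apply Rplus_le_compat. }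
  pose proof (Hdec s _ _ ltac:(lra) HgKs) as Hd.
  pose proof (Rpower_pos s (- alpha)) as Hp. set (p := Rpower s (- alpha)) in *.
  assert (HEk : norm (E k) <= ME * (Ck * BL * N)).
  { eapply Rle_trans; [apply HEb|]. apply Rmult_le_compat_l; lra. }
  assert (HGk : norm (G k) <= MG * (Ck * BL * N)).
  { eapply Rle_trans; [apply HGb|]. apply Rmult_le_compat_l; lra. }
  assert (HEk2 : norm (TK s (E k)) <= BK * (ME * (Ck * (ML * C) * p * N))).
  { eapply Rle_trans; [now apply HBKb|]. apply Rmult_le_compat_l; [lra|].
    eapply Rle_trans; [apply HEb|]. apply Rmult_le_compat_l; lra. }
  assert (Hd2 : norm (TK s (minus xs (E k))) <= M * p * ((B + MG * (Ck * BL) + ME * (Ck * BL)) * N)).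
  { eapply Rle_trans; [exact Hd|]. apply Rmult_le_compat_l; [apply Rmult_le_pos; lra|].
    pose proof (norm_minus_le ys (G k)). pose proof (norm_minus_le xs (E k)). lra. }
  apply Rle_trans with (norm (plus (TK s (minus xs (E k))) (TK s (E k)))).
  { right. f_equal. rewrite (linear_sub (TK s)) by now apply (sg_linear TK HK). vmod. }
  eapply Rle_trans; [apply norm_triangle|].
  eapply Rle_trans; [apply (Rplus_le_compat _ _ _ _ Hd2 HEk2)|].
  right. unfold C1. fold N. ring.
Qed.

Lemma triangular_polynomially_stable alpha : 0 < alpha ->
  growth_rate TL 0 -> growth_rate Gam 0 -> growth_rate S 0 ->
  polynomial_decay TL alpha -> damped_first_component alpha -> polynomially_stable alpha S.
Proof.
  intros Ha HTL HG HS [M [t0 [HM [Ht0 Hdec]]]] [C [t1 [HC [Ht1 Hdamp]]]].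
  destruct (growth_rate_0_bounded TL HTL) as [BL [HBL HBLb]].
  destruct (growth_rate_0_bounded Gam HG) as [BG [HBG HBGb]].
  destruct (growth_rate_0_bounded S HS) as [B [HB HBb]].
  split; [exists B; exact HBb|].
  set (q := Rpower 2 (- alpha)). assert (Hq : 0 < q) by apply Rpower_pos.
  exists ((C + BG * M + BL * M) / q), (2 * Rmax t0 t1).
  assert (Hpos : 0 < C + BG * M + BL * M).
  { assert (0 < BG * M) by now apply Rmult_lt_0_compat. assert (0 < BL * M) by now apply Rmult_lt_0_compat. lra. }
  pose proof (Rmax_l t0 t1). pose proof (Rmax_r t0 t1).
  split; [now apply Rdiv_lt_0_compat|]. split; [lra|].
  intros t [x e] [y e1] Ht Hg.
  (* Half of the time lets the second component decay, the other half damps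
     the first one. *)
  set (s := t / 2). assert (Hs : Rmax t0 t1 <= s) by (unfold s; lra).
  assert (Ets : t = s + s) by (unfold s; field).
  assert (Ep : Rpower t (- alpha) = q * Rpower s (- alpha)).
  { unfold q. rewrite Rpower_mult_distr by lra. f_equal. lra. }
  set (N := norm ((y, e1) : XX) + norm ((x, e) : XX)).
  pose proof (proj1 (proj1 (S_generator x y e e1) Hg)) as HgL.
  pose proof (Rpower_pos s (- alpha)) as Hp.
  assert (HNe : norm e1 + norm e <= N).
  { pose proof (norm_snd_le ((x, e) : XX)) as Q1. pose proof (norm_snd_le ((y, e1) : XX)) as Q2.
    simpl in Q1, Q2. unfold N. now apply Rplus_le_compat. }
  pose proof (Hdec s e e1 ltac:(lra) HgL) as HdL.
  assert (HdL' : norm (TL s e) <= M * Rpower s (- alpha) * N).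
  { eapply Rle_trans; [exact HdL|]. apply Rmult_le_compat_l; [apply Rmult_le_pos; lra|exact HNe]. }
  pose proof (Hdamp s x y e e1 ltac:(lra) Hg) as HdK. fold N in HdK.
  assert (Q1 : norm (Gam s (TL s e)) <= BG * (M * Rpower s (- alpha) * N)).
  { eapply Rle_trans; [apply HBGb; lra|]. apply Rmult_le_compat_l; lra. }
  assert (Q2 : norm (TL s (TL s e)) <= BL * (M * Rpower s (- alpha) * N)).
  { eapply Rle_trans; [apply HBLb; lra|]. apply Rmult_le_compat_l; lra. }
  apply Rle_trans with (norm ((plus (TK s (fst (S s (x, e)))) (Gam s (TL s e)), TL s (TL s e)) : XX)).
  { right. f_equal. rewrite Ets. unfold S, triangular. simpl.
    rewrite (sg_add TK HK), (sg_add TL HL), Gam_law by lra. f_equal.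
    rewrite (linear_plus (TK s)) by (apply (sg_linear TK HK); lra). vmod. }
  eapply Rle_trans; [apply norm_pair_le|].
  eapply Rle_trans; [apply Rplus_le_compat_r, norm_triangle|].
  eapply Rle_trans; [apply (Rplus_le_compat _ _ _ _ (Rplus_le_compat _ _ _ _ HdK Q1) Q2)|].
  rewrite Ep. right. unfold N. field. lra.
Qed.

End TriangularStability.

(** * Similar semigroups *)

Section Similarity.
Context {F : scalar_field} {V : NormedModule F}.
Variables P P' : V -> V.
Hypothesis hP : is_linear P.
Hypothesis hP' : is_linear P'.
Hypothesis hPP' : forall x, P (P' x) = x.
Hypothesis hP'P : forall x, P' (P x) = x.
Variable T : R -> V -> V.

Definition similar (t : R) (x : V) : V := P (T t (P' x)).

Lemma similar_C0 : C0_semigroup T -> C0_semigroup similar.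
Proof.
  intros [H1 [H2 [H3 H4]]]. split; [|split; [|split]].
  - intros t Ht. apply (is_linear_comp P' (fun v => P (T t v))); [exact hP'|].
    apply (is_linear_comp (T t) P); [now apply H1|exact hP].
  - intros x. unfold similar. now rewrite H2.
  - intros s t x Hs Ht. unfold similar. now rewrite H3, hP'P by assumption.
  - intros x. pose proof (linear_lim (at_right 0) P _ _ hP (H4 (P' x))) as H.
    rewrite hPP' in H. exact H.
Qed.

Lemma similar_generator x y : generator similar x y <-> generator T (P' x) (P' y).
Proof.
  unfold generator, similar. split; intros H.
  - apply (filterlim_ext (fun t => P' (scal (ofR (/ t)) (minus (P (T t (P' x))) x)))).
    + intros t. rewrite (linear_scal P' hP'), (linear_sub P'), hP'P by exact hP'. reflexivity.
    + now apply linear_lim.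
  - apply (filterlim_ext (fun t => P (scal (ofR (/ t)) (minus (T t (P' x)) (P' x))))).
    + intros t. rewrite (linear_scal P hP), (linear_sub P), hPP' by exact hP. reflexivity.
    + rewrite <- (hPP' y). now apply linear_lim.
Qed.

Lemma similar_bound : exists C, 0 < C /\ forall t x M, norm (T t (P' x)) <= M * norm (P' x) -> 0 <= M ->
  norm (similar t x) <= C * M * norm x.
Proof.
  destruct (linear_norm P hP) as [M1 [HM1 H1]]. destruct (linear_norm P' hP') as [M2 [HM2 H2]].
  exists (M1 * M2). split; [now apply Rmult_lt_0_compat|]. intros t x M H HM.
  unfold similar. eapply Rle_trans; [apply H1|].
  replace (M1 * M2 * M * norm x) with (M1 * (M * (M2 * norm x))) by ring.
  apply Rmult_le_compat_l; [lra|]. eapply Rle_trans; [exact H|]. now apply Rmult_le_compat_l.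
Qed.

Lemma similar_growth_rate w : growth_rate T w -> growth_rate similar w.
Proof.
  intros H. destruct (growth_rate_pos T w H) as [M [HM HMb]].
  destruct similar_bound as [C [HC HCb]]. exists (C * M). intros t x Ht.
  rewrite (Rmult_assoc C M). apply HCb; [now apply HMb|].
  apply Rmult_le_pos; [lra|left; apply exp_pos].
Qed.

Lemma similar_strongly_stable : strongly_stable T -> strongly_stable similar.
Proof.
  intros H x. pose proof (linear_lim (Rbar_locally p_infty) P _ _ hP (H (P' x))) as HP.
  rewrite linear_0 in HP by exact hP. exact HP.
Qed.

Lemma similar_polynomially_stable alpha : polynomially_stable alpha T -> polynomially_stable alpha similar.
Proof.
  intros [HB [M [t0 [HM [Ht0 H]]]]]. split.
  - destruct (similar_growth_rate 0) as [B HBb].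
    + destruct HB as [B HBb]. now apply growth_rate_0 with B.
    + exists B. intros t x Ht. specialize (HBb t x Ht). now rewrite Rmult_0_l, exp_0, Rmult_1_r in HBb.
  - destruct (linear_norm P hP) as [M1 [HM1 H1]]. destruct (linear_norm P' hP') as [M2 [HM2 H2]].
    exists (M1 * M * M2), t0. split; [repeat apply Rmult_lt_0_compat; lra|]. split; [exact Ht0|].
    intros t x Ax Ht Hg. apply similar_generator in Hg. specialize (H t _ _ Ht Hg).
    unfold similar. eapply Rle_trans; [apply H1|].
    pose proof (Rpower_pos t (- alpha)) as Hp. pose proof (H2 x). pose proof (H2 Ax).
    apply Rle_trans with (M1 * (M * Rpower t (- alpha) * (M2 * (norm Ax + norm x)))); [|right; ring].
    apply Rmult_le_compat_l; [lra|]. eapply Rle_trans; [exact H|].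
    apply Rmult_le_compat_l; [apply Rmult_le_pos; lra|]. lra.
Qed.

End Similarity.

Lemma similar_growth_bound {F : scalar_field} {V : NormedModule F} (P P' : V -> V) (T : R -> V -> V) :
  is_linear P -> is_linear P' -> (forall x, P (P' x) = x) -> (forall x, P' (P x) = x) ->
  growth_bound (similar P P' T) = growth_bound T.
Proof.
  intros hP hP' hPP' hP'P.
  assert (H : forall w, growth_rate (similar P P' T) w <-> growth_rate T w).
  { intros w. split; [|now apply similar_growth_rate].
    intros H. apply (similar_growth_rate P' P) in H; try assumption.
    destruct H as [M HM]. exists M. intros t x Ht. specialize (HM t x Ht).
    unfold similar in HM. now rewrite !hP'P in HM. }
  apply is_glb_Rbar_unique. fold (growth_rate (similar P P' T)).
  destruct (Glb_Rbar_correct (growth_rate T)) as [H1 H2].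
  change (Glb_Rbar (growth_rate T)) with (growth_bound T) in *. split.
  - intros w Hw. apply H1. now apply H.
  - intros b Hb. apply H2. intros w Hw. apply Hb. now apply H.
Qed.

Section Shear.
Context {F : scalar_field} {X : NormedModule F}.
Let XX := prod_NormedModule F X X.

(** From state and error to state and observer state. *)
Definition shear (z : XX) : XX := (fst z, plus (fst z) (snd z)).
Definition unshear (z : XX) : XX := (fst z, minus (snd z) (fst z)).

Lemma shear_linear : is_linear shear.
Proof.
  constructor.
  - intros [x e] [x' e']. apply injective_projections; [reflexivity|].
    change (plus (plus x x') (plus e e') = plus (plus x e) (plus x' e')). vmod.
  - intros k [x e]. apply injective_projections; [reflexivity|].
    change (plus (scal k x) (scal k e) = scal k (plus x e)).
    symmetry. exact (linear_plus _ (is_linear_scalar k) x e).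
  - exists 3. split; [lra|]. intros z. eapply Rle_trans; [apply norm_pair_le|].
    pose proof (norm_fst_le z) as H1. pose proof (norm_snd_le z) as H2.
    replace (3 * norm z) with (norm z + (norm z + norm z)) by ring.
    apply Rplus_le_compat; [exact H1|]. eapply Rle_trans; [apply norm_triangle|].
    apply Rplus_le_compat; assumption.
Qed.

Lemma unshear_linear : is_linear unshear.
Proof.
  constructor.
  - intros [x e] [x' e']. apply injective_projections; [reflexivity|].
    change (minus (plus e e') (plus x x') = plus (minus e x) (minus e' x')). vmod.
  - intros k [x e]. apply injective_projections; [reflexivity|].
    change (minus (scal k e) (scal k x) = scal k (minus e x)).
    symmetry. exact (linear_sub _ e x (is_linear_scalar k)).
  - exists 3. split; [lra|]. intros z. eapply Rle_trans; [apply norm_pair_le|].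
    pose proof (norm_fst_le z) as H1. pose proof (norm_snd_le z) as H2.
    replace (3 * norm z) with (norm z + (norm z + norm z)) by ring.
    apply Rplus_le_compat; [exact H1|]. eapply Rle_trans; [apply norm_minus_le|].
    apply Rplus_le_compat; assumption.
Qed.

Lemma shear_unshear z : shear (unshear z) = z.
Proof.
  destruct z as [x e]. apply injective_projections; [reflexivity|].
  change (plus x (minus e x) = e). vmod.
Qed.

Lemma unshear_shear z : unshear (shear z) = z.
Proof.
  destruct z as [x e]. apply injective_projections; [reflexivity|].
  change (minus (plus x e) x = e). vmod.
Qed.

End Shear.

(** * The closed loop *)

Section ClosedLoop.
Context {F : scalar_field} {Z X Ub U Y : NormedModule F}.
Variables (j fA : Z -> X) (fB : Z -> Ub) (fC : Z -> Y) (Q : U -> Ub) (Bi : U -> X).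
Variables (fK : Z -> U) (L : Y -> Ub) (Li : Y -> X).
Hypothesis hj : is_linear j.
Hypothesis hfA : is_linear fA.
Hypothesis hfB : is_linear fB.
Hypothesis hfC : is_linear fC.
Hypothesis hQ : is_linear Q.
Hypothesis hBi : is_linear Bi.
Hypothesis hfK : is_linear fK.
Hypothesis hL : is_linear L.
Hypothesis hLi : is_linear Li.

(** In terms of the state [z1] and the error [z2 - z1] the closed loop is a
    cascade: the error evolves freely under [A_L], and its observation by [fK]
    is the input of the node of [A_K]. *)
Lemma closed_loop_cascade (z1 z2 : Z) :
  (minus (fB z1) (Q (fK z2)) = zero /\
   plus (L (fC z1)) (minus (minus (fB z2) (Q (fK z2))) (L (fC z2))) = zero) <->
  (minus (fB (minus z2 z1)) (L (fC (minus z2 z1))) = zero /\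
   minus (fB z1) (Q (fK z1)) = Q (fK (minus z2 z1))).
Proof.
  rewrite (linear_sub fB), (linear_sub fC), (linear_sub L), (linear_sub fK), (linear_sub Q) by assumption.
  set (b1 := fB z1). set (b2 := fB z2). set (q1 := Q (fK z1)). set (q2 := Q (fK z2)).
  set (l1 := L (fC z1)). set (l2 := L (fC z2)).
  split.
  - intros [H1 H2]. split.
    + transitivity (minus (plus l1 (minus (minus b2 q2) l2)) (minus b1 q2)); [vmod|].
      rewrite H1, H2. vmod.
    + transitivity (plus (minus b1 q2) (minus q2 q1)); [vmod|]. rewrite H1. vmod.
  - intros [H1 H2].
    assert (H3 : minus b1 q2 = zero).
    { transitivity (minus (minus b1 q1) (minus q2 q1)); [vmod|]. rewrite H2. vmod. }
    split; [exact H3|].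
    transitivity (plus (minus (minus b2 b1) (minus l2 l1)) (minus b1 q2)); [vmod|].
    rewrite H1, H3. vmod.
Qed.

Lemma closed_loop_error_rate (z1 z2 : Z) :
  minus (plus (opp (Li (fC z1))) (plus (plus (fA z2) (Bi (fK z2))) (Li (fC z2))))
        (plus (fA z1) (Bi (fK z2))) =
  plus (fA (minus z2 z1)) (Li (fC (minus z2 z1))).
Proof.
  rewrite (linear_sub fA), (linear_sub fC), (linear_sub Li) by assumption. vmod.
Qed.

Lemma closed_loop_state_rate (z1 z2 : Z) :
  plus (plus (fA z1) (Bi (fK z1))) (Bi (fK (minus z2 z1))) = plus (fA z1) (Bi (fK z2)).
Proof. rewrite (linear_sub fK), (linear_sub Bi) by assumption. vmod. Qed.

End ClosedLoop.

Section Main.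
Context {F : scalar_field} {Z X Ub U Y : NormedModule F}.
Hypothesis hZ : is_complete Z.
Hypothesis hX : is_complete X.
Hypothesis hU : is_complete U.
Variables (j fA : Z -> X) (fB : Z -> Ub) (fC : Z -> Y) (Q : U -> Ub) (Bi : U -> X).
Variables (fK : Z -> U) (L : Y -> Ub) (Li : Y -> X).
Hypothesis hj : is_linear j.
Hypothesis hjinj : forall z z', j z = j z' -> z = z'.
Hypothesis hfA : is_linear fA.
Hypothesis hfB : is_linear fB.
Hypothesis hfC : is_linear fC.
Hypothesis hQ : is_linear Q.
Hypothesis hBi : is_linear Bi.
Hypothesis hfK : is_linear fK.
Hypothesis hL : is_linear L.
Hypothesis hLi : is_linear Li.

Let fA_K := fun z : Z => plus (fA z) (Bi (fK z)).
Let fB_K := fun z : Z => minus (fB z) (Q (fK z)).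
Let fA_L := fun z : Z => plus (fA z) (Li (fC z)).
Let fB_L := fun z : Z => minus (fB z) (L (fC z)).
Let XX := prod_NormedModule F X X.
Let ZZ := prod_NormedModule F Z Z.
Let UU := prod_NormedModule F Ub Ub.
Let j_e : ZZ -> XX := fun z => (j (fst z), j (snd z)).
Let fA_e : ZZ -> XX := fun z =>
    (plus (fA (fst z)) (Bi (fK (snd z))),
     plus (opp (Li (fC (fst z))))
       (plus (plus (fA (snd z)) (Bi (fK (snd z)))) (Li (fC (snd z))))).
Let fB_e : ZZ -> UU := fun z =>
    (minus (fB (fst z)) (Q (fK (snd z))),
     plus (L (fC (fst z)))
       (minus (minus (fB (snd z)) (Q (fK (snd z)))) (L (fC (snd z))))).

Variable fBr : Ub -> Z.
Hypothesis hfBr : is_linear fBr.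
Hypothesis hBr : forall v, fB_K (fBr v) = v.
Variables TK TL : R -> X -> X.
Hypothesis hTK : generates (restrict_ker j fA_K fB_K) TK.
Hypothesis hTL : generates (restrict_ker j fA_L fB_L) TL.

Let E : U -> X := input_state j Q fBr.
Let G : U -> X := input_rate fA_K Q Bi fBr.
Let kappa : X -> U := fun x => fK (lift j fB_L x).

Hypothesis hinput : exists tau M, 0 < tau /\ 0 < M /\ input_bound TK E G tau M.
Hypothesis houtput : exists tau M, 0 < tau /\ 0 < M /\ output_bound TL kappa tau M.

Lemma fA_K_linear : is_linear fA_K.
Proof. apply is_linear_sum; [exact hfA|now apply (is_linear_comp fK Bi)]. Qed.

Lemma fB_K_linear : is_linear fB_K.
Proof. apply is_linear_difference; [exact hfB|now apply (is_linear_comp fK Q)]. Qed.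

Lemma fA_L_linear : is_linear fA_L.
Proof. apply is_linear_sum; [exact hfA|now apply (is_linear_comp fC Li)]. Qed.

Lemma fB_L_linear : is_linear fB_L.
Proof. apply is_linear_difference; [exact hfB|now apply (is_linear_comp fC L)]. Qed.

(** On both sides there is an element [z2 - z1] of the kernel for [A_L] and a
    state [z1] whose boundary condition has the observation of that element as
    input: [closed_loop_cascade] matches the boundary conditions, and the two
    lemmas after it the rates. *)
Lemma closed_loop_generator (Te : R -> XX -> XX) (x y : XX) :
  (forall x y e e1 : X, generator Te ((x, e) : XX) ((y, e1) : XX) <->
    generator TL e e1 /\ generator TK (minus x (E (kappa e))) (minus y (G (kappa e)))) ->
  restrict_ker j_e fA_e fB_e x y <-> generator Te (unshear x) (unshear y).
Proof.
  intros HTe. destruct x as [x1 x2], y as [y1 y2]. unfold unshear; simpl. rewrite HTe.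
  pose proof (controlled_domain j fA_K fB_K Q Bi fBr hj hjinj fA_K_linear fB_K_linear hBr TK hTK) as Hc.
  unfold E, G. rewrite <- Hc. clear Hc.
  split.
  - intros [[z1 z2] [HB [Hj HA]]].
    unfold fB_e, j_e, fA_e in *. simpl in HB, Hj, HA.
    apply (f_equal fst) in HB as HB1. apply (f_equal snd) in HB as HB2.
    injection Hj as <- <-. injection HA as <- <-. simpl in HB1, HB2.
    destruct (proj1 (closed_loop_cascade fB fC Q fK L hfB hfC hQ hfK hL z1 z2) (Logic.conj HB1 HB2)) as [H1 H2].
    assert (Ee : minus (j z2) (j z1) = j (minus z2 z1)) by (symmetry; now apply linear_sub).
    assert (Ek : kappa (j (minus z2 z1)) = fK (minus z2 z1)).
    { unfold kappa. f_equal. apply (lift_j j fB_L hjinj). exact H1. }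
    split.
    + apply (generator_eq TL _ _ _ _ (generator_of_kernel j fA_L fB_L TL hTL (minus z2 z1) H1)).
      * symmetry. exact Ee.
      * symmetry. exact (closed_loop_error_rate fA fC Bi fK Li hfA hfC hLi z1 z2).
    + exists z1. assert (Ek' : kappa (minus (j z2) (j z1)) = fK (minus z2 z1)) by (rewrite Ee; exact Ek).
      split; [|split; [reflexivity|]].
      * transitivity (Q (fK (minus z2 z1))); [exact H2|]. f_equal. symmetry. exact Ek'.
      * etransitivity; [|exact (closed_loop_state_rate fA Bi fK hBi hfK z1 z2)].
        unfold fA_K. do 2 f_equal. exact Ek'.
  - intros [HgL [z1 [HB1 [Hj1 HA1]]]].
    destruct (lift_spec j fA_L fB_L hjinj TL hTL _ _ HgL) as [H0 [H1 H2]].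
    set (ze := lift j fB_L (minus x2 x1)) in *.
    assert (Ek : kappa (minus x2 x1) = fK ze) by reflexivity.
    set (z2 := plus z1 ze).
    assert (Ez : minus z2 z1 = ze) by (unfold z2; vmod).
    exists (z1, z2).
    assert (HH : minus (fB (minus z2 z1)) (L (fC (minus z2 z1))) = zero /\
      minus (fB z1) (Q (fK z1)) = Q (fK (minus z2 z1))).
    { rewrite Ez. split; [exact H0|]. rewrite <- Ek. exact HB1. }
    apply (closed_loop_cascade fB fC Q fK L hfB hfC hQ hfK hL z1 z2) in HH. destruct HH as [HH1 HH2].
    assert (Ey1 : plus (fA z1) (Bi (fK z2)) = y1).
    { rewrite <- (closed_loop_state_rate fA Bi fK hBi hfK z1 z2), Ez, <- Ek. exact HA1. }
    split; [|split].
    + apply injective_projections; [exact HH1|exact HH2].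
    + apply injective_projections; [exact Hj1|].
      change (j z2 = x2). unfold z2. rewrite (linear_plus j hj), Hj1, H1. vmod.
    + apply injective_projections; [exact Ey1|].
      change (plus (opp (Li (fC z1))) (plus (plus (fA z2) (Bi (fK z2))) (Li (fC z2))) = y2).
      pose proof (closed_loop_error_rate fA fC Bi fK Li hfA hfC hLi z1 z2) as Hr.
      rewrite Ez, Ey1 in Hr.
      assert (Hr' : minus (plus (opp (Li (fC z1))) (plus (plus (fA z2) (Bi (fK z2))) (Li (fC z2)))) y1 = minus y2 y1).
      { rewrite Hr. exact H2. }
      set (a := plus (opp (Li (fC z1))) (plus (plus (fA z2) (Bi (fK z2))) (Li (fC z2)))) in *.
      transitivity (plus (minus a y1) y1); [vmod|]. rewrite Hr'. vmod.
Qed.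

Theorem closed_loop_stability : exists T_e : R -> XX -> XX,
    generates (restrict_ker j_e fA_e fB_e) T_e /\
    (exponentially_stable TK -> exponentially_stable TL ->
     exponentially_stable T_e /\
     growth_bound T_e = Rbar_max (growth_bound TK) (growth_bound TL)) /\
    (strongly_stable TK /\ exponentially_stable TL \/
     exponentially_stable TK /\ strongly_stable TL ->
     strongly_stable T_e) /\
    (forall alpha : R, 0 < alpha ->
     polynomially_stable alpha TK /\ exponentially_stable TL \/
     exponentially_stable TK /\ polynomially_stable alpha TL ->
     polynomially_stable alpha T_e).
Proof.
  pose proof (proj1 hTK) as HK. pose proof (proj1 hTL) as HL.
  pose proof fA_K_linear as lAK. pose proof fB_K_linear as lBK.
  pose proof fA_L_linear as lAL. pose proof fB_L_linear as lBL.
  assert (hE : is_linear E) by now apply input_state_linear.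
  assert (hG : is_linear G) by now apply input_rate_linear.
  assert (k_plus : forall x x' y y', generator TL x y -> generator TL x' y' ->
    kappa (plus x x') = plus (kappa x) (kappa x')).
  { intros x x' y y' H H'. unfold kappa.
    rewrite (lift_plus j fA_L fB_L hj hjinj lBL TL hTL x x' y y') by assumption. now apply linear_plus. }
  assert (k_scal : forall (k : F) x y, generator TL x y -> kappa (scal k x) = scal k (kappa x)).
  { intros k x y H. unfold kappa.
    rewrite (lift_scal j fA_L fB_L hj hjinj lBL TL hTL k x y) by assumption. now apply linear_scal. }
  assert (k_minus : forall x x' y y', generator TL x y -> generator TL x' y' ->
    kappa (minus x x') = minus (kappa x) (kappa x')).
  { intros x x' y y' H H'. unfold kappa.
    rewrite (lift_minus j fA_L fB_L hj hjinj lBL TL hTL x x' y y') by assumption. now apply linear_sub. }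
  assert (k_cont : forall x y, generator TL x y -> cont (fun s => kappa (TL (Rmax 0 s) x))).
  { intros x y H. apply (cont_linear fK); [exact hfK|].
    now apply (lift_orbit_cont hZ hX j fA_L fB_L hj hjinj lBL TL hTL x y). }
  assert (k_int : forall x y y' t, 0 <= t -> generator TL x y -> generator TL y y' ->
    kappa (TL t x) = plus (kappa x) (integral (fun s => kappa (TL (Rmax 0 s) y)) 0 t)).
  { intros x y y' t Ht H H'. unfold kappa.
    rewrite (lift_orbit_integral hZ hX j fA_L fB_L hj hjinj lBL TL hTL x y y' t) by assumption.
    rewrite (linear_plus fK hfK). f_equal. symmetry. apply (integral_linear hZ fK); [exact hfK|].
    now apply (lift_orbit_cont hZ hX j fA_L fB_L hj hjinj lBL TL hTL y y'). }
  assert (k_bound : exists C, 0 < C /\ forall x y : X, generator TL x y ->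
    norm (kappa x) <= C * (norm x + norm y)).
  { destruct (lift_graph_bound hZ hX j fA_L fB_L hj hjinj lBL TL hTL) as [C [HC H]].
    destruct (linear_norm fK hfK) as [M [HM HMb]]. exists (M * C). split; [now apply Rmult_lt_0_compat|].
    intros x y Hg. eapply Rle_trans; [apply HMb|]. rewrite Rmult_assoc.
    apply Rmult_le_compat_l; [lra|]. now apply H. }
  destruct (coupling_operators hX hU TK TL HK HL E G hE hG kappa k_plus k_scal k_cont k_int hinput houtput)
    as [Gam [G1 [G2 [G3 [G4 G5]]]]].
  assert (G6 : forall e e1 : X, smooth TL e e1 -> forall eps, 0 < eps ->
    exists d, 0 < d /\ forall h, 0 < h < d ->
    norm (minus (plus (minus (TK h (E (kappa e))) (E (kappa e))) (Gam h e))
                (scal (ofR h) (G (kappa e)))) <= eps * h).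
  { intros e e1 Hs eps He.
    destruct (coupling_derivative hX hU TK TL HK HL E G hE hG kappa k_cont k_int e e1 Hs eps He) as [d [Hd H]].
    exists d. split; [exact Hd|]. intros h Hh. rewrite (G3 h e e1) by (lra || exact Hs). now apply H. }
  set (S := triangular TK TL Gam).
  assert (HS : C0_semigroup S) by now apply triangular_C0.
  assert (HSg : forall x y e e1 : X, generator S ((x, e) : XX) ((y, e1) : XX) <->
    generator TL e e1 /\ generator TK (minus x (E (kappa e))) (minus y (G (kappa e)))).
  { intros x y e e1. now apply (triangular_generator (U := U)). }
  exists (similar shear unshear S).
  assert (hsim : forall alpha, 0 < alpha -> polynomially_stable alpha S ->
    polynomially_stable alpha (similar shear unshear S)).
  { intros alpha _. apply similar_polynomially_stable;
     [apply shear_linear|apply unshear_linear|apply shear_unshear|apply unshear_shear]. }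
  split; [split|split; [|split]].
  - apply similar_C0; [apply shear_linear|apply unshear_linear|apply shear_unshear|apply unshear_shear|exact HS].
  - intros x y. transitivity (generator S (unshear x) (unshear y)).
    + now apply closed_loop_generator.
    + symmetry. apply (similar_generator (V := XX) shear unshear);
        [apply shear_linear|apply unshear_linear|apply shear_unshear|apply unshear_shear].
  - intros H1 H2.
    assert (Heq : growth_bound (similar shear unshear S) = Rbar_max (growth_bound TK) (growth_bound TL)).
    { etransitivity; [apply (similar_growth_bound (V := XX) shear unshear S);
        [apply shear_linear|apply unshear_linear|apply shear_unshear|apply unshear_shear]|].
      now apply triangular_growth_bound. }
    split; [|exact Heq]. apply (eq_ind_r (fun b => Rbar_lt b 0)) with (2 := Heq).
    unfold Rbar_max. destruct Rbar_le_dec; assumption.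
  - intros H. apply similar_strongly_stable; [apply shear_linear|].
    assert (HK0 : growth_rate TK 0).
    { destruct H as [[H _]|[H _]]; [now apply strongly_stable_bounded|now apply exponentially_stable_bounded]. }
    assert (HL0 : growth_rate TL 0).
    { destruct H as [[_ H]|[_ H]]; [now apply exponentially_stable_bounded|now apply strongly_stable_bounded]. }
    apply triangular_strongly_stable; try assumption.
    + destruct H as [[H _]|[H _]]; [exact H|now apply exponentially_strongly_stable].
    + destruct H as [[_ H]|[_ H]]; [now apply exponentially_strongly_stable|exact H].
    + apply (Gam_uniformly_bounded TK TL Gam); try assumption.
      destruct H as [[_ H]|[H _]]; [left|right]; now split.
  - intros alpha Ha H. apply hsim; [exact Ha|].
    assert (HK0 : growth_rate TK 0).
    { destruct H as [[H _]|[H _]]; [now apply polynomially_stable_bounded with alpha|now apply exponentially_stable_bounded]. }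
    assert (HL0 : growth_rate TL 0).
    { destruct H as [[_ H]|[_ H]]; [now apply exponentially_stable_bounded|now apply polynomially_stable_bounded with alpha]. }
    assert (HG0 : growth_rate Gam 0).
    { apply (Gam_uniformly_bounded TK TL Gam); try assumption.
      destruct H as [[_ H]|[H _]]; [left|right]; now split. }
    assert (HS0 : growth_rate S 0) by now apply triangular_growth_rate.
    apply (triangular_polynomially_stable TK TL Gam HK HL G4 E G kappa HSg alpha Ha HL0 HG0 HS0).
    + destruct H as [[_ H]|[_ [_ H]]]; [now apply exponentially_polynomial_decay|exact H].
    + destruct H as [[[_ Hd] He]|[He _]].
      * now apply (damped_of_polynomial TK TL Gam HK E G hE hG kappa k_bound HSg).
      * now apply (damped_of_exponential TK TL Gam).
Qed.

End Main.

Theorem corollary3p4 (F : scalar_field) (Z Ub U X Y : HilbertSpace F)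
    (j : Z -> X) (fB : Z -> Ub) (fA : Z -> X) (fC : Z -> Y)
    (Q : U -> Ub) (Bi : U -> X)
    (fK : Z -> U) (L : Y -> Ub) (Li : Y -> X)
    (hnode : boundary_node j fB fA fC Q Bi)
    (hfK : is_linear fK) (hL : is_linear L) (hLi : is_linear Li) :
  let fA_K := fun z : Z => plus (fA z) (Bi (fK z)) in
  let fB_K := fun z : Z => minus (fB z) (Q (fK z)) in
  let fA_L := fun z : Z => plus (fA z) (Li (fC z)) in
  let fB_L := fun z : Z => minus (fB z) (L (fC z)) in
  let XX := prod_NormedModule F X X in
  let ZZ := prod_NormedModule F Z Z in
  let UU := prod_NormedModule F Ub Ub in
  let j_e : ZZ -> XX := fun z => (j (fst z), j (snd z)) in
  let fA_e : ZZ -> XX := fun z =>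
    (plus (fA (fst z)) (Bi (fK (snd z))),
     plus (opp (Li (fC (fst z))))
       (plus (plus (fA (snd z)) (Bi (fK (snd z)))) (Li (fC (snd z))))) in
  let fB_e : ZZ -> UU := fun z =>
    (minus (fB (fst z)) (Q (fK (snd z))),
     plus (L (fC (fst z)))
       (minus (minus (fB (snd z)) (Q (fK (snd z)))) (L (fC (snd z))))) in
  forall (hnode_K : boundary_node j fB_K fA_K fC Q Bi)
    (hinput : wellposed_input_map j fB_K fA_K fC Q Bi)
    (hnode_L : boundary_node j fB_L fA_L fK Q Bi)
    (houtput : wellposed_output_map j fB_L fA_L fK Q Bi)
    (T_K T_L : R -> X -> X)
    (hT_K : generates (restrict_ker j fA_K fB_K) T_K)
    (hT_L : generates (restrict_ker j fA_L fB_L) T_L),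
  exists T_e : R -> XX -> XX,
    generates (restrict_ker j_e fA_e fB_e) T_e /\
    (exponentially_stable T_K -> exponentially_stable T_L ->
     exponentially_stable T_e /\
     growth_bound T_e = Rbar_max (growth_bound T_K) (growth_bound T_L)) /\
    (strongly_stable T_K /\ exponentially_stable T_L \/
     exponentially_stable T_K /\ strongly_stable T_L ->
     strongly_stable T_e) /\
    (forall alpha : R, 0 < alpha ->
     polynomially_stable alpha T_K /\ exponentially_stable T_L \/
     exponentially_stable T_K /\ polynomially_stable alpha T_L ->
     polynomially_stable alpha T_e).
Proof.
  intros.
  destruct (node_right_inverse _ _ _ _ _ _ hnode_K) as [fBr [hfBr hBr]].
  pose proof (input_map_estimate j fB_K fA_K fC Q Bi fBr T_K hnode_K hinput hfBr hBr hT_K) as Hin.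
  pose proof (output_map_estimate j fB_L fA_L fK Q Bi T_L hnode_L houtput hT_L) as Hout.
  destruct hnode as [hj hjinj hfA hfB hfC hQ hBi _ _].
  exact (closed_loop_stability (Z := Z) (X := X) (Ub := Ub) (U := U) (Y := Y)
    (is_complete_CompleteNormedModule Z) (is_complete_CompleteNormedModule X)
    (is_complete_CompleteNormedModule U) j fA fB fC Q Bi fK L Li hj hjinj hfA hfB hfC hQ hBi
    hfK hL hLi fBr hfBr hBr T_K T_L hT_K hT_L Hin Hout).
Qed.
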